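(* Let $D$ be a discriminant form of the special shape described in the context, with level $N=|D|$, even signature $r$, character $\chi_D$ and sign vector $\epsilon$, and let $k$ be an integer with $k\equiv\frac r2\pmod 2$. Let $f=\sum_na(n)q^n\in A^\epsilon(N,k,\chi_D)$, let $s$ be a cusp of $\Gamma_0(N)$ and let $q_s$ be the local parameter at $s$. Let $N_2$ be the $2$-part of $N$ and fix any positive odd divisor $m_1$ of $N$. Then: (1) If $s\sim\frac1m$ with $m=m_1$ or $m=N_2m_1$, then the Fourier expansion of $f$ at $s$ contains precisely the powers of the form $q_s^n$ with $a(nN/m)\ne0$. (2) If $4\mid N$ and $s\sim\frac1{2m_1}$, then the Fourier expansion of $f$ at $s$ contains at most powers of the form $q_s^{n/2}$ with $a(nN/2m_1)\neq0$. (3) If $8\mid N$ and $s\sim\frac1{4m_1}$, then the Fourier expansion of $f$ at $s$ contains at most powers of the form $q_s^{n/2}$ with $a(nN/4m_1)\ne0$. Here $n$ ranges over integers.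
   Context: Discriminant forms: a discriminant form is a finite abelian group $D$ with a quadratic form $q:D\to\mathbb Q/\mathbb Z$ with nondegenerate associated bilinear form; its level is the smallest positive $N$ with $Nq=0$ on $D$; its signature in $\mathbb Z/8\mathbb Z$ is the signature mod 8 of any even lattice $L$ with $L'/L\cong D$. Shape of $D$: $D=\bigoplus_p D_p$ (orthogonal sum over primes). For odd $p$, $D_p$ is trivial or $D_p=p^{\delta_p}$, $\delta_p\in\{\pm1\}$: cyclic of order $p$ with a generator $\gamma$ with $q(\gamma)=a/p$, $\delta_p=\left(\frac{2a}{p}\right)$. For $p=2$, $D_2$ is one of: trivial; $2_t^{+2}$ with $t\in\{\pm2\}$, i.e. the orthogonal sum of two cyclic groups of order 2 whose generators both have $q$-value $\frac{t/2}{4}$; or $2_{t_1}^{+1}\oplus4_{t_2}^{\delta_2}$ with $t_1\in\{\pm1\}$, $t_2\in\{\pm1,\pm3\}$, $\delta_2=\left(\frac{2}{t_2}\right)$, i.e. the orthogonal sum of a cyclic group of order 2 with generator of $q$-value $t_1/4$ and a cyclic group of order 4 with generator of $q$-value $t_2/8$. Then the level is $N=|D|$ and the signature $r$ is even. Character: $\chi_D=\prod_{p\mid N}\chi_p$; $\chi_p=\left(\frac{\cdot}{p}\right)$ for odd $p\mid N$; $\chi_2$ is trivial if $D_2$ is trivial, $\left(\frac{-4}{\cdot}\right)$ if $D_2=2_t^{+2}$, and $\left(\frac{-2a}{\cdot}\right)$ with $a=\left(\frac{-1}{t_1t_2}\right)$ if $D_2=2_{t_1}^{+1}\oplus4_{t_2}^{\delta_2}$.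 Sign vector: $\epsilon=(\epsilon_p)_{p\mid N}$ with $\epsilon_p=\chi_p(2N/p)\delta_p$ for odd $p$; $\epsilon_2=\chi_2(Nt/8)$ if $D_2=2_t^{+2}$; $\epsilon_2=\chi_2(t_2N/8)$ if $D_2=2_{t_1}^{+1}\oplus 4_{t_2}^{\delta_2}$. Forms: $A(N,k,\chi_D)$ is the space of weakly holomorphic modular forms of weight $k$, level $\Gamma_0(N)$ and character $\chi_D$ (holomorphic on the upper half plane, meromorphic at all cusps); here $q=e^{2\pi i\tau}$. $A^\epsilon(N,k,\chi_D)$ is the subspace of $f=\sum_na(n)q^n$ with $a(n)=0$ whenever $\chi_p(n)=-\epsilon_p$ for some prime $p\mid N$. Cusps: $\sim$ denotes $\Gamma_0(N)$-equivalence. The local parameter at a cusp $s$ of width $h_s$ is $q_s=q^{1/h_s}$, and the Fourier expansion of $f$ at $s$ is that of $f|_k\alpha$ for $\alpha\in\mathrm{SL}_2(\mathbb Z)$ with $\alpha\infty\sim s$ (the set of exponents occurring with nonzero coefficient does not depend on $\alpha$), where $(f|_k\alpha)(\tau)=(c\tau+d)^{-k}f(\alpha\tau)$ for $\alpha=\begin{pmatrix}a&b\\c&d\end{pmatrix}$. ''Contains'' a power means it occurs with nonzero coefficient. *)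

(* Defs.v *)
From HB Require Import structures.
From mathcomp Require Import all_boot all_order all_algebra all_fingroup all_solvable.
From mathcomp Require Import archimedean complex.
From mathcomp Require Import classical_sets reals topology normedtype sequences derive exp trigo.

Set Implicit Arguments.
Unset Strict Implicit.
Unset Printing Implicit Defensive.

Import Order.TTheory GRing.Theory Num.Theory.
Import numFieldNormedType.Exports.

Local Open Scope ring_scope.
Local Open Scope complex_scope.

Definition legendre (a : int) (p : nat) : int :=
  if (p %| a)%Z then 0
  else if [exists x : 'I_p, (p %| (x : nat)%:Z ^+ 2 - a)%Z] then 1 else -1.

Definition kronecker2 (a : int) : int :=
  if (2 %| a)%Z then 0
  else if ((a %% 8)%Z == 1) || ((a %% 8)%Z == 7) then 1 else -1.

(* The Kronecker symbol (a/n) for arbitrary integers a, n: besides the prime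
   factors of |n| there is the factor (a/-1) for n < 0, and (a/0) is 1 exactly
   for a = 1, -1. *)
Definition kronecker (a n : int) : int :=
  if n == 0 then (`|a|%N == 1%N)%:R
  else (if (n < 0) && (a < 0) then -1 else 1)
       * \prod_(p <- primes `|n|%N)
            (if p == 2%N then kronecker2 a else legendre a p)
              ^+ logn p `|n|%N.

(* A map D -> Q/Z is represented by a lift D -> rat, and equality in Q/Z by
   congruence modulo 1. *)
Definition eqQZ (x y : rat) : Prop := x - y \is a Num.int.

Definition bilin (D : zmodType) (q : D -> rat) (x y : D) : rat :=
  q (x + y) - q x - q y.

Record discriminant_form (D : finZmodType) (q : D -> rat) : Prop := {
  df_quad : forall (n : int) (x : D), eqQZ (q (x *~ n)) (n%:~R ^+ 2 * q x);
  df_bilin : forall x y z : D,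
    eqQZ (bilin q (x + y) z) (bilin q x z + bilin q y z);
  df_nondeg : forall x : D, (forall y : D, eqQZ (bilin q x y) 0) -> x = 0 }.

Definition annihilates (D : finZmodType) (q : D -> rat) (N : nat) : Prop :=
  forall x : D, eqQZ (N%:R * q x) 0.

Definition is_level (D : finZmodType) (q : D -> rat) (N : nat) : Prop :=
  [/\ (0 < N)%N, annihilates q N &
      forall M : nat, (0 < M)%N -> annihilates q M -> (N <= M)%N].

(* The lattice Z^n with Gram matrix G, sitting in Q^n (row vectors). *)
Definition even_lattice (n : nat) (G : 'M[int]_n) : Prop :=
  [/\ G^T = G, \det G != 0 & forall i, (2 %| G i i)%Z].

Definition gram (n : nat) (G : 'M[int]_n) : 'M[rat]_n :=
  map_mx (fun z : int => z%:~R) G.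

Definition in_lattice (n : nat) (x : 'rV[rat]_n) : Prop :=
  forall i, x 0 i \is a Num.int.

Definition in_dual (n : nat) (G : 'M[int]_n) (x : 'rV[rat]_n) : Prop :=
  in_lattice (x *m gram G).

Definition lattice_q (n : nat) (G : 'M[int]_n) (x : 'rV[rat]_n) : rat :=
  (x *m gram G *m x^T) 0 0 / 2.

Definition lattice_signature (n : nat) (G : 'M[int]_n) (s : int) : Prop :=
  exists (P : 'M[rat]_n) (d : 'rV[rat]_n),
    [/\ P \in unitmx, P *m gram G *m P^T = diag_mx d &
        s = #|[set i | 0 < d 0 i]|%:Z - #|[set i | d 0 i < 0]|%:Z].

(* An isomorphism L'/L -> D of quadratic forms, given as a map phi on L' that is
   additive, onto, and has kernel L; its values outside L' are irrelevant. *)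
Definition dual_quotient_iso (n : nat) (G : 'M[int]_n) (D : finZmodType)
    (q : D -> rat) : Prop :=
  exists phi : 'rV[rat]_n -> D,
    [/\ forall x y, in_dual G x -> in_dual G y -> phi (x + y) = phi x + phi y,
        forall g : D, exists2 x, in_dual G x & phi x = g,
        forall x, in_dual G x -> (phi x = 0 <-> in_lattice x) &
        forall x, in_dual G x -> eqQZ (q (phi x)) (lattice_q G x)].

Definition has_signature (D : finZmodType) (q : D -> rat) (r : int) : Prop :=
  exists (n : nat) (G : 'M[int]_n) (s : int),
    [/\ even_lattice G, dual_quotient_iso G q,
        lattice_signature G s & (s = r %[mod 8])%Z].

(* Dyadic22 t is 2_t^{+2}; Dyadic24 t1 t2 is 2_{t1}^{+1} + 4_{t2}^{delta_2},
   where delta_2 = (2/t2) is determined by t2. *)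
Inductive dyadic : Type :=
  | DyadicTriv
  | Dyadic22 of int
  | Dyadic24 of int & int.

(* The orthogonal decomposition of D into its p-parts pcore p D is automatic, so
   the shape only constrains each of these. *)
Definition odd_shape (D : finZmodType) (q : D -> rat) (delta : nat -> int) :
    Prop :=
  forall p : nat, prime p -> odd p ->
    (pcore p [set: D] = 1)%g \/
    exists (g : D) (a : int),
      [/\ (<[g]> = pcore p [set: D])%g, #[g]%g = p,
          eqQZ (q g) (a%:~R / p%:R) & delta p = legendre (2 * a) p].

Definition dyadic_shape (D : finZmodType) (q : D -> rat) (P : dyadic) : Prop :=
  match P with
  | DyadicTriv => (pcore 2 [set: D] = 1)%g
  | Dyadic22 t =>
      t \in [:: 2; -2] /\
      exists x y : D,
        [/\ (<[x]> \x <[y]> = pcore 2 [set: D])%g,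
            #[x]%g = 2%N /\ #[y]%g = 2%N, eqQZ (bilin q x y) 0,
            eqQZ (q x) (t%:~R / 2 / 4) & eqQZ (q y) (t%:~R / 2 / 4)]
  | Dyadic24 t1 t2 =>
      [/\ t1 \in [:: 1; -1], t2 \in [:: 1; -1; 3; -3] &
      exists x y : D,
        [/\ (<[x]> \x <[y]> = pcore 2 [set: D])%g,
            #[x]%g = 2%N /\ #[y]%g = 4%N, eqQZ (bilin q x y) 0,
            eqQZ (q x) (t1%:~R / 4) & eqQZ (q y) (t2%:~R / 8)]]
  end.

Definition chi2 (P : dyadic) (n : int) : int :=
  match P with
  | DyadicTriv => 1
  | Dyadic22 _ => kronecker (-4) n
  | Dyadic24 t1 t2 => kronecker (-2 * kronecker (-1) (t1 * t2)) n
  end.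

Definition chi (P : dyadic) (p : nat) (n : int) : int :=
  if p == 2%N then chi2 P n else legendre n p.

Definition chiD (P : dyadic) (N : nat) (n : int) : int :=
  \prod_(p <- primes N) chi P p n.

(* All integer divisions below are exact when N is the level.  The value at
   p = 2 for DyadicTriv is irrelevant, since then N is odd. *)
Definition eps (P : dyadic) (delta : nat -> int) (N p : nat) : int :=
  if p == 2%N then
    match P with
    | DyadicTriv => 1
    | Dyadic22 t => chi2 P ((N%:Z * t) %/ 8)%Z
    | Dyadic24 _ t2 => chi2 P ((t2 * N%:Z) %/ 8)%Z
    end
  else chi P p ((2 * N) %/ p)%N%:Z * delta p.

Definition SL2Z (A : 'M[int]_2) : Prop := \det A = 1.

Definition Gamma0 (N : nat) (A : 'M[int]_2) : Prop :=
  SL2Z A /\ (N%:Z %| A 1%R 0%R)%Z.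

(* Points of P^1(Q); None is the cusp at infinity. *)
Definition cusp : Type := option rat.

Definition cusp_act (A : 'M[int]_2) (s : cusp) : cusp :=
  let a := (A 0 0)%:~R : rat in let b := (A 0 1)%:~R : rat in
  let c := (A 1 0)%:~R : rat in let d := (A 1 1)%:~R : rat in
  match s with
  | None => if c == 0 then None else Some (a / c)
  | Some x => if c * x + d == 0 then None else Some ((a * x + b) / (c * x + d))
  end.

Definition cusp_equiv (N : nat) (s t : cusp) : Prop :=
  exists2 A, Gamma0 N A & cusp_act A s = t.

Definition translation (h : nat) : 'M[int]_2 :=
  \matrix_(i, j) (if i == j then 1 else if i == 0 then h%:Z else 0).

(* Gamma0 N contains -1, so no sign is needed here. *)
Definition cusp_period (N : nat) (s : cusp) (h : nat) : Prop :=
  (0 < h)%N /\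
  exists2 A, SL2Z A /\ cusp_act A None = s &
    Gamma0 N (A *m translation h *m invmx A).

Definition cusp_width (N : nat) (s : cusp) (h : nat) : Prop :=
  cusp_period N s h /\ forall h', cusp_period N s h' -> (h <= h')%N.

Section Forms.
Context {R : realType}.
Implicit Types (f g : R[i] -> R[i]) (tau : R[i]) (c : int -> R[i]).

Definition upper (tau : R[i]) : Prop := 0 < complex.Im tau.

Definition cexp (z : R[i]) : R[i] :=
  (expR (complex.Re z))%:C *
  (cos (complex.Im z) +i* sin (complex.Im z)).

Definition qpow (tau : R[i]) (x : rat) : R[i] :=
  cexp (2 * (pi : R)%:C * 'i * tau * ratr x).

Definition slash (k : int) (f : R[i] -> R[i]) (A : 'M[int]_2) (tau : R[i]) :
    R[i] :=
  let j := (A 1 0)%:~R * tau + (A 1 1)%:~R in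
  j ^ (- k) * f (((A 0 0)%:~R * tau + (A 0 1)%:~R) / j).

(* g = sum_n c(n) q^(n/M) on the upper half plane, with finitely many
   negative powers *)
Definition qexpansion (M : nat) (g : R[i] -> R[i]) (c : int -> R[i]) : Prop :=
  exists n0 : int,
    (forall n : int, n < n0 -> c n = 0) /\
    forall tau, upper tau ->
      (series (fun j : nat =>
          c (n0 + j%:Z) * qpow tau ((n0 + j%:Z)%:~R / M%:R) : R[i]^o)
        @ \oo --> (g tau : R[i]^o))%classic.

Definition meromorphic_at_oo (g : R[i] -> R[i]) : Prop :=
  exists (M : nat) (c : int -> R[i]), (0 < M)%N /\ qexpansion M g c.

(* q^x occurs with nonzero coefficient in the expansion of g; the choice of the
   denominator M does not matter by uniqueness of the coefficients. *)
Definition contains_power (g : R[i] -> R[i]) (x : rat) : Prop :=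
  exists (M : nat) (c : int -> R[i]) (n : int),
    [/\ (0 < M)%N, qexpansion M g c, c n != 0 & x = n%:~R / M%:R].

Definition holomorphic_on_upper (f : R[i] -> R[i]) : Prop :=
  forall tau, upper tau -> derivable (f : R[i]^o -> R[i]^o) tau 1.

Definition weakly_holomorphic (N : nat) (k : int) (psi : int -> int)
    (f : R[i] -> R[i]) : Prop :=
  [/\ holomorphic_on_upper f,
      forall A tau, Gamma0 N A -> upper tau ->
        slash k f A tau = (psi (A 1 1))%:~R * f tau &
      forall A, SL2Z A -> meromorphic_at_oo (slash k f A)].

(* A^eps(N, k, chi_D), paired with the q-expansion f = sum_n a(n) q^n *)
Definition Aeps (N : nat) (k : int) (P : dyadic) (delta : nat -> int)
    (f : R[i] -> R[i]) (a : int -> R[i]) : Prop :=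
  [/\ weakly_holomorphic N k (chiD P N) f, qexpansion 1 f a &
      forall (n : int) (p : nat), p \in primes N ->
        chi P p n = - eps P delta N p -> a n = 0].

End Forms.

(* Main.v *)
Require Import Defs.
From mathcomp Require Import all_boot all_order all_algebra.
From mathcomp Require Import all_fingroup all_solvable all_field.
From mathcomp Require Import archimedean complex.
From mathcomp Require Import boolp classical_sets functions reals topology.
From mathcomp Require Import normedtype sequences derive exp trigo.
From mathcomp Require Import zify ring lra.

(* Slashing by [1 0; m 1] with N = m M, expansions at the cusp 1/m are obtained
   from the expansion at infinity as follows.  For an odd prime p there is a
   function psi_p on Z/p of mean 0 that is 1 wherever chi_p <> - epsilon_p; for
   p = 2 the function psi_2 = 2 epsilon_2 chi_2 satisfies (-1)^n + psi_2(n) = 1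
   there.  With Psi the product of psi_p over the primes p dividing a modulus M',
   f is thus its own twist by Psi, plus f(tau + 1/2) when M' is even.
   The Fourier transform of Psi on Z/M' is supported on units u, and each f(tau + u/M') slashed by [1 0; m 1] is a multiple of some
   f(tau/M^2 + b), because u/M' is moved to infinity by an element of Gamma_0(N).
   Hence the twist contributes the terms a(n) q^(n/M^2) times explicit factors;
   at the exponents j/M and for m prime to M these factors contain
   sum_u Psi^(u) chi(u), which is nonzero because Psi chi prod(epsilon_p) >= 0.
   The remaining term f(tau + 1/2) slashed by [1 0; m 1] is separated from the
   rest by its behaviour under tau |-> tau + L for a suitable L. *)

Set Implicit Arguments.
Unset Strict Implicit.
Unset Printing Implicit Defensive.

Import Order.TTheory GRing.Theory Num.Theory.
Import numFieldNormedType.Exports.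

Local Open Scope ring_scope.

(** * Legendre and Kronecker symbols *)

(** A translate f(tau + u/M') with u not a unit leads to a cusp other than infinity, where no
    expansion is at hand; this is why the local functions need Fourier transforms on units, and why
    f(tau + 1/2) must be treated apart. Write m = e m' with M prime to m', and M' = e M. Part (1) is
    e = 1, where the cusp has width M. Parts (2) and (3) are e = 2 and e = 4: the width is M/2, but
    the slashed form changes sign under translation by M/2, because the parabolic matrix has lower
    right entry 1 + N/2, where chi_D is -1. Hence the half-integral exponents, and all three parts
    compare q^(j/M) with a(jM). The term from f(tau + 1/2) is removed in three ways. For e = 1 it is
    antiperiodic under M while the form is periodic. For e = 2 it is periodic under M/2 while the
    form is antiperiodic. For e = 4 translation by M/4 turns it into the form itself up to sign,
    which is incompatible with antiperiodicity under M/2 wherever the twist has coefficient 0. The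
    factors are shown to be nonzero for e = 1, which gives the equivalence in (1) against the
    inclusions in (2) and (3). *)

Lemma Fp_int_eq0 (p : nat) (n : int) : prime p ->
  (n%:~R == 0 :> 'F_p) = (p %| n)%Z.
Proof. by move=> pp; rewrite (dvdz_pcharf (pchar_Fp pp)). Qed.

Lemma legendre_sqrt (p : nat) (a : int) : prime p -> ~~ (p %| a)%Z ->
  legendre a p = if [exists y : 'F_p, y ^+ 2 == a%:~R] then 1 else -1.
Proof.
move=> pp /negPf Hpa; rewrite /legendre Hpa.
have -> // : [exists x : 'I_p, (p %| (x : nat)%:Z ^+ 2 - a)%Z] =
        [exists y : 'F_p, y ^+ 2 == a%:~R].
have key (x : nat) : (p %| x%:Z ^+ 2 - a)%Z = ((x%:R : 'F_p) ^+ 2 == a%:~R).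
  by rewrite -Fp_int_eq0 // rmorphB rmorphXn /= subr_eq0.
apply/existsP/existsP => [[x]|[y]].
  by rewrite key => H; exists (x : nat)%:R.
rewrite -[y]natr_Zp -key => H.
have yp : (y < p)%N by rewrite -[X in (_ < X)%N](Fp_cast pp) ltn_ord.
by exists (Ordinal yp).
Qed.

(** Euler's criterion. The unit group of 'F_p is cyclic: if x = g^i has x^((p-1)/2) = 1, then p - 1
    divides i(p-1)/2, so i is even and g^(i/2) is a square root of x. *)
Lemma legendre_euler (p : nat) (a : int) : prime p -> odd p ->
  ((legendre a p)%:~R : 'F_p) = a%:~R ^+ p./2.
Proof.
move=> pp po.
have p2 : (0 < p./2)%N by case: p pp po => [|[|[]]].
have [pa|npa] := boolP (p %| a)%Z.
  rewrite /legendre pa; move: pa; rewrite -Fp_int_eq0 // => /eqP ->.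
  by rewrite expr0n; case: (p./2) p2.
rewrite legendre_sqrt //.
move: npa; rewrite -Fp_int_eq0 //; move: (a%:~R : 'F_p) => x x0.
have hp : p.-1 = (p./2 * 2)%N by lia.
have xp1 (y : 'F_p) : y != 0 -> y ^+ p.-1 = 1.
  move=> y0; have e : y * y ^+ p.-1 = y.
    by rewrite -exprS prednK ?prime_gt0 // -[X in y ^+ X](card_Fp pp) expf_card.
  by rewrite -[LHS](mulKf y0) e mulVf.
have [/existsP[y /eqP Hy]|nex] := boolP [exists y : 'F_p, y ^+ 2 == x].
  have y0 : y != 0 by apply: contraNneq x0 => y0; rewrite -Hy y0 expr0n.
  by rewrite -Hy -exprM mulnC -hp xp1.
have : (x ^+ p./2) ^+ 2 = 1 by rewrite -exprM -hp xp1.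
move/eqP; rewrite sqrf_eq1 => /orP[/eqP h1|/eqP -> //].
case/negP: nex.
have x_u : x \is a GRing.unit by rewrite unitfE.
have [g Hg] := cyclicP (field_unit_group_cyclic [set: {unit 'F_p}]).
have ordg : #[g]%g = p.-1.
  rewrite orderE -Hg card_finField_unit card_Fp //.
have : FinRing.unit 'F_p x_u \in <[g]>%g by rewrite -Hg inE.
case/cycleP => i Hi.
have Hu : FinRing.uval (FinRing.unit 'F_p x_u) = x by [].
have : (g ^+ (i * p./2) == g ^+ 0)%g.
  rewrite expgM -Hi expg0; apply/eqP/val_inj => /=.
  by rewrite FinRing.val_unitX /= h1.
rewrite eq_expg_mod_order mod0n ordg hp mulnC => H.
have i2 : (2 %| i)%N.
  by move: H; rewrite -/(dvdn _ _) dvdn_pmul2l.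
apply/existsP; exists (FinRing.uval (g ^+ (i %/ 2))%g).
rewrite -FinRing.val_unitX -expgM divnK // -Hi.
by [].
Qed.

Lemma legendre_cases (p : nat) (a : int) :
  [\/ legendre a p = 0, legendre a p = 1 | legendre a p = -1].
Proof. by rewrite /legendre; case: ifP; [constructor 1|case: ifP; [constructor 2|constructor 3]]. Qed.

Lemma legendre_eq0 (p : nat) (a : int) : (legendre a p == 0) = (p %| a)%Z.
Proof. by rewrite /legendre; case: ifP => //; case: ifP. Qed.

(** Since p > 2, the values 0, 1, -1 stay distinct in 'F_p; identities between symbols can therefore
    be checked there by Euler's criterion. *)
Lemma legendre_inj (p : nat) (x y : int) : prime p -> odd p ->
  [\/ x = 0, x = 1 | x = -1] -> [\/ y = 0, y = 1 | y = -1] ->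
  (x%:~R : 'F_p) = y%:~R -> x = y.
Proof.
move=> pp po Hx Hy /eqP; rewrite -subr_eq0 -rmorphB /= Fp_int_eq0 //.
have p3 : (2 < p)%N by case: p pp po => [|[|[]]].
by case: Hx => ->; case: Hy => -> //; rewrite dvdzE => /dvdn_leq => /(_ isT); rewrite leqNgt ?p3 ?(ltnW p3).
Qed.

Lemma legendreM (p : nat) (a b : int) : prime p -> odd p ->
  legendre (a * b) p = legendre a p * legendre b p.
Proof.
move=> pp po; apply: (@legendre_inj p) => //.
- exact: legendre_cases.
- by case: (legendre_cases p a) => ->; case: (legendre_cases p b) => ->;
   rewrite ?mul0r ?mulr0 ?mul1r ?mulr1 ?mulN1r ?opprK;
   do ?[by constructor 1|by constructor 2|by constructor 3].
- by rewrite rmorphM /= !legendre_euler // rmorphM exprMn.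
Qed.

Lemma legendre_mod (p : nat) (a b : int) : prime p -> odd p ->
  (p %| a - b)%Z -> legendre a p = legendre b p.
Proof.
move=> pp po; rewrite -Fp_int_eq0 // rmorphB subr_eq0 => /eqP ab.
apply: (@legendre_inj p) => //; try exact: legendre_cases.
by rewrite !legendre_euler // ab.
Qed.

Lemma legendre1 (p : nat) : prime p -> odd p -> legendre 1 p = 1.
Proof.
move=> pp po; apply: (@legendre_inj p) => //; try exact: legendre_cases.
  by constructor 2.
by rewrite legendre_euler // expr1n.
Qed.

(** If every element of 'F_p were a square, squaring would be injective by finiteness, but 1 and -1
    have the same square. *)
Lemma legendre_nonresidue (p : nat) : prime p -> odd p ->
  exists g : int, legendre g p = -1.
Proof.
move=> pp po.
have p3 : (2 < p)%N by case: p pp po => [|[|[]]].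
have [/existsP[z Hz]|H] := boolP [exists z : 'F_p, z \notin [seq y ^+ 2 | y : 'F_p]].
  exists ((z : nat)%:Z); rewrite legendre_sqrt //.
    case: ifP => // /existsP[y /eqP Hy].
    by case/negP: Hz; apply/mapP; exists y; rewrite ?mem_enum // Hy [RHS]natr_Zp.
  rewrite -Fp_int_eq0 //.
  have -> : ((z : nat)%:~R : 'F_p) = z by exact: natr_Zp.
  apply: contraNneq Hz => ->.
  by apply/mapP; exists 0; rewrite ?mem_enum // expr0n.
exfalso.
have uq : uniq [seq y ^+ 2 | y : 'F_p].
  apply/card_uniqP; rewrite size_map -cardT.
  apply: eq_card => z; rewrite !inE; apply/idP.
  by move: H; rewrite negb_exists => /forallP/(_ z); rewrite negbK.
have inj : injective (fun y : 'F_p => y ^+ 2) by apply/injectiveP.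
have := inj 1 (-1); rewrite sqrrN => /(_ erefl)/eqP.
rewrite -subr_eq0 opprK -[1 + 1]/((2%:Z)%:~R) Fp_int_eq0 //.
by rewrite dvdzE => /dvdn_leq => /(_ isT); rewrite leqNgt p3.
Qed.

Lemma legendreN1 (p : nat) : prime p -> odd p -> legendre (-1) p = (-1) ^+ p./2.
Proof.
move=> pp po; apply: (@legendre_inj p) => //; try exact: legendre_cases.
  by rewrite -signr_odd; case: odd; [constructor 3|constructor 2].
by rewrite legendre_euler // rmorphXn.
Qed.

Lemma prod_even_odd (A : pzSemiRingType) (G : nat -> A) (h : nat) :
  \prod_(0 <= i < h.*2) G i = \prod_(0 <= k < h) (G k.*2 * G k.*2.+1).
Proof.
elim: h => [|h IH]; first by rewrite !big_geq.
by rewrite doubleS !big_nat_recr //= IH mulrA.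
Qed.

Lemma prod_fold (A : comPzSemiRingType) (G : nat -> A) (h : nat) :
  \prod_(0 <= i < h.*2) G i = \prod_(0 <= k < h) (G k * G (h.*2.-1 - k)%N).
Proof.
rewrite big_split /= -addnn (@big_cat_nat _ _ _ h) //=; last by lia.
congr (_ * _); rewrite -{1}[h]add0n big_addn addnK big_nat_rev /=.
by apply: eq_big_nat => i Hi; congr G; lia.
Qed.

(* Gauss: multiplying 1, ..., p./2 by 2 permutes these residues up to sign, k
   being hit with sign (-1)^k. *)
Lemma two_expr_half (p : nat) : prime p -> odd p ->
  (2 : 'F_p) ^+ p./2 = \prod_(0 <= k < p./2) (-1) ^+ k.+1.
Proof.
move=> pp po; set h := p./2.
have pE : p = h.*2.+1 by rewrite -[LHS]odd_double_half po.
have p0 : p%:R = 0 :> 'F_p by rewrite pchar_Fp_0.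
(* Index i stands for the number i + 1, kept if even and replaced by 1 if odd. Taking neighbours
   together gives the product of the 2(k+1); folding pairs k + 1 with p - (k+1), exactly one of
   which is even, and this gives the product of the signed k + 1. *)
pose G (i : nat) : 'F_p := if odd i then i.+1%:R else 1.
have fact0 : \prod_(0 <= k < h) (k.+1%:R : 'F_p) != 0.
  rewrite prodf_seq_neq0; apply/allP => k; rewrite mem_index_iota => /andP[_ kh].
  have := Fp_int_eq0 k.+1%:Z pp; rewrite /= => ->.
  by rewrite dvdzE; apply/negP => /dvdn_leq => /(_ isT); rewrite /=; lia.
apply: (mulIf fact0); rewrite -[X in _ ^+ X](subn0 h) -prodr_const_nat -!big_split /=.
have -> : \prod_(0 <= k < h) ((2 : 'F_p) * k.+1%:R) = \prod_(0 <= i < h.*2) G i.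
  rewrite prod_even_odd; apply: eq_bigr => k _.
  by rewrite /G /= odd_double /= mul1r -natrM; congr (_%:R); lia.
rewrite prod_fold; apply: eq_big_nat => k kh.
have e2 : odd (h.*2.-1 - k) = ~~ odd k by lia.
rewrite /G e2 -signr_odd /=.
have [ok|ek] /= := boolP (odd k); first by rewrite mulr1 expr0 mul1r.
rewrite mul1r expr1 mulN1r; apply/eqP; rewrite -subr_eq0 opprK -natrD; apply/eqP.
by rewrite -[RHS]p0; congr (_%:R); lia.
Qed.

(** The nontrivial Dirichlet character modulo 4. *)
Definition chi4 (n : int) : int :=
  if (n %% 4)%Z == 1 then 1 else if (n %% 4)%Z == 3 then -1 else 0.

(** The total sign in Gauss's product is -1 to the power 1 + ... + p./2. Its parity depends on p./2
    modulo 4, hence on p modulo 8. *)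
Lemma odd_sum_add4 (c m : nat) :
  odd (\sum_(0 <= k < 4 * c + m) k.+1) = odd (\sum_(0 <= k < m) k.+1).
Proof.
elim: c => [|c IH]; first by rewrite muln0.
rewrite (_ : 4 * c.+1 + m = (4 * c + m).+4)%N; last by lia.
by rewrite !big_nat_recr //= -IH; lia.
Qed.

Lemma legendre2 (p : nat) : prime p -> odd p -> legendre 2 p = kronecker2 p.
Proof.
move=> pp po; apply: (@legendre_inj p) => //; try exact: legendre_cases.
  by rewrite /kronecker2; case: ifP; [constructor 1|case: ifP; [constructor 2|constructor 3]].
rewrite legendre_euler // two_expr_half //.
have -> : p./2 = (4 * (p %/ 8) + (p %% 8)./2)%N by lia.
rewrite -expr_sum -signr_odd odd_sum_add4 /kronecker2.
have : (p %% 8)%N \in [:: 1; 3; 5; 7]%N.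
  have : (p %% 8 < 8)%N by rewrite ltn_mod.
  have : odd (p %% 8) by lia.
  by move: (p %% 8)%N => [|[|[|[|[|[|[|[|]]]]]]]].
have -> : (2 %| p%:Z)%Z = false by lia.
have -> : (p%:Z %% 8)%Z = (p %% 8)%N by lia.
rewrite !inE => /or4P[] /eqP ->;
  by rewrite /= ?big_nat_recr //= ?big_geq.
Qed.

Lemma legendreN1_mod4 (p : nat) : prime p -> odd p -> legendre (-1) p = chi4 p.
Proof.
move=> pp po; rewrite legendreN1 // /chi4 -signr_odd.
have : (p %% 4)%N \in [:: 1; 3]%N.
  have : (p %% 4 < 4)%N by rewrite ltn_mod.
  have : odd (p %% 4) by lia.
  by move: (p %% 4)%N => [|[|[|[|]]]].
have -> : (p%:Z %% 4)%Z = (p %% 4)%N by lia.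
rewrite !inE => /orP[] /eqP H; rewrite H /=.
  by have -> : odd p./2 = false by lia.
by have -> : odd p./2 by lia.
Qed.

Lemma mod8_multiplicative (g : int -> int) :
  (forall n, g n = g (n %% 8)%Z) ->
  all (fun x => all (fun y => g (x%:Z * y%:Z) == g x * g y) (iota 0 8)) (iota 0 8) ->
  forall x y, g (x * y) = g x * g y.
Proof.
move=> g8 H x y; rewrite g8 -modzMm -g8 [g x]g8 [g y]g8.
have mem (z : int) : exists2 n : nat, (z %% 8)%Z = n & n \in iota 0 8.
  exists `|(z %% 8)%Z|%N; first lia.
  by rewrite mem_iota; lia.
have [n -> nI] := mem x; have [m -> mI] := mem y.
by apply/eqP; exact: (allP (allP H _ nI) _ mI).
Qed.

Lemma chi4_mod8 n : chi4 n = chi4 (n %% 8)%Z.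
Proof. by rewrite /chi4 (_ : ((n %% 8)%Z %% 4)%Z = (n %% 4)%Z) //; lia. Qed.

Lemma kronecker2_mod8 n : kronecker2 n = kronecker2 (n %% 8)%Z.
Proof.
rewrite /kronecker2 modz_mod.
by have -> : (2 %| (n %% 8)%Z)%Z = (2 %| n)%Z by lia.
Qed.

Lemma chi4M x y : chi4 (x * y) = chi4 x * chi4 y.
Proof. by apply: mod8_multiplicative; [exact: chi4_mod8|vm_compute]. Qed.

Lemma kronecker2M x y : kronecker2 (x * y) = kronecker2 x * kronecker2 y.
Proof. by apply: mod8_multiplicative; [exact: kronecker2_mod8|vm_compute]. Qed.

(** A completely multiplicative function is determined by its values at 0, -1 and the primes. This
    replaces the symbol, defined through prime factorisation, by closed forms in which periodicity
    is visible. *)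
Lemma kronecker_char (a : int) (g : int -> int) :
  (`|a| != 1)%N -> {morph g : x y / x * y} -> g 0 = 0 -> g 1 = 1 ->
  g (-1) = (if a < 0 then -1 else 1) ->
  (forall p, prime p -> g p = if p == 2%N then kronecker2 a else legendre a p) ->
  forall n, kronecker a n = g n.
Proof.
move=> a1 gM g0 g1 gN1 gp n; rewrite /kronecker.
have [->|n0] := eqVneq n 0; first by rewrite (negPf a1) g0.
have gX (x : int) m : g (x ^+ m) = g x ^+ m.
  by elim: m => [|m IH]; rewrite ?expr0 ?g1 // !exprS gM IH.
have gprod (s : seq nat) (F : nat -> int) : g (\prod_(p <- s) F p) = \prod_(p <- s) g (F p).
  by elim: s => [|p s IH]; rewrite ?big_nil ?g1 // !big_cons gM IH.
have -> : \prod_(p <- primes `|n|) (if p == 2 then kronecker2 a else legendre a p) ^+ logn p `|n| = g `|n|%N.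
  rewrite [in RHS](prod_prime_decomp (n := `|n|%N)) ?absz_gt0 // prime_decompE big_map /=.
  rewrite -natz natr_prod gprod; apply: eq_big_seq => p; rewrite mem_primes => /and3P[pp _ _].
  by rewrite natrX gX natz gp.
have [n_lt|n_ge] /= := ltP n 0; last by rewrite mul1r; congr g; lia.
by rewrite -gN1 -gM; congr g; lia.
Qed.

Lemma kroneckerN4 n : kronecker (-4) n = chi4 n.
Proof.
apply: kronecker_char => //; first exact: chi4M.
move=> p pp; have [->//|p2] := eqVneq.
have po : odd p by case: (even_prime pp) p2 => [->|].
rewrite -(_ : (-1) * (2 * 2) = -4) // !legendreM // legendreN1_mod4 //.
case: (legendre_cases p 2) => H; rewrite H ?mulr1 ?mulrNN ?mulr1 //.
by move/eqP: H; rewrite legendre_eq0 dvdzE => /dvdn_leq => /(_ isT) /=; have := prime_gt1 pp; lia.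
Qed.

Lemma kroneckerP2 n : kronecker 2 n = kronecker2 n.
Proof.
apply: kronecker_char => //; first exact: kronecker2M.
move=> p pp; have [->//|p2] := eqVneq.
by case: (even_prime pp) p2 => [->//|po] _; rewrite legendre2.
Qed.

Lemma kroneckerN2 n : kronecker (-2) n = chi4 n * kronecker2 n.
Proof.
apply: (@kronecker_char _ (fun n => chi4 n * kronecker2 n)) => //.
  by move=> x y; rewrite chi4M kronecker2M; ring.
move=> p pp; have [->//|p2] := eqVneq.
have po : odd p by case: (even_prime pp) p2 => [->|].
by rewrite -(_ : (-1) * 2 = -2) // legendreM // legendreN1_mod4 // legendre2.
Qed.

(** * The level of a discriminant form *)

Section Level.
Variables (D : finZmodType) (q : D -> rat).
Hypothesis hD : discriminant_form q.

Lemma eqQZ0 x : eqQZ x 0 = (x \is a Num.int).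
Proof. by rewrite /eqQZ subr0. Qed.

Lemma eqQZ_int x y : eqQZ x y -> (x \is a Num.int) = (y \is a Num.int).
Proof. rewrite /eqQZ => H; apply/idP/idP => Hx.
  by rewrite -[y](subKr x) rpredB.
by rewrite -[x](subrK y) rpredD. Qed.

Lemma eqQZM (n : nat) x y : eqQZ x y -> eqQZ (n%:R * x) (n%:R * y).
Proof. by rewrite /eqQZ -mulrBr => H; rewrite rpredM ?rpred_nat. Qed.

Lemma int_coprime (A B : nat) (r : rat) : coprime A B ->
  A%:R * r \is a Num.int -> B%:R * r \is a Num.int -> r \is a Num.int.
Proof.
move=> cAB HA HB.
have /coprimezP[[u v] /= Huv] : coprimez A B by [].
have -> : r = u%:~R * (A%:R * r) + v%:~R * (B%:R * r).
  by rewrite !mulrA -mulrDl -[A%:R]/(A%:~R) -[B%:R]/(B%:~R) -!rmorphM -rmorphD Huv /= mul1r.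
by rewrite rpredD // rpredM // ?rpred_int.
Qed.

Lemma q0_int : q 0 \is a Num.int.
Proof. by have := df_quad hD 0 0; rewrite mulr0z expr0n mul0r eqQZ0. Qed.

Lemma bilin0l y : bilin q 0 y \is a Num.int.
Proof. by rewrite /bilin add0r addrAC subrr add0r rpredN q0_int. Qed.

Lemma bilinC x y : bilin q x y = bilin q y x.
Proof. by rewrite /bilin [x + y]addrC addrAC. Qed.

Lemma bilin_muln x y (n : nat) : eqQZ (bilin q (x *+ n) y) (n%:R * bilin q x y).
Proof.
elim: n => [|n IH]; first by rewrite mulr0n mul0r eqQZ0 bilin0l.
rewrite mulrS -natr1 mulrDl mul1r [n%:R * _ + _]addrC.
have := rpredD (df_bilin hD x (x *+ n) y) IH.
by rewrite /eqQZ /is_true => <-; congr (_ \is a Num.int); ring.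
Qed.

Lemma q_muln x (n : nat) : eqQZ (q (x *+ n)) (n%:R ^+ 2 * q x).
Proof. exact: (df_quad hD n x). Qed.

Lemma mulr_order (x : D) : x *+ #[x]%g = 0.
Proof. by have := expg_order x; rewrite FinRing.zmodXgE. Qed.

Lemma bilin_coprime x y : coprime #[x]%g #[y]%g -> bilin q x y \is a Num.int.
Proof.
move=> cxy; apply: (int_coprime cxy).
  by rewrite -(eqQZ_int (bilin_muln _ _ _)) mulr_order bilin0l.
by rewrite bilinC -(eqQZ_int (bilin_muln _ _ _)) mulr_order bilin0l.
Qed.

Lemma q_order x : (#[x]%g ^ 2)%:R * q x \is a Num.int.
Proof. by rewrite natrX -(eqQZ_int (q_muln _ _)) mulr_order q0_int. Qed.

Lemma q_add x y : q (x + y) = q x + q y + bilin q x y.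
Proof. by rewrite /bilin; ring. Qed.

Lemma ppart_decomp (p : nat) (x : D) : prime p ->
  exists y z : D, [/\ x = y + z, y \in pcore p [set: D] & coprime p #[z]%g].
Proof.
move=> pp; exists (x.`_p)%g, (x.`_p^')%g; split.
- by rewrite -FinRing.zmodMgE consttC.
- have ab : abelian [set: D] by exact: FinRing.zmod_abelian.
  rewrite (mem_normal_Hall (nilpotent_pcore_Hall p (abelian_nil ab)) (pcore_normal _ _)) ?inE //.
  exact: p_elt_constt.
- by rewrite prime_coprime // -p'natE //; exact: p_elt_constt.
Qed.

(** With N = c p^(logn p N), the number c p^e already annihilates q: an element splits into a
    p-part, handled by the hypothesis, and an orthogonal part of order prime to p. Minimality of the
    level gives the bound. *)
Lemma logn_level_le (p e N : nat) : prime p -> is_level q N ->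
  (forall y, y \in pcore p [set: D] -> (p ^ e)%:R * q y \is a Num.int) ->
  (logn p N <= e)%N.
Proof.
move=> pp [N0 annN minN] He.
have [c Hc cE] := pfactor_coprime pp N0.
have c0 : (0 < c)%N by move: N0; rewrite cE muln_gt0 => /andP[].
suff : (N <= c * p ^ e)%N by rewrite {1}cE leq_pmul2l // leq_exp2l // prime_gt1.
apply: minN => [|x]; first by rewrite muln_gt0 c0 expn_gt0 prime_gt0.
have [y [z [-> Hy cz]]] := ppart_decomp x pp.
rewrite eqQZ0 q_add mulrDr [_ * (q y + _)]mulrDr; apply: rpredD; last first.
  apply: rpredM; first exact: rpred_nat.
  apply: bilin_coprime.
  have : (p.-group (pcore p [set: D]))%g by exact: pcore_pgroup.
  move=> /mem_p_elt/(_ Hy); rewrite /p_elt => /p_natP[i ->].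
  by rewrite coprimeXl.
apply: rpredD; first by rewrite natrM -mulrA rpredM ?He ?rpred_nat.
rewrite mulnC natrM -mulrA; apply: rpredM; first exact: rpred_nat.
(* The number c q(z) becomes integral after multiplication by a power of p, as N annihilates q, and
   also by the square of the order of z, which is prime to p. *)
apply: (@int_coprime (p ^ logn p N) (#[z]%g ^ 2)).
- by rewrite coprimeXl // coprimeXr.
- by rewrite mulrA -natrM mulnC -cE -eqQZ0; exact: annN.
- by rewrite mulrCA rpredM ?q_order ?rpred_nat.
Qed.

Lemma logn_level_ge (p e N : nat) (a : int) (x : D) : prime p -> is_level q N ->
  eqQZ (q x) (a%:~R / (p ^ e)%:R) -> coprime p `|a|%N -> (e <= logn p N)%N.
Proof.
move=> pp [N0 annN _] qx cpa.
have pe0 : (p ^ e)%:R != 0 :> rat by rewrite pnatr_eq0 expn_eq0 negb_and -lt0n prime_gt0.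
have : N%:R * (a%:~R / (p ^ e)%:R) \is a @Num.int rat.
  by rewrite -(eqQZ_int (eqQZM N qx)) -eqQZ0; exact: annN.
case/intrP => c Hc.
have Hz : (N%:Z * a = c * (p ^ e)%N%:Z).
  apply: (@intr_inj rat); rewrite !rmorphM /= -Hc.
  by rewrite mulrA divfK.
rewrite -pfactor_dvdn //.
have : (p ^ e %| N * `|a|)%N by apply/dvdnP; exists `|c|%N; have := congr1 absz Hz; rewrite !abszM.
by rewrite Gauss_dvdl // coprimeXl.
Qed.

Lemma q_cycle (g y : D) : y \in <[g]>%g -> exists j : nat, eqQZ (q y) (j%:R ^+ 2 * q g).
Proof. by case/cycleP => j ->; exists j; rewrite FinRing.zmodXgE; exact: q_muln. Qed.

Lemma eqQZ_trans x y z : eqQZ x y -> eqQZ y z -> eqQZ x z.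
Proof. by rewrite /eqQZ => H1 H2; rewrite -(subrK y x) -addrA rpredD. Qed.

(** The sign is nonzero by nondegeneracy: if p divided a, then q(g) would be integral, so g would
    pair integrally with its own multiples and with everything of order prime to p, forcing g =
    0. *)
Lemma odd_level (delta : nat -> int) (p N : nat) : prime p -> odd p ->
  is_level q N -> odd_shape q delta -> (p %| N)%N ->
  logn p N = 1%N /\ (delta p = 1 \/ delta p = -1).
Proof.
move=> pp po levN shp pN; have N0 : (0 < N)%N by case: levN.
have l1 : (1 <= logn p N)%N by rewrite -pfactor_dvdn // expn1.
case: (shp p pp po) => [triv|[g [a [Hg og qg dp]]]].
  suff : (logn p N <= 0)%N by rewrite leqNgt l1.
  apply: logn_level_le => // y; rewrite triv inE => /eqP ->.
  by rewrite mul1r q0_int.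
split.
  apply/eqP; rewrite eqn_leq l1 andbT; apply: logn_level_le => // y.
  rewrite -Hg => /q_cycle[j Hj]; rewrite expn1 (eqQZ_int (eqQZM _ Hj)) mulrCA.
  rewrite rpredM ?rpredX ?rpred_nat // (eqQZ_int (eqQZM _ qg)) mulrC divfK ?rpred_int //.
  by rewrite pnatr_eq0 -lt0n prime_gt0.
have pa : ~~ (p %| 2 * a)%Z.
  apply/negP => pa.
  have {}pa : (p %| a)%Z by move: pa; rewrite Gauss_dvdzr // coprimezE coprimen2.
  have qgi : q g \is a Num.int.
    case/dvdzP: pa qg => c -> qg; rewrite (eqQZ_int qg) rmorphM /= mulfK ?rpred_int //.
    by rewrite intr_eq0 -lt0n prime_gt0.
  have g0 : g = 0.
    apply: (df_nondeg hD) => x; rewrite eqQZ0.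
    have [y [z [-> Hy cz]]] := ppart_decomp x pp.
    rewrite bilinC (eqQZ_int (df_bilin hD _ _ _)) rpredD //; last first.
      by apply: bilin_coprime; rewrite og coprime_sym.
    move: Hy; rewrite -Hg => /cycleP[j ->]; rewrite FinRing.zmodXgE.
    rewrite (eqQZ_int (bilin_muln _ _ _)) rpredM ?rpred_nat //.
    rewrite /bilin -mulr2n rpredB // rpredB // (eqQZ_int (q_muln _ _)).
    by rewrite rpredM ?rpredX ?rpred_nat.
  by move: og pp; rewrite g0 (_ : 0 = 1%g :> D) // order1 => <-.
rewrite dp; move: pa; rewrite -legendre_eq0.
by case: (legendre_cases p (2 * a)) => ->; [|left|right].
Qed.

Lemma q_dprod_cycle (x y z : D) (A : {group D}) :
  (<[x]> \x <[y]> = A)%g -> bilin q x y \is a Num.int -> z \in A ->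
  exists i j : nat, eqQZ (q z) (i%:R ^+ 2 * q x + j%:R ^+ 2 * q y).
Proof.
move=> HA bxy zA.
have [_ HA' _ _] := dprodP HA; move: zA; rewrite -HA' => /mulsgP[_ _ /cycleP[i ->] /cycleP[j ->] ->].
exists i, j; rewrite !FinRing.zmodXgE FinRing.zmodMgE q_add.
have bint : bilin q (x *+ i) (y *+ j) \is a Num.int.
  rewrite (eqQZ_int (bilin_muln _ _ _)) rpredM ?rpred_nat // bilinC.
  by rewrite (eqQZ_int (bilin_muln _ _ _)) rpredM ?rpred_nat // bilinC.
have := rpredD (rpredD (q_muln x i) (q_muln y j)) bint.
by rewrite /eqQZ /is_true => <-; congr (_ \is a Num.int); ring.
Qed.

Lemma dyadic_level (P : dyadic) (N : nat) : is_level q N -> dyadic_shape q P ->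
  logn 2 N = match P with DyadicTriv => 0 | Dyadic22 _ => 2 | Dyadic24 _ _ => 3 end.
Proof.
move=> levN; have p2 : prime 2 by [].
case: P => [triv|t|t1 t2] /=.
- apply/eqP; rewrite -leqn0; apply: logn_level_le => // y.
  by rewrite triv inE => /eqP ->; rewrite mul1r q0_int.
- case=> Ht [x [y [HA [ox oy] bxy qx qy]]].
  apply/eqP; rewrite eqn_leq; apply/andP; split; last first.
    apply: (@logn_level_ge _ _ _ (t %/ 2)%Z x) => //; move: qx Ht; rewrite !inE => qx /orP[]/eqP tE;
    by move: qx; rewrite tE //; apply: eqQZ_trans; apply: eqxx.
  apply: logn_level_le => // z /(q_dprod_cycle HA); rewrite eqQZ0 in bxy => /(_ bxy)[i [j Hz]].
  rewrite (eqQZ_int (eqQZM _ Hz)) mulrDr !(mulrCA (4%:R)).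
  apply: rpredD; (apply: rpredM; first by rewrite rpredX ?rpred_nat).
    rewrite (eqQZ_int (eqQZM _ qx)).
    by move: Ht; rewrite !inE => /orP[]/eqP ->.
  rewrite (eqQZ_int (eqQZM _ qy)).
  by move: Ht; rewrite !inE => /orP[]/eqP ->.
- case=> Ht1 Ht2 [x [y [HA [ox oy] bxy qx qy]]].
  apply/eqP; rewrite eqn_leq; apply/andP; split; last first.
    apply: (@logn_level_ge _ _ _ t2 y) => //.
    by move: Ht2; rewrite !inE => /or4P[]/eqP ->.
  apply: logn_level_le => // z /(q_dprod_cycle HA); rewrite eqQZ0 in bxy => /(_ bxy)[i [j Hz]].
  rewrite (eqQZ_int (eqQZM _ Hz)) mulrDr !(mulrCA (8%:R)).
  apply: rpredD; (apply: rpredM; first by rewrite rpredX ?rpred_nat).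
    rewrite (eqQZ_int (eqQZM _ qx)).
    by move: Ht1; rewrite !inE => /orP[]/eqP ->.
  rewrite (eqQZ_int (eqQZM _ qy)).
  by move: Ht2; rewrite !inE => /or4P[]/eqP ->.
Qed.

End Level.

(** * Fourier analysis on Z/m *)

Lemma dvdz_small (m : nat) (x : int) : (m %| x)%Z -> (`|x| < m)%N -> x = 0.
Proof.
rewrite dvdzE => mx xm; apply/eqP; rewrite -absz_eq0; apply/eqP.
by case: (posnP `|x|%N) => // x0; move: (dvdn_leq x0 mx); rewrite absz_nat leqNgt xm.
Qed.

Section PeriodicSums.
Variables (K : nmodType) (m : nat) (F : int -> K).
Hypothesis m0 : (0 < m)%N.
Hypothesis Fper : forall x y, (m %| x - y)%Z -> F x = F y.

(** For s prime to m the map t -> n + ts permutes the residues modulo m. *)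
Lemma sum_affine (n s : int) : coprimez s m ->
  \sum_(t < m) F (n + t%:Z * s) = \sum_(t < m) F t%:Z.
Proof.
move=> cs; have mz : m%:Z != 0 by lia.
have lt (x : int) : (`|(x %% m)%Z| < m)%N.
  by rewrite -ltz_nat gez0_abs ?modz_ge0 // ltz_pmod.
pose h (t : 'I_m) := Ordinal (lt (n + t%:Z * s)).
have hE t : (h t)%:Z = ((n + t%:Z * s) %% m)%Z by rewrite /= gez0_abs ?modz_ge0.
have hinj : injective h.
  move=> t u /(congr1 (fun x : 'I_m => x%:Z)); rewrite !hE => /eqP.
  rewrite eqz_modDl eqz_mod_dvd -mulrBl Gauss_dvdzl 1?coprimez_sym // => /dvdz_small H.
  by apply: val_inj => /=; have := ltn_ord t; have := ltn_ord u; lia.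
rewrite [RHS](reindex_inj hinj) /=; apply: eq_bigr => t _; apply: Fper.
by rewrite hE -eqz_mod_dvd modz_mod.
Qed.

Lemma sum_shift (n : int) : \sum_(t < m) F (t%:Z + n) = \sum_(t < m) F t%:Z.
Proof.
by rewrite -(@sum_affine n 1) ?/coprimez ?gcd1z //; apply: eq_bigr => t _; rewrite mulr1 addrC.
Qed.

Lemma sum_dilate (s : int) : coprimez s m ->
  \sum_(t < m) F (t%:Z * s) = \sum_(t < m) F t%:Z.
Proof. by move=> cs; rewrite -(@sum_affine 0 s cs); apply: eq_bigr => t _; rewrite add0r. Qed.

End PeriodicSums.

Section Fourier.
Variables (K : numFieldType) (m : nat) (z : K).
Hypothesis zprim : m.-primitive_root z.
Implicit Types phi : int -> K.

Definition periodic_mod (A : Type) (phi : int -> A) : Prop :=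
  forall x y, (m %| x - y)%Z -> phi x = phi y.

Definition fourier phi (u : int) : K := m%:R^-1 * \sum_(n < m) phi n%:Z * z ^ (- (u * n%:Z)).

Let m0 : (0 < m)%N. Proof. exact: prim_order_gt0 zprim. Qed.
Let mn0 : m%:R != 0 :> K. Proof. by rewrite pnatr_eq0 -lt0n. Qed.
Let z0 : z != 0.
Proof.
apply/eqP => ze; have := prim_expr_order zprim.
by rewrite ze expr0n eqn0Ngt m0 => /eqP; rewrite eq_sym oner_eq0.
Qed.

Lemma prim_expz_eq1 (n : int) : (z ^ n == 1) = (m %| n)%Z.
Proof.
case: n => n; first by rewrite -exprnP -(prim_order_dvd zprim).
by rewrite NegzE -invr_expz invr_eq1 -exprnP -(prim_order_dvd zprim) dvdzE abszN.
Qed.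

Lemma prim_expz_mod (x y : int) : (m %| x - y)%Z -> z ^ x = z ^ y.
Proof.
rewrite -prim_expz_eq1 => /eqP H.
by rewrite -(subrK y x) expfzDr // H mul1r.
Qed.

(** Orthogonality of characters: shifting u by 1 multiplies the sum by z^n without changing it. *)
Lemma sum_prim_expz (n : int) :
  \sum_(u < m) z ^ (u%:Z * n) = if (m %| n)%Z then m%:R else 0.
Proof.
case: ifPn => mn.
  rewrite (eq_bigr (fun=> 1)) ?sumr_const ?card_ord // => u _.
  by apply/eqP; rewrite prim_expz_eq1 dvdz_mull.
have per : periodic_mod (fun x => z ^ (x * n)).
  by move=> x y xy; apply: prim_expz_mod; rewrite -mulrBl dvdz_mulr.
pose S := \sum_(u < m) z ^ (u%:Z * n).
have H : \sum_(u < m) z ^ ((u%:Z + 1) * n) = S by exact: (sum_shift m0 per 1).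
have : (z ^ n - 1) * S = 0.
  rewrite mulrBl mul1r -[X in _ - X]H mulr_sumr; apply/eqP; rewrite subr_eq0; apply/eqP.
  by apply: eq_bigr => u _; rewrite -expfzDr //; congr (_ ^ _); ring.
by move/eqP; rewrite mulf_eq0 subr_eq0 prim_expz_eq1 (negPf mn) /= => /eqP S0.
Qed.

Lemma fourier_inv phi n : periodic_mod phi ->
  phi n = \sum_(u < m) fourier phi u%:Z * z ^ (u%:Z * n).
Proof.
move=> per.
transitivity (m%:R^-1 * \sum_(k < m) phi k%:Z * (if (m %| n - k%:Z)%Z then m%:R else 0)).
  have lt : (`|(n %% m)%Z| < m)%N.
    by rewrite -ltz_nat gez0_abs ?modz_ge0 ?ltz_pmod // -lt0n.
  have kE : (`|(n %% m)%Z|%N)%:Z = (n %% m)%Z by rewrite gez0_abs ?modz_ge0 // -lt0n.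
  rewrite (bigD1 (Ordinal lt)) //= kE big1 ?addr0 => [|k kn].
    have d : (m %| n - (n %% m)%Z)%Z by rewrite -eqz_mod_dvd modz_mod.
    by rewrite d mulrC mulfK // (per _ _ d).
  case: ifP; rewrite ?mulr0 // => mnk; case/eqP: kn.
  have : (m %| (n %% m)%Z - k%:Z)%Z by rewrite -eqz_mod_dvd modz_mod eqz_mod_dvd.
  move=> /dvdz_small H; apply: val_inj => /=; move: H lt kE (ltn_ord k).
  by move: (n %% m)%Z => r; lia.
under eq_bigr do rewrite -sum_prim_expz.
under [RHS]eq_bigr do rewrite -mulrA mulr_suml.
rewrite -mulr_sumr exchange_big /=; congr (_ * _); apply: eq_bigr => k _.
rewrite mulr_sumr; apply: eq_bigr => u _.
by rewrite -mulrA -expfzDr //; congr (_ * _ ^ _); ring.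
Qed.

(** For p dividing u the character z^(-un) is constant along steps of m/p. Averaging the defining
    sum over these steps leaves sums of [phi] alone, which vanish. *)
Lemma fourier_eq0 phi (p : nat) (u : int) : prime p -> (p %| m)%N -> (p %| u)%Z ->
  periodic_mod phi ->
  (forall n, \sum_(t < p) phi (n + t%:Z * (m %/ p)%N%:Z) = 0) ->
  fourier phi u = 0.
Proof.
move=> pp pm pu per H; rewrite /fourier.
set S := \sum_(n < m) _; suff : p%:R * S = 0.
  move/eqP; rewrite mulf_eq0 pnatr_eq0 eqn0Ngt prime_gt0 //= => /eqP ->.
  by rewrite mulr0.
pose F (n : int) := phi n * z ^ (- (u * n)).
have Fper : periodic_mod F.
  move=> x y xy; rewrite /F (per _ _ xy); congr (_ * _); apply: prim_expz_mod.
  by rewrite -opprD -mulrBr rpredN dvdz_mull.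
transitivity (\sum_(t < p) \sum_(n < m) F (n%:Z + t%:Z * (m %/ p)%N%:Z)).
  under eq_bigr do rewrite (sum_shift m0 Fper).
  by rewrite sumr_const card_ord mulr_natl.
rewrite exchange_big /= big1 // => n _.
transitivity (\sum_(t < p) phi (n%:Z + t%:Z * (m %/ p)%N%:Z) * z ^ (- (u * n%:Z))).
  apply: eq_bigr => t _; rewrite /F; congr (_ * _); apply: prim_expz_mod.
  have [c uE] := dvdzP pu.
  rewrite (_ : _ - _ = - (c * t%:Z) * (m %/ p * p)%N%:Z); last first.
    by rewrite uE PoszM; ring.
  by rewrite divnK // dvdz_mull.
by rewrite -mulr_suml H mul0r.
Qed.

(** The standard separation of Gauss sums, by the substitution t -> tn. *)
Lemma fourier_separable (chi : int -> K) (n : int) : periodic_mod chi ->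
  {morph chi : x y / x * y} -> coprimez n m ->
  chi n * fourier chi n = fourier chi 1.
Proof.
move=> per chiM cn; rewrite /fourier mulrCA; congr (_ * _).
have Fper : periodic_mod (fun x => chi x * z ^ (- x)).
  move=> x y xy; rewrite (per _ _ xy); congr (_ * _); apply: prim_expz_mod.
  by rewrite -opprD rpredN.
under [RHS]eq_bigr do rewrite mul1r.
rewrite -(sum_dilate m0 Fper cn) mulr_sumr; apply: eq_bigr => t _.
by rewrite mulrA -chiM [n * _]mulrC.
Qed.

End Fourier.

(** * The local characters *)

Lemma chi4_unit n : odd `|n|%N -> chi4 n ^+ 2 = 1.
Proof. by rewrite /chi4 => no; case: ifP => // h1; case: ifP => // h3; lia. Qed.

Lemma kronecker2_unit n : odd `|n|%N -> kronecker2 n ^+ 2 = 1.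
Proof. by rewrite /kronecker2 => no; case: ifP => [|_]; [lia|case: ifP]. Qed.

Lemma kronecker2_even n : ~~ odd `|n|%N -> kronecker2 n = 0.
Proof. by rewrite /kronecker2 => ne; case: ifP => //; lia. Qed.

Lemma chi4_even n : ~~ odd `|n|%N -> chi4 n = 0.
Proof. by rewrite /chi4 => ne; case: ifP => [|_]; [lia|case: ifP => //; lia]. Qed.

Lemma chi4_mod x y : (4 %| x - y)%Z -> chi4 x = chi4 y.
Proof. by rewrite -eqz_mod_dvd /chi4 => /eqP ->. Qed.

Lemma kronecker2_mod x y : (8 %| x - y)%Z -> kronecker2 x = kronecker2 y.
Proof. by rewrite kronecker2_mod8 [RHS]kronecker2_mod8 -eqz_mod_dvd => /eqP ->. Qed.

Lemma mod8_ext (g h : int -> int) :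
  (forall x y, (8 %| x - y)%Z -> g x = g y) -> (forall x y, (8 %| x - y)%Z -> h x = h y) ->
  all (fun x : nat => g x == h x) (iota 0 8) -> g =1 h.
Proof.
move=> g8 h8 H x; have [c cI d] : exists2 c : nat, c \in iota 0 8 & (8 %| x - c%:Z)%Z.
  by exists `|(x %% 8)%Z|%N; [rewrite mem_iota|]; lia.
by rewrite (g8 _ _ d) (h8 _ _ d); apply/eqP/(allP H).
Qed.

Lemma chi4_add2 x c : odd `|c|%N -> chi4 (x + 2 * c) = - chi4 x.
Proof.
move=> oc; rewrite (@chi4_mod _ (x + 2)); last by lia.
apply: (mod8_ext (g := fun x => chi4 (x + 2)) (h := fun x => - chi4 x)) x => [x y d|x y d|//].
  by apply: chi4_mod; lia.
by congr (- _); apply: chi4_mod; lia.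
Qed.

Lemma kronecker2_add4 x c : odd `|c|%N -> kronecker2 (x + 4 * c) = - kronecker2 x.
Proof.
move=> oc; rewrite (@kronecker2_mod _ (x + 4)); last by lia.
apply: (mod8_ext (g := fun x => kronecker2 (x + 4)) (h := fun x => - kronecker2 x))
  x => [x y d|x y d|//].
  by apply: kronecker2_mod; lia.
by congr (- _); apply: kronecker2_mod; lia.
Qed.

(** The arithmetic consequences of the shape of D_2 on which the properties of [chi2] rest: the
    2-part of the level is the conductor of [chi2]. *)
Definition dyadic_ok (P : dyadic) (N : nat) : Prop :=
  match P with
  | DyadicTriv => logn 2 N = 0
  | Dyadic22 _ => logn 2 N = 2
  | Dyadic24 t1 t2 => logn 2 N = 3 /\
      (kronecker (-1) (t1 * t2) = 1 \/ kronecker (-1) (t1 * t2) = -1)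
  end.

(** Multiplying the summation variable by a nonresidue permutes the terms and changes the sign of
    the sum. *)
Lemma sum_legendre (p : nat) : prime p -> odd p -> \sum_(t < p) legendre t%:Z p = 0.
Proof.
move=> pp po; have [g Hg] := legendre_nonresidue pp po.
have per : forall x y, (p %| x - y)%Z -> legendre x p = legendre y p.
  by move=> x y; exact: legendre_mod.
have cg : coprimez g p.
  rewrite coprimez_sym coprimezE prime_coprime //=; apply/negP => pg.
  by move: Hg; have /eqP -> : legendre g p == 0 by rewrite legendre_eq0.
have := sum_dilate (prime_gt0 pp) per cg.
under eq_bigr do rewrite legendreM // Hg mulrN1.
by rewrite sumrN; set S := \sum_(t < p) _; lia.
Qed.

Section LocalCharacters.
Variables (P : dyadic) (N : nat).
Hypothesis N0 : (0 < N)%N.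
Hypothesis hP : dyadic_ok P N.
Hypothesis hsq : forall p, prime p -> odd p -> (p %| N)%N -> logn p N = 1%N.

Lemma chi2_cases : (2 %| N)%N ->
  (logn 2 N = 2 /\ chi2 P =1 chi4) \/
  (logn 2 N = 3 /\ (chi2 P =1 kronecker2 \/ chi2 P =1 (fun n => chi4 n * kronecker2 n))).
Proof.
move=> N2; have : (0 < logn 2 N)%N by rewrite logn_gt0 mem_primes N0 N2.
case: P hP => [->//|t H _|t1 t2 [H ks] _]; first by left; split=> // n; exact: kroneckerN4.
right; split=> //; case: ks => e; [right|left] => n; rewrite /chi2 e.
  exact: kroneckerN2.
exact: kroneckerP2.
Qed.


Lemma chi_odd (p : nat) : prime p -> odd p -> chi P p = legendre^~ p.
Proof. by move=> pp po; rewrite /chi; case: eqP po => [->|]. Qed.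

Lemma chi_mul p x y : p \in primes N -> chi P p (x * y) = chi P p x * chi P p y.
Proof.
rewrite mem_primes => /and3P[pp _ pN'].
case: (even_prime pp) => [p2|po]; last by rewrite chi_odd // legendreM.
rewrite p2 in pN' *; rewrite /chi /=; case: (chi2_cases pN') => [[_ E]|[_ [E|E]]]; rewrite !E.
- exact: chi4M.
- exact: kronecker2M.
- by rewrite chi4M kronecker2M; ring.
Qed.

Lemma chi_one p : p \in primes N -> chi P p 1 = 1.
Proof.
rewrite mem_primes => /and3P[pp _ pN'].
case: (even_prime pp) => [p2|po]; last by rewrite chi_odd // legendre1.
by rewrite p2 in pN' *; rewrite /chi /=; case: (chi2_cases pN') => [[_ E]|[_ [E|E]]]; rewrite !E.
Qed.

Lemma chi_sqr p n : p \in primes N -> chi P p n ^+ 2 = (~~ (p %| n)%Z)%:R.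
Proof.
rewrite mem_primes => /and3P[pp _ pN'].
case: (even_prime pp) => [p2|po]; last first.
  rewrite chi_odd // -legendre_eq0; by case: (legendre_cases p n) => ->.
rewrite p2 in pN' *; rewrite /chi /= dvdzE dvdn2 negbK.
case: (boolP (odd `|n|)) => on.
  case: (chi2_cases pN') => [[_ E]|[_ [E|E]]]; rewrite !E ?exprMn;
  by rewrite ?chi4_unit ?kronecker2_unit.
case: (chi2_cases pN') => [[_ E]|[_ [E|E]]]; rewrite !E ?exprMn;
by rewrite ?kronecker2_even ?chi4_even.
Qed.

Lemma chi_periodic p : p \in primes N -> periodic_mod (p ^ logn p N) (chi P p).
Proof.
rewrite mem_primes => /and3P[pp _ pN'] x y.
case: (even_prime pp) => [p2|po]; last first.
  by rewrite chi_odd // hsq // expn1; exact: legendre_mod.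
rewrite p2 in pN' *; rewrite /chi /=; case: (chi2_cases pN') => [[-> E]|[-> [E|E]]] d; rewrite !E.
- exact: chi4_mod.
- exact: kronecker2_mod.
- by rewrite (kronecker2_mod d) (@chi4_mod x y) //; lia.
Qed.

(** Here m/2 is an odd multiple of half the conductor, 2 for conductor 4 and 4 for conductor 8; for
    a primitive character this step changes the sign. *)
Lemma chi2_shift (m : nat) n : (0 < m)%N -> (2 %| N)%N -> logn 2 m = logn 2 N ->
  chi2 P (n + (m %/ 2)%N%:Z) = - chi2 P n.
Proof.
move=> m0 N2 lm; have [c oc mE] := pfactor_coprime (p := 2) isT m0.
rewrite coprime2n in oc.
case: (chi2_cases N2) lm => [[-> E]|[-> E]] lm; rewrite lm in mE.
  by rewrite !E (_ : (m %/ 2)%N%:Z = 2 * c%:Z) ?chi4_add2 //; lia.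
have -> : (m %/ 2)%N%:Z = 4 * c%:Z by lia.
case: E => E; rewrite !E kronecker2_add4 // (@chi4_mod (n + 4 * c%:Z) n) ?mulrN //.
by lia.
Qed.

End LocalCharacters.

(** * The multiplier of the coefficients *)

(** A unitary divisor, one prime to its cofactor. It is phrased by valuations because the function
    at p has period the full p-part of N. *)
Definition unitary (N m : nat) : Prop :=
  (0 < m)%N /\ forall p, p \in primes m -> p \in primes N /\ logn p m = logn p N.

Section Products.
Variables (K : comPzRingType) (N m : nat) (g : nat -> int -> K).
Hypothesis um : unitary N m.
Hypothesis gper : forall p, p \in primes m -> periodic_mod (p ^ logn p N) (g p).

Let Pi n := \prod_(p <- primes m) g p n.

Lemma prod_periodic : periodic_mod m Pi.
Proof.
move=> x y d; apply: eq_big_seq => p pm; apply: gper => //.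
apply: dvdz_trans d; rewrite dvdzE; case: um => m0 /(_ _ pm)[_ <-].
exact: pfactor_dvdnn.
Qed.

(** A step of m/p moves only the factor at p, since the q-part of m divides m/p for every other
    prime q. *)
Lemma prod_mean0 (p : nat) n : p \in primes m ->
  (forall n, \sum_(t < p) g p (n + t%:Z * (m %/ p)%N%:Z) = 0) ->
  \sum_(t < p) Pi (n + t%:Z * (m %/ p)%N%:Z) = 0.
Proof.
move=> pm H.
transitivity (\sum_(t < p) g p (n + t%:Z * (m %/ p)%N%:Z) *
    \prod_(q <- rem p (primes m)) g q n); last by rewrite -mulr_suml H mul0r.
apply: eq_bigr => t _; rewrite /Pi (big_rem p pm) /=; congr (_ * _).
apply: eq_big_seq => q; rewrite mem_rem_uniq ?primes_uniq // inE => /andP[qp qm].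
apply: gper => //; rewrite addrAC subrr add0r dvdz_mull // dvdzE.
case: um => m0 /(_ _ qm)[_ <-].
move: pm qm; rewrite !mem_primes => /and3P[pp _ pm] /and3P[qq _ qm].
have : (q ^ logn q m %| m %/ p * p)%N by rewrite divnK // pfactor_dvdnn.
by rewrite Gauss_dvdl // coprimeXl // prime_coprime // dvdn_prime2.
Qed.
End Products.

Section Multiplier.
Variables (K : numFieldType) (P : dyadic) (N : nat) (ep : nat -> int).
Hypothesis N0 : (0 < N)%N.
Hypothesis hP : dyadic_ok P N.
Hypothesis hsq : forall p, prime p -> odd p -> (p %| N)%N -> logn p N = 1%N.
Hypothesis hep : forall p, p \in primes N -> ep p = 1 \/ ep p = -1.

(* For odd [p] this is the function of mean [0] on Z/p which is [1] wherever
   [chi_p <> - ep_p].  For [p = 2] no such function has its Fourier transform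
   supported on units; instead [(-1) ^ n + local_multiplier 2 n = 1] on the same set. *)
Definition local_multiplier (p : nat) (n : int) : K :=
  if p == 2%N then 2 * (ep p * chi P p n)%:~R
  else 1 - p%:R / p.-1%:R * (chi P p n ^+ 2 - ep p * chi P p n)%:~R.

Definition multiplier (m : nat) (n : int) : K := \prod_(p <- primes m) local_multiplier p n.

Definition chiK (m : nat) (n : int) : K := (chiD P m n)%:~R.

Lemma chiKE m n : chiK m n = \prod_(p <- primes m) (chi P p n)%:~R.
Proof. by rewrite /chiK /chiD rmorph_prod. Qed.

Variable m : nat.
Hypothesis um : unitary N m.

Let m0 : (0 < m)%N. Proof. by case: um. Qed.

Let pN p : p \in primes m -> p \in primes N. Proof. by case: um => _ H /H[]. Qed.

Lemma local_multiplier_periodic p : p \in primes N -> periodic_mod (p ^ logn p N) (local_multiplier p).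
Proof. by move=> pn x y d; rewrite /local_multiplier (chi_periodic N0 hP hsq pn d). Qed.

Lemma multiplier_periodic : periodic_mod m (multiplier m).
Proof. by apply: (prod_periodic um) => p pm; apply: local_multiplier_periodic; exact: pN. Qed.

Lemma chiD_periodic : periodic_mod m (chiD P m).
Proof. by apply: (prod_periodic um) => p pm; apply: (chi_periodic N0 hP hsq); exact: pN. Qed.

Lemma chiDM : {morph chiD P m : x y / x * y}.
Proof.
move=> x y; rewrite /chiD -big_split /=; apply: eq_big_seq => p pm.
exact: (chi_mul N0 hP x y (pN pm)).
Qed.

Lemma chiD1 : chiD P m 1 = 1.
Proof. by apply: big1_seq => p /andP[_ pm]; exact: (chi_one N0 hP (pN pm)). Qed.

Lemma chiD_sqr n : coprimez n m -> chiD P m n ^+ 2 = 1.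
Proof.
move=> cn; rewrite /chiD -prodrXl; apply: big1_seq => p /andP[_ pm].
rewrite (chi_sqr N0 hP n (pN pm)).
have -> // : ~~ (p %| n)%Z.
move: pm; rewrite mem_primes => /and3P[pp _ pm]; apply/negP => pn.
have : (p %| gcdz n m)%Z by rewrite dvdz_gcd pn.
by move: cn; rewrite /coprimez => /eqP ->; rewrite dvdz1 /=; case: p pp {pm pn} => [|[]].
Qed.

Lemma chi_mean0 (p : nat) n : p \in primes m ->
  \sum_(t < p) chi P p (n + t%:Z * (m %/ p)%N%:Z) = 0.
Proof.
move=> pm; have [_ /(_ _ pm)[pn lm]] := um.
move: (pm) pn; rewrite !mem_primes => /and3P[pp _ pdm] /and3P[_ _ pdN].
case: (even_prime pp) => [p2|po]; last first.
  rewrite chi_odd //.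
  rewrite -[RHS](sum_legendre pp po); apply: (sum_affine (F := legendre^~ p) (prime_gt0 pp)).
    by move=> x y; exact: legendre_mod.
  (* As p divides m exactly once, m/p is prime to p, and the steps run through all residues modulo
     p. *)
  rewrite coprimezE /= coprime_sym prime_coprime //; apply/negP => H.
  have : (p ^ 2 %| m)%N by rewrite -(divnK pdm) mulnC expnS expn1 dvdn_pmul2l ?prime_gt0.
  by rewrite pfactor_dvdn // lm hsq.
move: pdN lm; rewrite p2 => pdN lm.
rewrite !big_ord_recl big_ord0 /= mul0r !addr0 mul1r /chi /=.
by rewrite (chi2_shift N0 hP) // subrr.
Qed.

(** This fixes the constant p/(p-1): the character sums to 0 and its square is the indicator of the
    p - 1 units, so the total is p - (p/(p-1))(p-1) = 0. *)
Lemma local_multiplier_mean0 (p : nat) n : p \in primes m ->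
  \sum_(t < p) local_multiplier p (n + t%:Z * (m %/ p)%N%:Z) = 0.
Proof.
move=> pm; have cm := chi_mean0 n pm; rewrite /local_multiplier; case: eqP => p2.
  by rewrite -mulr_sumr -rmorph_sum -mulr_sumr cm !mulr0.
rewrite sumrB -mulr_sumr -rmorph_sum sumrB -mulr_sumr cm mulr0 subr0 sumr_const card_ord.
move: (pm); rewrite mem_primes => /and3P[pp _ pdm].
have po : odd p by case: (even_prime pp).
have [_ /(_ _ pm)[pn lm]] := um.
pose F (n : int) : int := (~~ (p %| n)%Z)%:R.
have -> : \sum_(t < p) chi P p (n + t%:Z * (m %/ p)%N%:Z) ^+ 2 = \sum_(t < p) F t%:Z.
  under eq_bigr do rewrite (chi_sqr N0 hP _ pn) -/(F _).
  apply: (sum_affine (prime_gt0 pp)).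
    move=> x y d; rewrite /F; congr ((~~ _)%:R).
    by apply/idP/idP => H; [rewrite -(subKr x y)|rewrite -(subrK y x)]; rewrite (rpredB,rpredD).
  rewrite coprimezE /= coprime_sym prime_coprime //; apply/negP => H.
  have : (p ^ 2 %| m)%N by rewrite -(divnK pdm) mulnC expnS expn1 dvdn_pmul2l ?prime_gt0.
  by rewrite pfactor_dvdn // lm hsq //; move: pn; rewrite mem_primes => /and3P[].
have {cm} -> : \sum_(t < p) F t%:Z = p.-1%:Z.
  case: p pp {p2 cm pm pdm po pn lm} @F => // p pp F.
  rewrite big_ord_recl /F dvdz0 add0r (eq_bigr (fun=> 1)) ?sumr_const ?card_ord ?natz //.
  by move=> i _; rewrite dvdzE /= gtnNdvd // ltnS; exact: ltn_ord.
rewrite [X in _ * X](_ : _ = p.-1%:R) // divfK ?subrr // pnatr_eq0 -lt0n.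
by case: p pp {p2 pm pdm po pn lm F} => [|[]].
Qed.

Lemma chiK_periodic : periodic_mod m (chiK m).
Proof. by move=> x y d; rewrite /chiK (chiD_periodic d). Qed.

Lemma chiKM : {morph chiK m : x y / x * y}.
Proof. by move=> x y; rewrite /chiK chiDM rmorphM. Qed.

Variable z : K.
Hypothesis zprim : m.-primitive_root z.

Lemma not_coprime_prime (u : int) : ~~ coprimez u m -> exists2 p, p \in primes m & (p %| u)%Z.
Proof.
rewrite coprimezE /= => nc; have d0 : (1 < gcdn `|u| m)%N.
  by rewrite ltn_neqAle eq_sym nc gcdn_gt0 m0 orbT.
exists (pdiv (gcdn `|u| m)).
  by rewrite mem_primes pdiv_prime // m0 /= (dvdn_trans (pdiv_dvd _)) ?dvdn_gcdr.
by rewrite dvdzE (dvdn_trans (pdiv_dvd _)) ?dvdn_gcdl.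
Qed.

Lemma fourier_multiplier_eq0 (u : int) : ~~ coprimez u m -> fourier m z (multiplier m) u = 0.
Proof.
case/not_coprime_prime => p pm pu; move: (pm); rewrite mem_primes => /and3P[pp _ pdm].
apply: (fourier_eq0 zprim pp pdm pu multiplier_periodic) => n.
apply: (prod_mean0 um _ n pm) => [q qm|k]; last exact: local_multiplier_mean0.
by apply: local_multiplier_periodic; exact: pN.
Qed.

Lemma fourier_chiK_eq0 (u : int) : ~~ coprimez u m -> fourier m z (chiK m) u = 0.
Proof.
case/not_coprime_prime => p pm pu; move: (pm); rewrite mem_primes => /and3P[pp _ pdm].
apply: (fourier_eq0 zprim pp pdm pu chiK_periodic) => n.
under eq_bigr do rewrite chiKE.
apply: (prod_mean0 (g := fun p n => (chi P p n)%:~R) um _ n pm) => [q qm|k].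
  by move=> x y d; rewrite (chi_periodic N0 hP hsq (pN qm) d).
by rewrite -rmorph_sum chi_mean0.
Qed.

Lemma chiK_eq0 (u : int) : ~~ coprimez u m -> chiK m u = 0.
Proof.
case/not_coprime_prime => p pm pu; rewrite chiKE (big_rem p pm) /=.
have := chi_sqr N0 hP u (pN pm); rewrite pu /= => /eqP; rewrite expf_eq0 /= => /eqP ->.
by rewrite mul0r.
Qed.

(** Writing c = p/(p-1), the right side is, for odd p, 1 where chi = ep and 2c - 1 where chi = -ep,
    with c >= 1; for p = 2 it is twice the square of chi. So the multiplier correlates positively
    with the character once the sign ep is removed. *)
Lemma local_multiplier_chi_ge p n : p \in primes N ->
  (chi P p n ^+ 2)%:~R <= (ep p)%:~R * (local_multiplier p n * (chi P p n)%:~R) :> K.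
Proof.
move=> pn; have p1 : (1 < p)%N by move: pn; rewrite mem_primes => /and3P[/prime_gt1].
have c3 : [\/ chi P p n = 0, chi P p n = 1 | chi P p n = -1].
  have := chi_sqr N0 hP n pn; case: (p %| n)%Z => /= /eqP; rewrite ?sqrf_eq0 ?sqrf_eq1.
    by move/eqP; constructor 1.
  by case/orP => /eqP; [constructor 2|constructor 3].
have c1 : 1 <= p%:R / p.-1%:R :> K.
  by rewrite ler_pdivlMr ?ltr0n ?mul1r ?ler_nat; case: p p1 {pn c3}.
have c2 : 1 <= 2 * (p%:R / p.-1%:R) - 1 :> K.
  by rewrite lerBrDr mulr_natl mulr2n lerD.
rewrite /local_multiplier; set c := _ / _ in c1 c2 *.
have vE (x y : K) : x = y -> 1 <= y -> 1 <= x by move=> ->.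
by case: c3 => ->; case: (hep pn) => ->; case: ifP => _; rewrite ?expr0n ?mulr0 //;
  rewrite ?sqrrN ?expr1n; 
  first [ by apply: (vE _ 2); [ring|rewrite ler1n] | by apply: (vE _ 1); [ring|]
        | by apply: (vE _ (2 * c - 1)); [ring|] ].
Qed.

Lemma sum_multiplier_chi_neq0 : \sum_(n < m) multiplier m n%:Z * chiK m n%:Z != 0.
Proof.
pose F n := multiplier m n * chiK m n.
have Fper : periodic_mod m F.
  by move=> x y d; rewrite /F (multiplier_periodic d) (chiK_periodic d).
pose E : K := \prod_(p <- primes m) (ep p)%:~R.
have EF n : E * F n = \prod_(p <- primes m) ((ep p)%:~R * (local_multiplier p n * (chi P p n)%:~R)).
  by rewrite !big_split /= -chiKE.
(* All terms are nonnegative, so one positive term suffices. The shift by 1 puts the unit n = 1 at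
   index 0, which exists even for m = 1. *)
apply/eqP => S0; have : 0 < E * \sum_(n < m) F (n%:Z + 1).
  rewrite mulr_sumr; under eq_bigr do rewrite EF.
  rewrite (bigD1 (Ordinal m0)) //= add0r ltr_wpDr //.
    apply: sumr_ge0 => i _; rewrite big_seq prodr_ge0 // => p pm.
    by apply: le_trans (local_multiplier_chi_ge _ (pN pm)); rewrite ler0z sqr_ge0.
  rewrite big_seq; apply: prodr_gt0 => p pm.
  by apply: lt_le_trans (local_multiplier_chi_ge _ (pN pm)); rewrite (chi_one N0 hP (pN pm)) expr1n ltr01.
by rewrite (sum_shift m0 Fper) S0 mulr0 ltxx.
Qed.

(** Exchanging sums moves the transform onto the real character, where it equals the character times
    its Gauss sum. The Gauss sum is nonzero, for otherwise the transform of the character would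
    vanish identically, and the character with it by inversion. *)
Lemma fourier_multiplier_chi_neq0 : \sum_(u < m) fourier m z (multiplier m) u%:Z * chiK m u%:Z != 0.
Proof.
have -> : \sum_(u < m) fourier m z (multiplier m) u%:Z * chiK m u%:Z =
   \sum_(n < m) multiplier m n%:Z * fourier m z (chiK m) n%:Z.
  rewrite /fourier; under eq_bigr do rewrite mulr_sumr mulr_suml.
  under [RHS]eq_bigr do rewrite 2!mulr_sumr.
  rewrite exchange_big /=; apply: eq_bigr => n _; apply: eq_bigr => u _.
  by rewrite [n%:Z * _]mulrC; ring.
have -> : \sum_(n < m) multiplier m n%:Z * fourier m z (chiK m) n%:Z =
   (\sum_(n < m) multiplier m n%:Z * chiK m n%:Z) * fourier m z (chiK m) 1.
  rewrite mulr_suml; apply: eq_bigr => n _.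
  have [cn|nc] := boolP (coprimez n%:Z m); last first.
    by rewrite fourier_chiK_eq0 // chiK_eq0 // !mulr0 mul0r.
  rewrite -(fourier_separable zprim chiK_periodic chiKM cn) -mulrA; congr (_ * _).
  by rewrite mulrA /chiK -expr2 -rmorphXn chiD_sqr // mul1r.
apply: mulf_neq0; first exact: sum_multiplier_chi_neq0.
apply/eqP => g0; have : chiK m 1 = 0.
  rewrite (fourier_inv zprim 1 chiK_periodic) big1 // => u _.
  have [cn|nc] := boolP (coprimez u%:Z m); last by rewrite fourier_chiK_eq0 ?mul0r.
  have := fourier_separable zprim chiK_periodic chiKM cn; rewrite g0 => /eqP.
  rewrite mulf_eq0 => /orP[/eqP c0|/eqP ->]; last by rewrite mul0r.
  have := chiD_sqr cn; move: c0; rewrite /chiK => /eqP; rewrite intr_eq0 => /eqP ->.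
  by rewrite expr0n => /eqP; rewrite eq_sym oner_eq0.
by rewrite /chiK chiD1 => /eqP; rewrite oner_eq0.
Qed.

End Multiplier.

(** * The complex exponential *)

Section Exponential.
Context {R : realType}.
Local Notation C := R[i].
Implicit Types (z w tau : C).

Lemma cexpD z w : cexp (z + w) = cexp z * cexp w.
Proof.
case: z => a b; case: w => c d; rewrite /cexp /= expRD cosD sinD.
by rewrite /real_complex_def; simpc; apply/eqP; rewrite eq_complex /=; apply/andP; split;
   apply/eqP; ring.
Qed.

(** The usual e(z) = exp(2 pi i z). *)
Definition ee z : C := cexp (2 * (pi : R)%:C%C * 'i%C * z).

Lemma eeD z w : ee (z + w) = ee z * ee w.
Proof. by rewrite /ee mulrDr cexpD. Qed.

Lemma cexp0 : cexp (0 : C) = 1.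
Proof. by rewrite /cexp /= expR0 cos0 sin0 mulr1. Qed.

Lemma ee0 : ee 0 = 1. Proof. by rewrite /ee mulr0 cexp0. Qed.

Lemma ee_neq0 z : ee z != 0.
Proof.
apply/eqP => e0; have := eeD z (- z).
by rewrite subrr ee0 e0 mul0r => /eqP; rewrite oner_eq0.
Qed.

Lemma eeN z : ee (- z) = (ee z)^-1.
Proof. by apply: (mulfI (ee_neq0 z)); rewrite -eeD subrr ee0 divff ?ee_neq0. Qed.

Lemma ee1 : ee 1 = 1.
Proof.
rewrite /ee mulr1 /cexp; have -> : 2 * (pi : R)%:C%C * 'i%C = (0 +i* (pi *+ 2))%C :> C.
  by rewrite mulr_natl -rmorphMn /=; simpc.
by rewrite /= expR0 cos2pi sin2pi mul1r.
Qed.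

Lemma eeX z (n : int) : ee (n%:~R * z) = ee z ^ n.
Proof.
have nat (m : nat) : ee (m%:R * z) = ee z ^+ m.
  elim: m => [|m IH]; first by rewrite mul0r ee0 expr0.
  by rewrite -natr1 mulrDl mul1r eeD IH exprSr.
case: n => n; first exact: nat.
by rewrite NegzE rmorphN mulNr eeN nat -invr_expz.
Qed.

Lemma ee_int (n : int) : ee n%:~R = 1.
Proof. by rewrite -[n%:~R]mulr1 eeX ee1 exp1rz. Qed.

(** The fractional part y satisfies cos(2 pi y) = 1. Injectivity of the cosine on [0, pi] gives y =
    0 if y <= 1/2; otherwise, applied to 1 - y, it gives y = 1, which is excluded. *)
Lemma ee_real_eq1 (x : R) : ee x%:C%C = 1 -> x \is a Num.int.
Proof.
pose y := x - (Num.floor x)%:~R => H.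
have y01 : 0 <= y < 1.
  by have := floorD1_gt x; rewrite /y subr_ge0 floor_le_tmp /= intrD; lra.
suff y0 : y = 0 by rewrite -[x](subrK (Num.floor x)%:~R) -/y y0 add0r rpred_int.
have {H} : ee y%:C%C = 1.
  by rewrite rmorphB /= eeD H mul1r rmorph_int -rmorphN ee_int.
rewrite /ee /cexp; have -> : 2 * (pi : R)%:C%C * 'i%C * y%:C%C = (0 +i* (pi *+ 2 * y))%C :> C.
  by rewrite mulr_natl -rmorphMn /=; simpc.
rewrite /= expR0 mul1r => /eqP; rewrite eq_complex /= => /andP[/eqP c1 _].
have pi0 : 0 < (pi : R) by exact: pi_gt0.
have in0pi (t : R) : 0 <= t -> t <= 2^-1 -> (pi *+ 2 * t \in `[0, pi])%R.
  by move: (pi : R) pi0 => p p0 t0 t2; rewrite in_itv /= mulr2n; apply/andP; split; nra.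
have zero0pi : ((0 : R) \in `[0, pi])%R by rewrite in_itv /= lexx ltW.
case/andP: y01 => y0 y1.
have [yh|yh] := leP y 2^-1.
  have : pi *+ 2 * y = 0.
    by apply: cos_inj; rewrite ?c1 ?cos0 // in0pi.
  by move/eqP; rewrite mulf_eq0 mulrn_eq0 /= (gt_eqF pi0) /= => /eqP.
have : pi *+ 2 * (1 - y) = 0.
  apply: cos_inj => //; first by apply: in0pi; lra.
  rewrite cos0 -[RHS]c1 -(cosN (pi *+ 2 * y)) -[in RHS](cosD2pi (- _)).
  by congr cos; ring.
move/eqP; rewrite mulf_eq0 mulrn_eq0 /= (gt_eqF pi0) /= subr_eq0 => /eqP e.
by rewrite -e ltxx in y1.
Qed.

Lemma qpowE tau (x : rat) : qpow tau x = ee (tau * ratr x).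
Proof. by rewrite /qpow /ee mulrA. Qed.

Lemma qpow_eeX tau (n : int) (M : nat) :
  qpow tau (n%:~R / M%:R) = ee (tau / M%:R) ^ n.
Proof.
rewrite qpowE -eeX rmorphM fmorphV rmorph_int rmorph_nat; congr ee; ring.
Qed.

Lemma ee_im (s : nat) (M : nat) : ee (s%:R * 'i%C / M%:R) = (expR (- (pi *+ 2) / M%:R) ^+ s)%:C%C :> C.
Proof.
have -> : s%:R * 'i%C / M%:R = s%:~R * ('i%C / M%:R) :> C by rewrite mulrA.
rewrite eeX -exprnP rmorphXn; congr (_ ^+ _).
rewrite /ee /cexp.
have -> : 2 * (pi : R)%:C%C * 'i%C * ('i%C / M%:R) = (- (pi *+ 2) / M%:R)%:C%C :> C.
  rewrite mulr_natl -rmorphMn mulrA -[_ * 'i%C * 'i%C]mulrA -expr2 sqr_i mulrN1.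
  by rewrite rmorphM rmorphN fmorphV rmorph_nat.
by rewrite /= cos0 sin0 mulr1.
Qed.

End Exponential.

(** * Expansions in fractional powers of q *)

Lemma mulr_exprzM (K : fieldType) (x y z : K) (n : int) :
  x * (y * z) ^ n = x * z ^ n * y ^ n.
Proof. by rewrite expfzMl [y ^ n * _]mulrC mulrA. Qed.

Section Expansions.
Context {R : realType}.
Local Notation C := R[i].
Implicit Types (g : C -> C) (c : int -> C) (tau : C).

(** The first index is a parameter, so that series to be added can be given a common one;
    convergence is that of partial sums from there. *)
Definition qexp_from (n0 : int) (M : nat) g c : Prop :=
  (forall n : int, n < n0 -> c n = 0) /\
  forall tau, upper tau ->
    (series (fun j : nat => c (n0 + j%:Z) * ee (tau / M%:R) ^ (n0 + j%:Z) : C^o)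
       @ \oo --> (g tau : C^o))%classic.

Lemma qexpansionP M g c : qexpansion M g c <-> exists n0, qexp_from n0 M g c.
Proof.
split=> [[n0 [H0 H]]|[n0 [H0 H]]]; exists n0; split=> // tau /H.
  by under eq_fun do rewrite qpow_eeX.
by under [X in series X]eq_fun do rewrite -qpow_eeX.
Qed.

Lemma qexp_from_lower n0 n1 M g c : n1 <= n0 -> qexp_from n0 M g c -> qexp_from n1 M g c.
Proof.
move=> n10 [H0 H]; split=> [n nn|tau ut]; first by apply: H0; lia.
pose t := `|n0 - n1|%N; have tE : n0 = n1 + t%:Z by lia.
rewrite -(cvg_shiftn t).
suff -> : [sequence (series (fun j : nat => c (n1 + j%:Z) * ee (tau / M%:R) ^ (n1 + j%:Z)) : C^o^nat)
   (n + t)%N]_n = series (fun j : nat => c (n0 + j%:Z) * ee (tau / M%:R) ^ (n0 + j%:Z) : C^o).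
  exact: H.
apply/funext => n; rewrite /series /= addnC big_nat_cond.
rewrite -big_nat_cond (@big_cat_nat _ _ _ t) ?leq_addr //= big_nat big1 ?add0r => [|j jt]; last first.
  by rewrite H0 ?mul0r //; lia.
rewrite -{1}[t]add0n big_addn addnC addnK; apply: eq_bigr => j _.
by rewrite (_ : n1 + (j + t)%N%:Z = n0 + j%:Z) //; lia.
Qed.

Lemma qexp_fromD n0 M g1 g2 c1 c2 : qexp_from n0 M g1 c1 -> qexp_from n0 M g2 c2 ->
  qexp_from n0 M (fun t => g1 t + g2 t) (fun n => c1 n + c2 n).
Proof.
move=> [H1 K1] [H2 K2]; split=> [n nn|tau ut]; first by rewrite H1 ?H2 ?addr0.
have := cvgD (K1 _ ut) (K2 _ ut).
suff -> : (series (fun j : nat => (c1 (n0 + j%:Z) + c2 (n0 + j%:Z)) * ee (tau / M%:R) ^ (n0 + j%:Z) : C^o)) =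
  series (fun j : nat => c1 (n0 + j%:Z) * ee (tau / M%:R) ^ (n0 + j%:Z) : C^o) +
  series (fun j : nat => c2 (n0 + j%:Z) * ee (tau / M%:R) ^ (n0 + j%:Z) : C^o)
  by move=> H; exact: H.
apply/funext => n; rewrite {1}/series /=; under eq_bigr do rewrite mulrDl.
by rewrite big_split.
Qed.

Lemma qexp_fromZ n0 M g c (k : C) : qexp_from n0 M g c ->
  qexp_from n0 M (fun t => k * g t) (fun n => k * c n).
Proof.
move=> [H1 K1]; split=> [n nn|tau ut]; first by rewrite H1 ?mulr0.
have := cvgMl_tmp (a := k) (K1 _ ut).
suff -> : (series (fun j : nat => (k * c (n0 + j%:Z)) * ee (tau / M%:R) ^ (n0 + j%:Z) : C^o)) =
  (fun n => k * series (fun j : nat => c (n0 + j%:Z) * ee (tau / M%:R) ^ (n0 + j%:Z) : C^o) n)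
  by move=> H; exact: H.
by apply/funext => n; rewrite /series /= mulr_sumr; apply: eq_bigr => j _; rewrite mulrA.
Qed.

Lemma qexp_from0 n0 M : qexp_from n0 M (fun=> 0) (fun=> 0).
Proof.
split=> // tau _; under [X in series X]eq_fun do rewrite mul0r.
suff -> : series (fun=> 0 : C^o) = (fun=> 0) by exact: cvg_cst.
by apply/funext => n; rewrite /series /= big1.
Qed.

Lemma eq_qexp_from n0 M g1 g2 c1 c2 : (forall tau, upper tau -> g1 tau = g2 tau) -> c1 =1 c2 ->
  qexp_from n0 M g1 c1 -> qexp_from n0 M g2 c2.
Proof.
move=> Hg Hc [H0 H]; have -> : c2 = c1 by apply/funext => n; rewrite Hc.
by split=> [|tau ut]; [exact: H0|rewrite -(Hg _ ut); exact: H].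
Qed.

Lemma qexp_from_sum n0 M (I : finType) (G : I -> C -> C) (cs : I -> int -> C) :
  (forall i, qexp_from n0 M (G i) (cs i)) ->
  qexp_from n0 M (fun t => \sum_i G i t) (fun n => \sum_i cs i n).
Proof.
move=> H.
suff K (s : seq I) : qexp_from n0 M (fun t => \sum_(i <- s) G i t) (fun n => \sum_(i <- s) cs i n).
  exact: K.
elim: s => [|i s IH].
  by apply: eq_qexp_from (qexp_from0 n0 M) => [tau _|n]; rewrite big_nil.
by apply: eq_qexp_from (qexp_fromD (H i) IH) => [tau _|n]; rewrite big_cons.
Qed.

Lemma qexp_from_affine n0 M g c (r : nat) (b : R) : (0 < r)%N -> qexp_from n0 M g c ->
  qexp_from n0 (M * r) (fun t => g (t / r%:R + b%:C%C))
    (fun n => c n * ee (b%:C%C / M%:R) ^ n).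
Proof.
move=> r0 [H0 H]; split=> [n nn|tau ut]; first by rewrite H0 ?mul0r.
have ut' : upper (tau / r%:R + b%:C%C).
  rewrite /upper raddfD /= addr0.
  have -> : tau / r%:R = tau * (r%:R^-1)%:C%C by rewrite fmorphV rmorph_nat.
  move: ut; rewrite /upper; case: (tau) => x y /= y0; rewrite mulr0 add0r.
  by rewrite mulr_gt0 // invr_gt0 ltr0n.
suff E : (fun j : nat => c (n0 + j%:Z) * ee (b%:C%C / M%:R) ^ (n0 + j%:Z) *
    ee (tau / (M * r)%:R) ^ (n0 + j%:Z)) =
  (fun j : nat => c (n0 + j%:Z) * ee ((tau / r%:R + b%:C%C) / M%:R) ^ (n0 + j%:Z)).
  by rewrite E; exact: (H _ ut').
apply/funext => j.
rewrite (_ : (tau / r%:R + b%:C%C) / M%:R = tau / (M * r)%:R + b%:C%C / M%:R).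
  rewrite eeD; symmetry.
  exact: (mulr_exprzM (c (n0 + j%:Z)) (ee (tau / (M * r)%:R)) (ee (b%:C%C / M%:R))).
by rewrite mulrDl natrM invfM; congr (_ + _); ring.
Qed.

Lemma qexp_from_stretch n0 M g c (e : nat) : (0 < e)%N -> qexp_from n0 M g c ->
  qexp_from (n0 * e%:Z) (M * e) g (fun n => if (e %| n)%Z then c (n %/ e)%Z else 0).
Proof.
move=> e0 [H0 H]; split=> [n nn|tau ut].
  case: ifP => // /dvdzP[x nE]; rewrite nE mulzK; last lia.
  by apply: H0; nia.
(* [u j] is j/e rounded up, the number of multiples of e below j: the j-th partial sum of the
   stretched series is the [u j]-th one of the original. *)
pose u (j : nat) := ((j + e.-1) %/ e)%N.
pose F (j : nat) : C := c (n0 + j%:Z) * ee (tau / M%:R) ^ (n0 + j%:Z).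
have -> : series (fun j : nat => (if (e %| n0 * e%:Z + j%:Z)%Z then c ((n0 * e%:Z + j%:Z) %/ e)%Z else 0) *
     ee (tau / (M * e)%:R) ^ (n0 * e%:Z + j%:Z) : C^o) = (series (F : C^o^nat)) \o u.
  apply/funext => n; rewrite /series /=.
  elim: n => [|n IH]; first by rewrite /u add0n divn_small ?prednK // !big_geq.
  rewrite big_nat_recr //= IH /u.
  have -> : (e %| n0 * e%:Z + n%:Z)%Z = (e %| n)%N.
    by rewrite rpredDl ?dvdz_mull.
  case: ifP => [/dvdnP[q ->]|ne]; last first.
    rewrite mul0r addr0; congr (\sum_(0 <= _ < _) _).
    have := divn_eq n e; have := ltn_pmod n e0; set q := (n %/ e)%N; set r := (n %% e)%N.
    move=> re nE; have r0 : r != 0%N by apply/eqP => r0; rewrite /dvdn -/r r0 in ne.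
    have -> : (n + e.-1 = q.+1 * e + r.-1)%N by nia.
    have -> : (n.+1 + e.-1 = q.+1 * e + r)%N by nia.
    by rewrite !divnMDl // !divn_small //; lia.
  rewrite divnMDl // (_ : ((q * e).+1 + e.-1 = q.+1 * e)%N) ?mulnK //; last by nia.
  rewrite (divn_small (m := e.-1)) ?prednK // addn0 big_nat_recr //=; congr (_ + _).
  rewrite /F PoszM -mulrDl mulzK; last by lia.
  congr (_ * _); rewrite -!eeX; congr ee; rewrite natrM rmorphM /= -pmulrn.
  rewrite invfM; move: (M%:R^-1) => w; field.
  by rewrite pnatr_eq0 -lt0n.
apply: (@cvg_comp _ _ _ u (series (F : C^o^nat)) _ \oo%classic); last exact: H.
apply/cvgnyPge => A; exists (A * e)%N => // n /= An.
by rewrite /u leq_divRL //; lia.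
Qed.

End Expansions.

(** * Uniqueness of expansions *)

Section Uniqueness.
Context {R : realType}.
Local Notation C := R[i].

Lemma realcM (x y : R) : (x * y)%:C%C = x%:C%C * y%:C%C :> C.
Proof. exact: rmorphM. Qed.

Lemma realcX (x : R) n : (x ^+ n)%:C%C = x%:C%C ^+ n :> C.
Proof. exact: rmorphXn. Qed.

Lemma norm_realc (x : R) : 0 <= x -> `|x%:C%C : C| = x%:C%C.
Proof. by move=> x0; rewrite ger0_norm // lecE /= eqxx. Qed.

Lemma ltr_realc (x y : R) : (x%:C%C < y%:C%C :> C) = (x < y).
Proof. by rewrite ltcE /= eqxx. Qed.

Definition psums (v : nat -> C) (x : C) (n : nat) : C := \sum_(0 <= j < n) v j * x ^+ j.

Definition small_eventually (u : nat -> C) : Prop :=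
  forall e : R, 0 < e -> exists A : nat, forall n : nat, (A <= n)%N -> `|u n| < e%:C%C.

Lemma geom_le (r : R) (n : nat) : 0 <= r < 1 -> (1 - r) * (\sum_(0 <= i < n) r ^+ i) <= 1.
Proof.
move=> /andP[r0 r1]; have := subrX1 r n; rewrite big_mkord.
have rn : 0 <= r ^+ n by exact: exprn_ge0.
lra.
Qed.

(** A power series that converges to 0 at the points t^s vanishes. The point 1, from s = 0, bounds
    the coefficients; the other points accumulate at 0 and kill the leading coefficient. *)
Lemma psums_eq0 (v : nat -> C) (t : R) : 0 < t < 1 ->
  (forall s : nat, small_eventually (psums v (t ^+ s)%:C%C)) -> forall j, v j = 0.
Proof.
move=> /andP[t0 t1] H.
have [B B0 vB] : exists2 B : R, 0 <= B & forall j, `|v j| <= B%:C%C.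
  have [A HA] := H 0%N 1 ltr01.
  pose S : C := \sum_(0 <= j < A) `|v j|.
  have S0 : 0 <= S by apply: sumr_ge0.
  (* The sum S bounds the first A coefficients; a later one is a difference of two partial sums,
     each smaller than 1. *)
  exists (complex.Re S + 2); first by rewrite addr_ge0 //; move: S0; rewrite lecE => /andP[].
  move=> j; rewrite rmorphD /= RRe_real ?ger0_real //.
  have [jA|Aj] := ltnP j A.
    rewrite (le_trans (_ : _ <= S)) ?lerDl ?ler0c ?ler0n //.
    rewrite /S big_mkord (bigD1 (Ordinal jA)) //= lerDl; exact: sumr_ge0.
  have h1 := HA _ Aj; have h2 := HA _ (leqW Aj).
  have -> : v j = psums v (t ^+ 0)%:C%C j.+1 - psums v (t ^+ 0)%:C%C j.
    by rewrite /psums big_nat_recr //= expr0 rmorph1 expr1n mulr1 addrAC subrr add0r.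
  apply: (le_trans (ler_normB _ _)).
  rewrite (_ : 2%:C%C = 1%:C%C + 1%:C%C); last by rewrite -rmorphD.
  by rewrite -[X in X <= _]add0r lerD // lerD ?ltW.
elim/ltn_ind => J IH.
(* With r = t^(s+1), dividing by r^J leaves v_J plus a tail of size at most B r/(1-r), and r <= t
   gives the uniform factor 1 - t. *)
have key (s : nat) : (1 - t) * complex.Re `|v J| <= B * t ^+ s.+1.
  have r0 : 0 < t ^+ s.+1 by rewrite exprn_gt0.
  have r1 : t ^+ s.+1 <= t by rewrite exprS ger_pMr // exprn_ile1 // ltW.
  move: (H s.+1) r0 r1; move: (t ^+ s.+1) => r Hr r0 r1.
  have rJ0 : 0 < r ^+ J by rewrite exprn_gt0.
  apply/ler_addgt0Pr => e e0.
  have [A HA] := Hr (e * r ^+ J) (mulr_gt0 e0 rJ0).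
  have /HA : (A <= J + A.+1)%N by lia.
  have -> : psums v r%:C%C (J + A.+1) =
     (r ^+ J)%:C%C * (v J + \sum_(0 <= i < A) v (J + i.+1)%N * r%:C%C ^+ i.+1).
    rewrite /psums (@big_cat_nat _ _ _ J) ?leq_addr //= big_nat big1 ?add0r; last first.
      by move=> i iJ; rewrite IH ?mul0r.
    rewrite -{1}[J]add0n big_addn addKn big_nat_recl // add0n mulrDr mulr_sumr realcX mulrC.
    congr (_ + _); apply: eq_bigr => i _.
    by rewrite addnC exprD; ring.
  rewrite normrM norm_realc ?(ltW rJ0) // realcM mulrC ltr_pM2r; last by rewrite ltr_realc.
  move=> HJ.
  have : `|v J| <= e%:C%C + (B * \sum_(0 <= i < A) r ^+ i.+1)%:C%C.
    rewrite -[v J](addrK (\sum_(0 <= i < A) v (J + i.+1)%N * r%:C%C ^+ i.+1)).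
    apply: (le_trans (ler_normB _ _)); apply: lerD; first exact: ltW.
    apply: (le_trans (ler_norm_sum _ _ _)).
    rewrite mulr_sumr rmorph_sum /=; apply: ler_sum => i _.
    by rewrite normrM realcM ler_pM // normrX norm_realc ?(ltW r0) // realcX.
  rewrite -rmorphD lecE /= => /andP[_].
  have : \sum_(0 <= i < A) r ^+ i.+1 = r * \sum_(0 <= i < A) r ^+ i.
    by rewrite mulr_sumr; apply: eq_bigr => i _; rewrite exprS.
  move=> ->; have := @geom_le r A; set G := \sum_(0 <= i < A) _.
  have G0 : 0 <= G by apply: sumr_ge0 => i _; exact/exprn_ge0/ltW.
  move=> /(_ _)Hg Hx; have {}Hg : (1 - r) * G <= 1 by apply: Hg; apply/andP; split; lra.
  have Hx2 : (1 - t) * complex.Re `|v J| <= (1 - t) * (e + B * (r * G)) by rewrite ler_pM2l //; lra.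
  apply: (le_trans Hx2); rewrite mulrDr addrC lerD //; last first.
    by rewrite ger_pMl //; lra.
  have : (1 - t) * G <= 1 by apply: le_trans Hg; rewrite ler_wpM2r //; lra.
  move=> Hg'; rewrite (_ : (1 - t) * _ = B * r * ((1 - t) * G)); last by ring.
  by apply: ler_piMr => //; rewrite mulr_ge0 // ltW.
have Re0 : 0 <= complex.Re `|v J| by have := normr_ge0 (v J); rewrite lecE => /andP[].
suff RJ : complex.Re `|v J| = 0.
  by apply/eqP; rewrite -normr_eq0 -[`|v J|]RRe_real ?ger0_real // RJ.
apply/eqP; rewrite eq_le Re0 andbT leNgt; apply/negP => Rpos.
pose eps := (1 - t) * complex.Re `|v J| / (B + 1).
have eps0 : 0 < eps by rewrite !mulr_gt0 ?invr_gt0 ?subr_gt0 // ltr_wpDl.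
have tn : (t ^+ n @[n --> \oo] --> (0 : R))%classic by apply: cvg_expr; rewrite gtr0_norm.
have /cvgrPdist_lt/(_ _ eps0)[A _ HA] := tn.
have := HA _ (leqnSn A); rewrite sub0r normrN gtr0_norm ?exprn_gt0 // /eps ltr_pdivlMr; last first.
  by rewrite ltr_wpDl.
have := key A; have : 0 < t ^+ A.+1 by rewrite exprn_gt0.
by set x := t ^+ _; set y := _ * complex.Re _; lra.
Qed.

Lemma qexp_from_zero n0 M (c : int -> C) : (0 < M)%N ->
  qexp_from n0 M (fun=> 0) c -> forall n, c n = 0.
Proof.
move=> M0 [H0 H] n; have [/H0 //|nn] := ltP n n0.
pose t : R := expR (- (pi *+ 2) / M%:R).
have t0 : 0 < t by exact: expR_gt0.
have t1 : t < 1.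
  rewrite -expR0 ltr_expR pmulr_llt0 ?invr_gt0 ?ltr0n //.
  by rewrite oppr_lt0 mulrn_wgt0 ?pi_gt0.
have tz : t%:C%C != 0 :> C by rewrite eq_complex /= gt_eqF.
(* The series is evaluated at tau = (s+1)i, where q^(1/M) = t^(s+1). One factor t is absorbed into
   the coefficients, so that s = 0 corresponds to the point 1. *)
pose v (j : nat) : C := c (n0 + j%:Z) * t%:C%C ^ (n0 + j%:Z).
suff vz : v `|n - n0|%N = 0.
  move/eqP: vz; rewrite /v mulf_eq0 expfz_eq0 (negPf tz) andbF orbF => /eqP <-.
  by congr c; lia.
apply: (psums_eq0 (t := t)) => [|s]; first by rewrite t0.
have ut : upper (s.+1%:R * 'i%C : C).
  by rewrite /upper -(rmorph_nat (real_complex R)) /= mul0r addr0 mulr1 ltr0n.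
have := H _ ut => /cvgrPdist_lt Hlim e e0.
pose k : C := (t ^+ s)%:C%C ^ n0.
have k0 : k != 0 by rewrite expfz_eq0 realcX expf_eq0 (negPf tz) !andbF.
have nk : 0 < `|k| by rewrite normr_gt0.
have := Hlim (e%:C%C * `|k|) => /(_ _)[]; first by rewrite mulr_gt0 // ltr_realc.
move=> A _ HA; exists A => j Aj; have := HA j Aj.
rewrite sub0r normrN /series /=.
have -> : \sum_(0 <= k0 < j) c (n0 + k0%:Z) * ee (s.+1%:R * 'i%C / M%:R) ^ (n0 + k0%:Z) =
   psums v (t ^+ s)%:C%C j * k.
  rewrite /psums mulr_suml; apply: eq_bigr => i _.
  rewrite ee_im -/t exprSr realcM expfzMl expfzDr; last by rewrite realcX expf_neq0.
  by rewrite /v /k -exprnP; ring.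
by rewrite normrM ltr_pM2r.
Qed.

Lemma qexp_from_uniq n0 M (g : C -> C) c1 c2 : (0 < M)%N ->
  qexp_from n0 M g c1 -> qexp_from n0 M g c2 -> c1 =1 c2.
Proof.
move=> M0 h1 h2 n; apply/eqP; rewrite -subr_eq0; apply/eqP.
have := qexp_fromD h1 (qexp_fromZ (-1) h2) => h.
have {h} := eq_qexp_from (g2 := fun=> 0) (c2 := fun n => c1 n - c2 n) _ _ h.
move/(_ _ _)/(qexp_from_zero M0); apply => [tau _|m]; by rewrite mulN1r ?subrr.
Qed.
End Uniqueness.

(** * The slash action *)

Lemma det2 (A : 'M[int]_2) : \det A = A 0 0 * A 1 1 - A 0 1 * A 1 0.
Proof.
rewrite (expand_det_row _ 0) !big_ord_recl big_ord0 addr0 /cofactor !det_mx11 !mxE /=.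
rewrite !expr0 !expr1 mul1r mulN1r mulrN.
by congr (A _ _ * A _ _ - A _ _ * A _ _); apply: val_inj.
Qed.

Definition mx2 (a b c d : int) : 'M[int]_2 :=
  \matrix_(i, j) (if i == 0 then (if j == 0 then a else b) else (if j == 0 then c else d)).

Section Slash.
Context {R : realType}.
Local Notation C := R[i].
Implicit Types (tau z : C) (x y : R).

(** The slash action for real entries, needed for translations by fractions and for the matrix
    [1/M b0; 0 M]. There is no determinant factor, as the matrices it is applied to have determinant
    1. *)
Definition rslash (k : int) (f : C -> C) (a b c d : R) tau : C :=
  (c%:C%C * tau + d%:C%C) ^ (- k) *
    f ((a%:C%C * tau + b%:C%C) / (c%:C%C * tau + d%:C%C)).

Lemma denom_neq0 (c d : R) tau : upper tau -> (c != 0) || (d != 0) ->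
  c%:C%C * tau + d%:C%C != 0.
Proof.
case: tau => x y; rewrite /upper /= => y0 cd; apply/eqP => /eqP.
rewrite eq_complex /= !mul0r subr0 !addr0 mulf_eq0 (gt_eqF y0) orbF => /andP[/eqP h /eqP c0].
by move: h cd; rewrite c0 mul0r add0r => ->; rewrite eqxx.
Qed.

Lemma upper_moebius (a b c d : R) tau : 0 < a * d - b * c -> upper tau ->
  upper ((a%:C%C * tau + b%:C%C) / (c%:C%C * tau + d%:C%C)).
Proof.
move=> D0 ut; have cd : (c != 0) || (d != 0).
  apply/negPn/negP; rewrite negb_or !negbK => /andP[/eqP c0 /eqP d0].
  by move: D0; rewrite c0 d0 !mulr0 subrr ltxx.
have n0 := denom_neq0 ut cd.
have := divfK n0 (a%:C%C * tau + b%:C%C); set w := _ / _.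
case: w ut {n0} => p q; case: tau => x y; rewrite /upper /= => y0 /eqP.
rewrite eq_complex /= !mul0r !subr0 !addr0 => /andP[/eqP h1 /eqP h2].
have e : q * ((c * x + d) ^+ 2 + (c * y) ^+ 2) = y * (a * d - b * c).
  have -> : q * ((c * x + d) ^+ 2 + (c * y) ^+ 2) =
     (p * (c * y) + q * (c * x + d)) * (c * x + d) - (p * (c * x + d) - q * (c * y)) * (c * y) by ring.
  by rewrite h1 h2; ring.
have : 0 < q * ((c * x + d) ^+ 2 + (c * y) ^+ 2) by rewrite e mulr_gt0.
rewrite pmulr_lgt0 // lt0r addr_ge0 ?sqr_ge0 // andbT paddr_eq0 ?sqr_ge0 // !sqrf_eq0.
rewrite mulf_eq0 (gt_eqF y0) orbF; apply/negP => /andP[/eqP h /eqP c0].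
by move: h cd; rewrite c0 mul0r add0r => ->; rewrite eqxx.
Qed.

Variables (N : nat) (k : int) (chr : int -> int) (f : C -> C).
Hypothesis fmod : forall A tau, Gamma0 N A -> upper tau ->
  slash k f A tau = (chr (A 1 1))%:~R * f tau.

Lemma modular_entries (a b c d : int) z : a * d - b * c = 1 -> (N %| c)%Z -> upper z ->
  f ((a%:~R * z + b%:~R) / (c%:~R * z + d%:~R)) = (chr d)%:~R * (c%:~R * z + d%:~R) ^ k * f z.
Proof.
move=> D1 Nc uz.
have G : Gamma0 N (mx2 a b c d).
  by split; [rewrite /SL2Z det2|]; rewrite !mxE.
have := fmod G uz; rewrite /slash !mxE /= => H.
have n0 : c%:~R * z + d%:~R != 0 :> C.
  rewrite -!(rmorph_int (real_complex R)); apply: denom_neq0 => //.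
  rewrite !intr_eq0 -negb_and; apply/negP => /andP[/eqP c0 /eqP d0].
  by move: D1; rewrite c0 d0 !mulr0.
by rewrite mulrAC -H mulrAC -expfzDr // addNr expr0z mul1r.
Qed.

Lemma rslash_Gamma0 (a b c d : int) (x1 x2 x3 x4 y1 y2 y3 y4 : R) tau :
  a * d - b * c = 1 -> (N %| c)%Z -> upper tau -> 0 < x1 * x4 - x2 * x3 ->
  y1 = a%:~R * x1 + b%:~R * x3 -> y2 = a%:~R * x2 + b%:~R * x4 ->
  y3 = c%:~R * x1 + d%:~R * x3 -> y4 = c%:~R * x2 + d%:~R * x4 ->
  rslash k f y1 y2 y3 y4 tau = (chr d)%:~R * rslash k f x1 x2 x3 x4 tau.
Proof.
move=> D1 Nc ut D0 -> -> -> ->.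
have uz := upper_moebius D0 ut; rewrite /rslash; set z := _ / _ in uz *.
have n0 : x3%:C%C * tau + x4%:C%C != 0.
  apply: denom_neq0 => //; apply/negPn/negP; rewrite negb_or !negbK => /andP[/eqP c0 /eqP d0].
  by move: D0; rewrite c0 d0 !mulr0 subrr ltxx.
have zE : z * (x3%:C%C * tau + x4%:C%C) = x1%:C%C * tau + x2%:C%C by rewrite divfK.
have n1 : c%:~R * z + d%:~R != 0 :> C.
  rewrite -!(rmorph_int (real_complex R)); apply: denom_neq0 => //.
  rewrite !intr_eq0 -negb_and; apply/negP => /andP[/eqP c0 /eqP d0].
  by move: D1; rewrite c0 d0 !mulr0.
have E (s t : int) : (s%:~R * x1 + t%:~R * x3)%:C%C * tau + (s%:~R * x2 + t%:~R * x4)%:C%C =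
    (s%:~R * z + t%:~R) * (x3%:C%C * tau + x4%:C%C) :> C.
  rewrite mulrDl -[s%:~R * z * _]mulrA zE !rmorphD !rmorphM /= !rmorph_int; ring.
rewrite !E -[in f _]mulf_div divff // mulr1 modular_entries // expfzMl -/z.
have wk : (c%:~R * z + d%:~R) ^ (- k) * (c%:~R * z + d%:~R) ^ k = 1.
  by rewrite -expfzDr // addNr expr0z.
transitivity ((c%:~R * z + d%:~R) ^ (- k) * (c%:~R * z + d%:~R) ^ k *
   ((chr d)%:~R * ((x3%:C%C * tau + x4%:C%C) ^ (- k) * f z))); last by rewrite wk mul1r.
ring.
Qed.

(* [f(tau + y)] slashed by [1 0; m 1] *)
Definition cusp_form (m : nat) (y : R) tau : C :=
  (m%:R * tau + 1) ^ (- k) * f (tau / (m%:R * tau + 1) + y%:C%C).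

(** The matrix on the right is the product [1 y; 0 1] [1 0; m 1] [1 j; 0 1]. *)
Lemma cusp_formE m y tau j : upper tau ->
  cusp_form m y (tau + j%:C%C) =
  rslash k f (1 + m%:R * y) ((1 + m%:R * y) * j + y) m%:R (m%:R * j + 1) tau.
Proof.
move=> ut; have n0 : m%:R * (tau + j%:C%C) + 1 != 0 :> C.
  have := @denom_neq0 m%:R (m%:R * j + 1) tau ut _.
  rewrite rmorphD rmorphM !rmorph_nat rmorph1 /= mulrDr addrA; apply.
  by have [->|] := eqVneq; rewrite ?mul0r ?add0r ?oner_eq0.
have e : m%:R%:C%C * tau + (m%:R * j + 1)%:C%C = m%:R * (tau + j%:C%C) + 1 :> C.
  by rewrite rmorphD rmorphM !rmorph_nat rmorph1 /= mulrDr addrA.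
rewrite /rslash /cusp_form e; congr (_ * f _).
rewrite -[in LHS](mulfK n0 y%:C%C) -mulrDl; congr (_ / _).
by rewrite !(rmorphD, rmorphM, rmorph1, rmorph_nat) /=; ring.
Qed.

(** The four real equations are the entries of [1 y'; 0 1] [1 0; m 1] [1 L; 0 1] = [a b; c d]
    [1 y; 0 1] [1 0; m 1]. *)
Lemma cusp_form_translate (m : nat) (y y' L : R) (a b c d : int) tau :
  a * d - b * c = 1 -> (N %| c)%Z -> upper tau ->
  1 + m%:R * y' = a%:~R * (1 + m%:R * y) + b%:~R * m%:R ->
  (1 + m%:R * y') * L + y' = a%:~R * y + b%:~R ->
  m%:R = c%:~R * (1 + m%:R * y) + d%:~R * m%:R ->
  m%:R * L + 1 = c%:~R * y + d%:~R ->
  cusp_form m y' (tau + L%:C%C) = (chr d)%:~R * cusp_form m y tau.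
Proof.
move=> D1 Nc ut h1 h2 h3 h4.
rewrite cusp_formE // -[tau in RHS]addr0 -(rmorph0 (real_complex R)) cusp_formE //.
apply: (rslash_Gamma0 D1 Nc ut); rewrite ?mulr0 ?add0r ?mulr1 //.
by rewrite (_ : _ - _ = 1) ?ltr01 //; ring.
Qed.

(** The equations factor [1 y; 0 1] [1 0; m 1] as [a b; c d] [1/M b0; 0 M], and the second factor
    sends tau to tau/M^2 + b0/M. *)
Lemma cusp_form_infty (m : nat) (y b0 : R) (M : nat) (a b c d : int) tau : (0 < M)%N ->
  a * d - b * c = 1 -> (N %| c)%Z -> upper tau ->
  1 + m%:R * y = a%:~R / M%:R ->
  y = a%:~R * b0 + b%:~R * M%:R ->
  m%:R = c%:~R / M%:R :> R ->
  1 = c%:~R * b0 + d%:~R * M%:R ->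
  cusp_form m y tau = (chr d)%:~R * (M%:R ^ (- k) * f (tau / (M * M)%:R + (b0 / M%:R)%:C%C)).
Proof.
move=> M0 D1 Nc ut h1 h2 h3 h4.
have Mn0 : M%:R != 0 :> R by rewrite pnatr_eq0 -lt0n.
have Mn0' : M%:R != 0 :> C by rewrite pnatr_eq0 -lt0n.
rewrite -[tau in LHS]addr0 -(rmorph0 (real_complex R)) cusp_formE // !mulr0 !add0r.
rewrite (@rslash_Gamma0 a b c d M%:R^-1 b0 0 M%:R) ?mulr0 ?addr0 //; last first.
  by rewrite mulVf // subr0 ltr01.
rewrite /rslash rmorph0 mul0r add0r rmorph_nat; congr (_ * (_ * f _)).
rewrite natrM !rmorphM !fmorphV !rmorph_nat /=; field.
exact: Mn0'.
Qed.

(** The entries say that A is, up to the sign, [a b; c d] [1 0; m 1] [1 j; 0 1]. *)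
Lemma slash_cusp_form (A : 'M[int]_2) (m : nat) (a b c d : int) (s : bool) (j : int) tau :
  a * d - b * c = 1 -> (N %| c)%Z -> upper tau ->
  A 0 0 = (-1) ^+ s * (a + b * m%:Z) -> A 1 0 = (-1) ^+ s * (c + d * m%:Z) ->
  A 0 1 = (-1) ^+ s * (a * j + b * (m%:Z * j + 1)) ->
  A 1 1 = (-1) ^+ s * (c * j + d * (m%:Z * j + 1)) ->
  slash k f A tau =
    ((-1) ^+ s) ^ (- k) * (chr d)%:~R * cusp_form m 0 (tau + (j%:~R)%:C%C).
Proof.
move=> D1 Nc ut h00 h10 h01 h11.
rewrite cusp_formE // !mulr0 !addr0 !mul1r -mulrA.
rewrite -(@rslash_Gamma0 a b c d _ _ _ _ (a + b * m%:Z)%:~R (a * j + b * (m%:Z * j + 1))%:~R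
   (c + d * m%:Z)%:~R (c * j + d * (m%:Z * j + 1))%:~R) //; first last.
- by rewrite !(intrD, intrM) -pmulrn; ring.
- by rewrite !(intrD, intrM) -pmulrn; ring.
- by rewrite !(intrD, intrM) -pmulrn; ring.
- by rewrite !(intrD, intrM) -pmulrn; ring.
- by rewrite (_ : _ - _ = 1) ?ltr01 //; ring.
rewrite /slash /rslash h00 h01 h10 h11 mulrA -expfzMl !rmorph_int.
have sg : ((-1) ^+ s : C) != 0 by rewrite signr_eq0.
congr (_ ^ _ * f _).
  by rewrite !rmorphM rmorphXn /= rmorphN1; ring.
rewrite !rmorphM rmorphXn /= rmorphN1 -!mulrA -!mulrDr -mulf_div divff // mul1r.
by [].
Qed.

End Slash.

(** * Twisting by the multiplier *)

Section Core.
Context {R : realType}.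
Local Notation C := R[i].

Lemma ee_frac_eq1 (m : nat) (n : int) : (0 < m)%N ->
  (ee (m%:R^-1 : C) ^ n == 1) = (m %| n)%Z.
Proof.
move=> m0; have mn0 : m%:R != 0 :> R by rewrite pnatr_eq0 -lt0n.
rewrite -eeX; have -> : n%:~R * m%:R^-1 = (n%:~R / m%:R : R)%:C%C :> C.
  by rewrite rmorphM fmorphV rmorph_int rmorph_nat.
apply/eqP/idP => [/ee_real_eq1/intrP[c Hc]|/dvdzP[c ->]].
  apply/dvdzP; exists c; apply: (@intr_inj R).
  by rewrite intrM -Hc -pmulrn divfK.
by rewrite intrM -pmulrn mulfK // rmorph_int ee_int.
Qed.

Lemma ee_primitive (m : nat) : (0 < m)%N -> m.-primitive_root (ee (m%:R^-1 : C)).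
Proof.
move=> m0; rewrite /primitive_root_of_unity m0; apply/forallP => i.
rewrite unity_rootE exprnP ee_frac_eq1 // dvdzE /=; apply/eqP; apply/idP/idP => [/dvdn_leq H|/eqP ->//].
by have := H isT; have := ltn_ord i; lia.
Qed.

Lemma qexp_from_fun n0 M (g1 g2 : C -> C) c : qexp_from n0 M g1 c -> qexp_from n0 M g2 c ->
  forall tau, upper tau -> g1 tau = g2 tau.
Proof.
move=> [_ H1] [_ H2] tau ut; apply: cvg_unique (H1 _ ut) (H2 _ ut).
exact: norm_hausdorff.
Qed.

Lemma upper_translate (tau : C) (b : R) : upper tau -> upper (tau + b%:C%C).
Proof. by rewrite /upper raddfD /= addr0. Qed.

Lemma qexp_from_translate n0 M (g : C -> C) c (b : R) : qexp_from n0 M g c ->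
  qexp_from n0 M (fun t => g (t + b%:C%C)) (fun n => c n * ee (b%:C%C / M%:R) ^ n).
Proof.
move=> /(qexp_from_affine b (r := 1) isT); rewrite muln1.
by apply: eq_qexp_from => // tau _; rewrite divr1.
Qed.

Variables (P : dyadic) (N : nat) (ep : nat -> int) (k : int) (f : C -> C) (a : int -> C).
Hypothesis N0 : (0 < N)%N.
Hypothesis hP : dyadic_ok P N.
Hypothesis hsq : forall p, prime p -> odd p -> (p %| N)%N -> logn p N = 1%N.
Hypothesis hep : forall p, p \in primes N -> ep p = 1 \/ ep p = -1.
Hypothesis fmod : forall A tau, Gamma0 N A -> upper tau ->
  slash k f A tau = (chiD P N (A 1 1))%:~R * f tau.
Hypothesis van : forall n p, p \in primes N -> chi P p n = - ep p -> a n = 0.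
Variable n0 : int.
Hypothesis fexp : qexp_from n0 1 f a.

Local Notation Psi := (@multiplier C P ep).
Local Notation psi := (@local_multiplier C P ep).

Lemma psi_odd_support p n : p \in primes N -> odd p -> a n != 0 -> psi p n = 1.
Proof.
move=> pN po an; rewrite /local_multiplier; case: eqP po => [->//|_ po].
have sq := chi_sqr N0 hP n pN.
suff -> : chi P p n ^+ 2 - ep p * chi P p n = 0 by rewrite mulr0 subr0.
have : chi P p n != - ep p by apply: contraNneq an => /(van pN) ->.
case: (p %| n)%Z sq => /= /eqP.
  by rewrite sqrf_eq0 => /eqP ->; rewrite mulr0 expr0n.
by rewrite sqrf_eq1 => /orP[] /eqP ->; case: (hep pN) => ->.
Qed.

Lemma psi2_support n : 2 \in primes N -> a n != 0 -> (-1) ^ n + psi 2 n = 1.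
Proof.
move=> pN an; rewrite /local_multiplier /=.
have sq := chi_sqr N0 hP n pN.
have : chi P 2 n != - ep 2 by apply: contraNneq an => /(van pN) ->.
have [c nE] : exists c : int, n = (n %% 2)%Z + 2 * c by exists (n %/ 2)%Z; lia.
have -> : (-1 : C) ^ n = (-1) ^ (n %% 2)%Z.
  rewrite {1}nE expfzDr ?oppr_eq0 ?oner_eq0 // -[X in _ * X]exprz_exp.
  by rewrite -exprnP sqrrN expr1n exp1rz mulr1.
have [n2|n2] : (n %% 2)%Z = 0 \/ (n %% 2)%Z = 1 by lia.
  have d : (2 %| n)%Z by lia.
  by move: sq; rewrite d n2 expr0z => /eqP; rewrite sqrf_eq0 => /eqP ->; rewrite !mulr0 addr0.
have d : (2 %| n)%Z = false by lia.
move: sq; rewrite d n2 expr1z => /eqP; rewrite sqrf_eq1.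
by case/orP => /eqP ->; case: (hep pN) => -> //= _; ring.
Qed.

Variables (e m' M : nat).
Hypothesis NE : N = (e * m' * M)%N.
Hypothesis cMm : coprime M m'.
Hypothesis NmM : forall p, prime p -> (p %| N)%N -> (p %| m' * M)%N.
Hypothesis uM' : unitary N (e * M).

Local Notation m := (e * m')%N.
Local Notation M' := (e * M)%N.

Let M0 : (0 < M)%N. Proof. by move: N0; rewrite NE; case: M; rewrite ?muln0. Qed.
Let e0 : (0 < e)%N. Proof. by move: N0; rewrite NE; case: e. Qed.
Let m'0 : (0 < m')%N. Proof. by move: N0; rewrite NE; case: m'; rewrite ?muln0. Qed.
Let M'0 : (0 < M')%N. Proof. by rewrite muln_gt0 e0. Qed.

Local Notation zeta := (ee (M'%:R^-1 : C)).

Let zprim : M'.-primitive_root zeta. Proof. exact: ee_primitive. Qed.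

Let Psihat := fourier M' zeta (Psi M').

(** The twist of f by the multiplier modulo M', written through Fourier inversion as a combination
    of translates and then slashed by [1 0; m 1]. *)
Definition Gpart (tau : C) : C :=
  \sum_(u < M') Psihat u%:Z * cusp_form k f m (u%:R / M'%:R) tau.

Lemma upper_cusp (d : nat) tau : upper tau -> upper (tau / (d%:R * tau + 1) : C).
Proof.
move=> ut; have D : 0 < 1 * 1 - 0 * d%:R :> R by rewrite mulr1 mul0r subr0 ltr01.
by have := upper_moebius D ut; rewrite rmorph0 !rmorph1 rmorph_nat mul1r addr0.
Qed.

Lemma twist_exp : qexp_from n0 1
  (fun z => \sum_(u < M') Psihat u%:Z * f (z + (u%:R / M'%:R : R)%:C%C)) (fun n => a n * Psi M' n).
Proof.
have H (u : 'I_M') := qexp_fromZ (Psihat u%:Z) (qexp_from_translate (u%:R / M'%:R) fexp).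
apply: eq_qexp_from (qexp_from_sum H) => // n.
rewrite (fourier_inv zprim n (multiplier_periodic _ ep N0 hP hsq uM')) mulr_sumr.
apply: eq_bigr => u _; rewrite mulrCA; congr (_ * (_ * _)).
rewrite divr1 -exprz_exp -[zeta ^ _]eeX; congr (ee _ ^ _).
by rewrite rmorphM fmorphV !rmorph_nat -pmulrn.
Qed.

Lemma cusp_form_decomp_odd tau : 2 \notin primes M' -> upper tau ->
  cusp_form k f m 0 tau = Gpart tau.
Proof.
move=> o2 ut.
have aPsi : (fun n => a n * Psi M' n) =1 a => [n|].
  have [->|an] := eqVneq (a n) 0; first by rewrite mul0r.
  rewrite /multiplier big1_seq ?mulr1 // => p /andP[_ pM]; have [_ /(_ _ pM)[pN _]] := uM'.
  apply: psi_odd_support => //.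
  by move: (pM); rewrite mem_primes => /and3P[pp _ _]; case: (even_prime pp) pM o2 => [-> ->|].
have tw := eq_qexp_from (fun t (_ : upper t) => erefl) aPsi twist_exp.
have fE := qexp_from_fun fexp tw.
rewrite /cusp_form /Gpart /cusp_form rmorph0 addr0 fE; last exact: upper_cusp.
by rewrite mulr_sumr; apply: eq_bigr => u _; ring.
Qed.

Lemma cusp_form_decomp_even tau : 2 \in primes M' -> upper tau ->
  cusp_form k f m 0 tau = cusp_form k f m 2^-1 tau + Gpart tau.
Proof.
move=> o2 ut.
have tw := qexp_fromD (qexp_from_translate 2^-1 fexp) twist_exp.
have aPsi : (fun n => a n * ee ((2^-1 : R)%:C%C / 1%:R) ^ n + a n * Psi M' n) =1 a => [n|].
  have [->|an] := eqVneq (a n) 0; first by rewrite !mul0r addr0.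
  rewrite -mulrDr; have [_ /(_ _ o2)[pN2 _]] := uM'.
  have -> : ee ((2^-1 : R)%:C%C / 1%:R) = -1 :> C.
    rewrite divr1 /ee /cexp fmorphV rmorph_nat.
    have -> : 2 * (pi : R)%:C%C * 'i%C / 2 = (0 +i* pi)%C :> C.
      by transitivity ((pi : R)%:C%C * 'i%C : C); [field|simpc].
    by rewrite /= expR0 cospi sinpi mul1r; apply/eqP; rewrite eq_complex /= oppr0 !eqxx.
  have -> : multiplier C P ep M' n = psi 2 n.
    rewrite /multiplier (big_rem 2%N o2) /= big1_seq ?mulr1 // => p /andP[_].
    rewrite mem_rem_uniq ?primes_uniq // inE => /andP[p2 pM].
    have [_ /(_ _ pM)[pN _]] := uM'; apply: psi_odd_support => //.
    by move: pM p2; rewrite mem_primes => /and3P[pp _ _]; case: (even_prime pp) => [->|].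
  by rewrite psi2_support // mulr1.
have fE := qexp_from_fun fexp (eq_qexp_from (fun t (_ : upper t) => erefl) aPsi tw).
rewrite /cusp_form /Gpart /cusp_form rmorph0 addr0 {1}fE; last exact: upper_cusp.
by rewrite mulrDr mulr_sumr; congr (_ + _); apply: eq_bigr => u _; ring.
Qed.

(** The first column of [1 u/M'; 0 1] [1 0; m 1] is (M + um', N)/M. It is completed to the matrix [M
    + um', [bezy u]; N, [bezw u]] of Gamma_0(N), whose inverse moves the cusp to infinity. *)
Definition bezw (u : nat) : int := (egcdz (M + u * m')%N%:Z N%:Z).1.
Definition bezy (u : nat) : int := - (egcdz (M + u * m')%N%:Z N%:Z).2.

Lemma bezE (u : nat) : coprime u M' -> (M + u * m')%N%:Z * bezw u - bezy u * N%:Z = 1.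
Proof.
(* A prime dividing N divides m' or M. Dividing M + um' as well, it would in the first case divide
   M, and in the second u or m'; each contradicts a coprimality. *)
move=> cu; have cN : coprime (M + u * m') N.
  rewrite /coprime; apply/negPn/negP => h.
  have g0 : (0 < gcdn (M + u * m') N)%N by rewrite gcdn_gt0 N0 orbT.
  have [p pp pg] : exists2 p, prime p & (p %| gcdn (M + u * m') N)%N.
    by exists (pdiv (gcdn (M + u * m') N)); [apply: pdiv_prime; lia|exact: pdiv_dvd].
  have pN := dvdn_trans pg (dvdn_gcdr _ _); have pS := dvdn_trans pg (dvdn_gcdl _ _).
  have contra (x y : nat) : coprime x y -> (p %| x)%N -> (p %| y)%N -> False.
    move=> cxy px py; have : (p %| gcdn x y)%N by rewrite dvdn_gcd px.
    by rewrite (eqP cxy) dvdn1 => /eqP p1; move: pp; rewrite p1.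
  have := NmM pp pN; rewrite Euclid_dvdM // => /orP[pm|pM].
    have pM : (p %| M)%N by move: pS; rewrite dvdn_addl // dvdn_mull.
    exact: contra cMm pM pm.
  have : (p %| u * m')%N by move: pS; rewrite dvdn_addr.
  rewrite Euclid_dvdM // => /orP[pu|pm]; last exact: contra cMm pM pm.
  by apply: contra cu pu _; rewrite dvdn_mull.
rewrite /bezw /bezy; case: egcdzP => x y /= H _.
by move: H; rewrite /gcdz /= (eqP cN) => H; rewrite -[RHS]H; ring.
Qed.

(** This is b0/M, where b0 is the upper right entry left after removing the Gamma_0(N) factor. *)
Definition bezb (u : nat) : R := ((bezw u)%:~R * u%:R - (bezy u)%:~R * M'%:R) / M'%:R / M%:R.

Definition kappa (n : int) : C :=
  \sum_(u < M') (if coprime u M' then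
    Psihat u%:Z * ((chiD P N (bezw u))%:~R * (M%:R ^ (- k) * ee (bezb u)%:C%C ^ n)) else 0).

Lemma Gpart_term (u : nat) tau : coprime u M' -> upper tau ->
  cusp_form k f m (u%:R / M'%:R) tau =
  (chiD P N (bezw u))%:~R * (M%:R ^ (- k) * f (tau / (M * M)%:R + (bezb u)%:C%C)).
Proof.
move=> cu ut; have bz := bezE cu.
have bzR : (M%:R + u%:R * m'%:R) * (bezw u)%:~R - (bezy u)%:~R * (e%:R * m'%:R * M%:R) = 1 :> R.
  move: bz; move: (bezw u) (bezy u) => w y bz.
  apply: etrans (congr1 (fun x : int => x%:~R : R) bz) => /=.
  by rewrite NE intrB !intrM -!pmulrn !(natrD, natrM).
have Mn : M%:R != 0 :> R by rewrite pnatr_eq0 -lt0n.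
have en : e%:R != 0 :> R by rewrite pnatr_eq0 -lt0n.
rewrite /bezb.
apply: (@cusp_form_infty _ N k (chiD P N) f fmod m (u%:R / M'%:R) _ M (M + u * m')%N%:Z (bezy u) N%:Z (bezw u)) => //.
- by rewrite -!pmulrn !(natrD, natrM); field; rewrite Mn en.
- rewrite -!pmulrn !(natrD, natrM); move: (bezw u) (bezy u) bzR => w y bzR.
  have wE : (M%:R + u%:R * m'%:R) * w%:~R = 1 + y%:~R * (e%:R * m'%:R * M%:R) :> R.
    by apply/eqP; rewrite -subr_eq bzR.
  transitivity (((M%:R + u%:R * m'%:R) * w%:~R * u%:R -
     (M%:R + u%:R * m'%:R) * (y%:~R * (e%:R * M%:R))) / (e%:R * M%:R) + y%:~R * M%:R : R).
    by rewrite wE; field; rewrite Mn en.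
  by field; rewrite Mn en.
- by rewrite -!pmulrn [in RHS]NE !natrM mulfK.
- rewrite -!pmulrn [in X in X%:R * _]NE !natrM; move: (bezw u) (bezy u) bzR => w y bzR.
  by rewrite -[LHS]bzR; field; rewrite Mn en.
Qed.

Lemma Gpart_exp : qexp_from n0 (M * M) Gpart (fun n => kappa n * a n).
Proof.
have H (u : 'I_M') : qexp_from n0 (M * M)
   (fun t => Psihat u%:Z * cusp_form k f m (u%:R / M'%:R) t)
   (fun n => (if coprime u M' then Psihat u%:Z *
     ((chiD P N (bezw u))%:~R * (M%:R ^ (- k) * ee (bezb u)%:C%C ^ n)) else 0) * a n).
  case cu: (coprime u M'); last first.
    apply: eq_qexp_from (qexp_from0 n0 (M * M)) => [t _|n]; last by rewrite mul0r.
    by rewrite /Psihat (fourier_multiplier_eq0 _ N0 hP hsq uM') ?mul0r // coprimezE /= cu.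
  have r0 : (0 < M * M)%N by rewrite muln_gt0 M0.
  have := qexp_fromZ (Psihat u%:Z * ((chiD P N (bezw u))%:~R * M%:R ^ (- k)))
    (qexp_from_affine (bezb u) r0 fexp).
  rewrite [(1 * _)%N]mul1n; apply: eq_qexp_from => [t ut|n].
    by rewrite Gpart_term // !mulrA.
  by rewrite divr1; ring.
apply: eq_qexp_from (qexp_from_sum H) => [t _|n] //.
by rewrite -mulr_suml.
Qed.

Lemma chiD_split (x : int) : coprime m' M -> chiD P (m' * M) x = chiD P m' x * chiD P M x.
Proof.
move=> cmM; rewrite /chiD -big_cat /=; apply: perm_big; apply: uniq_perm.
- exact: primes_uniq.
- rewrite cat_uniq !primes_uniq andbT /=; apply/hasPn => p; rewrite /= !mem_primes.
  case/and3P=> pp _ pM; apply/negP => /and3P[_ _ pm].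
  have : (p %| gcdn m' M)%N by rewrite dvdn_gcd pm.
  by rewrite (eqP cmM) dvdn1 => /eqP p1; move: pp; rewrite p1.
- by move=> p; rewrite mem_cat primesM.
Qed.

(** At indices jM the root of unity no longer depends on u, and the character value is a constant
    sign times chi(u). The factor is thus a nonzero constant times the pairing of the transform of
    the multiplier with the character. *)
Lemma kappa_neq0 (j : int) : e = 1%N -> kappa (j * M%:Z) != 0.
Proof.
move=> e1; have NE' : N = (m' * M)%N by rewrite NE e1 mul1n.
have M'E : M' = M by rewrite e1 mul1n.
have Mn : M%:R != 0 :> R by rewrite pnatr_eq0 -lt0n.
have uM : unitary N M by rewrite -M'E.
have um' : unitary N m'.
  split=> // p pm; move: (pm); rewrite mem_primes => /and3P[pp _ pdm].
  rewrite NE' primesM // mem_primes pp pdm m'0; split=> //.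
  rewrite mulnC logn_Gauss //; apply: coprime_dvdl pdm _; by rewrite coprime_sym.
have uN : unitary N N by split.
have [mi Hmi] : exists mi : int, (M %| m'%:Z * mi - 1)%Z.
  have /coprimezP[[s t] /= st] : coprimez m' M by rewrite coprimezE /= coprime_sym.
  by exists s; apply/dvdzP; exists (- t); rewrite -st; ring.
(* The Bezout relation gives m'(wu - yM) = 1 modulo M, so wu - yM is the inverse [mi] of m' for
   every u. *)
have eeb (u : nat) : coprime u M' -> ee (bezb u)%:C%C ^ (j * M%:Z) = ee (M%:R^-1 : C) ^ (mi * j).
  move=> cu; have bz := bezE cu; rewrite /bezb M'E; move: (bezw u) (bezy u) bz => w y bz.
  have d : (M %| (w * u%:Z - y * M%:Z) - mi)%Z.
    rewrite -(@Gauss_dvdzr _ m'%:Z) ?coprimezE //.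
    have [c mE] := dvdzP Hmi; apply/dvdzP; exists (y * m'%:Z - w - m'%:Z * y - c).
    have {}mE : m'%:Z * mi = c * M%:Z + 1 by rewrite -mE subrK.
    have {}bz : m'%:Z * (w * u%:Z) = 1 + y * (m'%:Z * M%:Z) - w * M%:Z.
      by move: bz; rewrite NE' !(PoszD, PoszM) => bz; rewrite -[1]bz; ring.
    rewrite !mulrBr bz mE; ring.
  rewrite -[in RHS]exprz_exp -(prim_expz_mod (ee_primitive M0) d).
  rewrite [j * _]mulrC -exprz_exp; congr (_ ^ _); rewrite -!eeX; congr ee.
  rewrite !(rmorphM, rmorphB, fmorphV, rmorph_int, rmorph_nat) /= -!pmulrn; field.
  by rewrite pnatr_eq0 -lt0n.
(* [bezw u] is inverse to M + um' modulo N and the character is quadratic, so both have the same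
   value; M + um' is M modulo m' and um' modulo M. *)
have chiw (u : nat) : coprime u M' -> chiD P N (bezw u) = chiD P m' M%:Z * (chiD P M u%:Z * chiD P M m'%:Z).
  move=> cu; have bz := bezE cu.
  have -> : chiD P N (bezw u) = chiD P N (M + u * m')%N%:Z.
    have H1 : chiD P N ((M + u * m')%N%:Z * bezw u) = 1.
      rewrite -(chiD1 N0 hP uN); apply: (chiD_periodic N0 hP hsq uN).
      by rewrite -bz opprB addrC addrNK dvdz_mull.
    rewrite (chiDM N0 hP uN) in H1.
    have cN : coprimez (M + u * m')%N%:Z N.
      apply/coprimezP; exists (bezw u, - bezy u) => /=; rewrite -bz; ring.
    by rewrite -[LHS]mul1r -(chiD_sqr N0 hP uN cN) expr2 -mulrA H1 mulr1.
  rewrite [in LHS]NE' chiD_split 1?coprime_sym // -(chiDM N0 hP uM); congr (_ * _).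
    by apply: (chiD_periodic N0 hP hsq um'); rewrite PoszD PoszM addrAC subrr add0r dvdz_mull.
  by apply: (chiD_periodic N0 hP hsq uM); rewrite PoszD PoszM addrK dvdzz.
have -> : kappa (j * M%:Z) = M%:R ^ (- k) * ee (M%:R^-1 : C) ^ (mi * j) *
    (chiD P m' M%:Z * chiD P M m'%:Z)%:~R * \sum_(u < M') Psihat u%:Z * chiK C P M' u%:Z.
  rewrite /kappa mulr_sumr; apply: eq_bigr => u _; case: ifP => cu; last first.
    rewrite /Psihat (fourier_multiplier_eq0 _ N0 hP hsq uM' zprim) ?mul0r ?mulr0 //.
    by rewrite coprimezE /= cu.
  rewrite chiw // eeb // /chiK; have -> : chiD P M' u%:Z = chiD P M u%:Z by congr (chiD P _ _).
  by rewrite !intrM; ring.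
have unit (n x : nat) : unitary N n -> coprime x n -> (chiD P n x)%:~R != 0 :> C.
  move=> un cx; have := chiD_sqr N0 hP un (n := x); rewrite coprimezE => /(_ cx) H.
  by rewrite intr_eq0; apply/eqP => h0; move: H; rewrite h0.
rewrite !mulf_neq0 //.
- by rewrite expfz_neq0 // pnatr_eq0 -lt0n.
- by rewrite expfz_neq0 // ee_neq0.
- by rewrite intrM mulf_neq0 ?unit // coprime_sym.
- exact: (fourier_multiplier_chi_neq0 N0 hP hsq hep uM' zprim).
Qed.

Lemma cusp_form_twisted_expansion : exists (G : C -> C) (kap : int -> C),
  [/\ (2 \notin primes M' -> forall tau, upper tau -> cusp_form k f m 0 tau = G tau),
      (2 \in primes M' -> forall tau, upper tau ->
         cusp_form k f m 0 tau = cusp_form k f m 2^-1 tau + G tau),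
      qexp_from n0 (M * M) G (fun n => kap n * a n) &
      (e = 1%N -> forall j : int, kap (j * M%:Z) != 0)].
Proof.
exists Gpart, kappa; split.
- by move=> o2 tau; exact: cusp_form_decomp_odd.
- by move=> o2 tau; exact: cusp_form_decomp_even.
- exact: Gpart_exp.
- by move=> e1 j; exact: kappa_neq0.
Qed.

End Core.

(** * Translations of the slashed form *)

Section Translations.
Context {R : realType}.
Local Notation C := R[i].
Variables (P : dyadic) (N : nat) (k : int) (f : C -> C).
Hypothesis N0 : (0 < N)%N.
Hypothesis hP : dyadic_ok P N.
Hypothesis hsq : forall p, prime p -> odd p -> (p %| N)%N -> logn p N = 1%N.
Hypothesis fmod : forall A tau, Gamma0 N A -> upper tau ->
  slash k f A tau = (chiD P N (A 1 1))%:~R * f tau.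

Let uN : unitary N N. Proof. by []. Qed.

Lemma chiD_add_level (t : int) : chiD P N (1 + N%:Z * t) = 1.
Proof.
rewrite -[RHS](chiD1 N0 hP uN); apply: (chiD_periodic N0 hP hsq uN).
by rewrite addrAC subrr add0r dvdz_mulr.
Qed.

(** The argument is 1 + N/2 modulo N: adding N/2 flips the character at 2 and is invisible at odd
    primes. *)
Lemma chiD_half (c : nat) (t : int) : N = (4 * c)%N -> odd `|t|%N ->
  chiD P N (1 + (2 * c)%N%:Z * t) = -1.
Proof.
move=> NE ot; have n2 : 2%N \in primes N by rewrite mem_primes N0 NE dvdn_mulr.
have -> : chiD P N (1 + (2 * c)%N%:Z * t) = chiD P N (1 + (N %/ 2)%N%:Z).
  apply: (chiD_periodic N0 hP hsq uN); have -> : (N %/ 2 = 2 * c)%N by lia.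
  have [s ->] : exists s : int, t = 1 + 2 * s by exists (t %/ 2)%Z; lia.
  by apply/dvdzP; exists s; rewrite NE; lia.
rewrite /chiD (big_rem 2%N n2) /= big1_seq => [|p /andP[_]].
  rewrite mulr1 /chi /= (chi2_shift N0 hP) //; last by rewrite NE dvdn_mulr.
  by have := chi_one N0 hP n2; rewrite /chi /= => ->.
rewrite mem_rem_uniq ?primes_uniq // inE => /andP[p2 pn].
rewrite -[RHS](chi_one N0 hP pn); apply: (chi_periodic N0 hP hsq pn).
rewrite addrAC subrr add0r dvdzE /=.
move: (pn) p2; rewrite mem_primes => /and3P[pp _ pN] p2.
have : (p ^ logn p N %| N %/ 2 * 2)%N by rewrite divnK ?pfactor_dvdnn // NE dvdn_mulr.
by rewrite Gauss_dvdl // coprimeXl // prime_coprime // dvdn_prime2.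
Qed.

Variables m M : nat.
Hypothesis NE : N = (m * M)%N.

Local Notation F := (cusp_form k f m).

Ltac real_of_int := rewrite ?(rmorphD, rmorphN, rmorphM, rmorph1, intrD, rmorphB) /= -?pmulrn ?natrM.

(** The witness is [1 M; 0 1] conjugated by [1 0; m 1]. *)
Lemma cusp_form_period tau : upper tau -> F 0 (tau + (M%:R : R)%:C%C) = F 0 tau.
Proof.
move=> ut; transitivity ((chiD P N (1 + N%:Z * 1))%:~R * F 0 tau); last first.
  by rewrite chiD_add_level mul1r.
apply: (@cusp_form_translate R N k (chiD P N) f fmod m 0 0 M%:R
  (1 - N%:Z) M%:Z (- (N * m)%N%:Z) (1 + N%:Z * 1)) => //.
- by rewrite PoszM NE PoszM; ring.
- by rewrite PoszM -mulNr dvdz_mulr // rpredN.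
- by rewrite NE; real_of_int; ring.
- by real_of_int; ring.
- by rewrite NE; real_of_int; ring.
- by rewrite NE; real_of_int; ring.
Qed.

(** Conjugating [1 M; 0 1] by [1 1/2; 0 1] [1 0; m 1] gives upper right entry M(1 + m/2)^2, integral
    as 4 divides M, and lower right entry 1 + (N/2)(2 + m), an odd multiple of N/2 away from 1. *)
Lemma cusp_form_half_antiperiod (c : nat) tau : M = (4 * c)%N -> odd m -> upper tau ->
  F 2^-1 (tau + (M%:R : R)%:C%C) = - F 2^-1 tau.
Proof.
move=> ME om ut.
have d1 : (chiD P N (1 + N%:Z + (2 * (m * c))%N%:Z * m%:Z))%:~R = -1 :> C.
  have NE' : N = (4 * (m * c))%N by rewrite NE ME; lia.
  rewrite (_ : _ + _ = 1 + (2 * (m * c))%N%:Z * (2 + m%:Z)); last by rewrite {1}NE'; lia.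
  by rewrite chiD_half //; lia.
rewrite -mulN1r -[X in _ = X * _]d1.
apply: (@cusp_form_translate R N k (chiD P N) f fmod m 2^-1 2^-1 M%:R
  (1 - N%:Z - (2 * (m * c))%N%:Z * m%:Z) (M%:Z + M%:Z * m%:Z + c%:Z * m%:Z ^+ 2)
   (- (N * m)%N%:Z)) => //.
- by rewrite NE ME !PoszM; ring.
- by rewrite PoszM -mulNr dvdz_mulr // rpredN.
- by rewrite NE ME; real_of_int; field.
- by rewrite NE ME; real_of_int; field.
- by rewrite NE ME; real_of_int; field.
- by rewrite NE ME; real_of_int; field.
Qed.

(** The conjugate of [1 c; 0 1] has lower right entry 1 + cm = 1 + N/2. *)
Lemma cusp_form_antiperiod (c n : nat) tau : M = (2 * c)%N -> m = (2 * n)%N -> upper tau ->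
  F 0 (tau + (c%:R : R)%:C%C) = - F 0 tau.
Proof.
move=> ME mE ut.
have d1 : (chiD P N (1 + (2 * (n * c))%N%:Z * 1))%:~R = -1 :> C.
  by rewrite (@chiD_half (n * c)) // NE ME mE; lia.
rewrite -mulN1r -[X in _ = X * _]d1.
apply: (@cusp_form_translate R N k (chiD P N) f fmod m 0 0 c%:R
  (1 - (2 * (n * c))%N%:Z) c%:Z (- (N * n)%N%:Z)) => //.
- by rewrite NE ME mE !PoszM; ring.
- by rewrite PoszM -mulNr dvdz_mulr // rpredN.
- by rewrite mE; real_of_int; ring.
- by real_of_int; ring.
- by rewrite NE ME mE; real_of_int; ring.
- by rewrite NE ME mE; real_of_int; ring.
Qed.

(** With the extra translation by 1/2 the lower right entry becomes 1 + cm(1 + n). As n is odd, this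
    is 1 modulo N, and the sign disappears. *)
Lemma cusp_form_half_period (c n : nat) tau : M = (2 * c)%N -> m = (2 * n)%N -> odd n ->
  upper tau -> F 2^-1 (tau + (c%:R : R)%:C%C) = F 2^-1 tau.
Proof.
move=> ME mE on ut; have [s sE] : exists s, (1 + n = 2 * s)%N.
  by exists ((1 + n)./2); lia.
transitivity ((chiD P N (1 + N%:Z * s%:Z))%:~R * F 2^-1 tau); last first.
  by rewrite chiD_add_level mul1r.
have nE : n%:Z = 2 * s%:Z - 1 by lia.
have nR : n%:R = 2 * s%:R - 1 :> R by rewrite -[n%:R]/(n%:Z%:~R) nE intrB intrM.
apply: (@cusp_form_translate R N k (chiD P N) f fmod m 2^-1 2^-1 c%:R
  (1 - N%:Z * s%:Z) (4 * c%:Z * s%:Z ^+ 2) (- (N * n)%N%:Z)) => //.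
- by rewrite NE ME mE !PoszM nE; ring.
- by rewrite PoszM -mulNr dvdz_mulr // rpredN.
- by rewrite NE ME mE; real_of_int; rewrite nR; field.
- by rewrite NE ME mE; real_of_int; rewrite nR; field.
- by rewrite NE ME mE; real_of_int; rewrite nR; field.
- by rewrite NE ME mE; real_of_int; rewrite nR; field.
Qed.

(* Here [M / 4] is half an odd integer. *)
Lemma cusp_form_half_quarter (c n : nat) tau : M = (2 * c)%N -> odd c -> m = (4 * n)%N -> odd n ->
  upper tau ->
  F 2^-1 (tau + (c%:R / 2 : R)%:C%C) = (chiD P N (1 + (2 * (n * c))%N%:Z))%:~R * F 0 tau.
Proof.
move=> ME oc mE on ut.
(* s is the upper right entry of [1 1/2; 0 1] [1 0; m 1] [1 c/2; 0 1] [1 0; -m 1]; it is integral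
   because c is odd. *)
have [s sE] : exists s : nat, (1 + c + 2 * n * c = 2 * s)%N.
  by exists ((1 + c + 2 * n * c)./2); lia.
have sR : s%:R = (1 + c%:R + 2 * n%:R * c%:R) / 2 :> R.
  by have := congr1 (fun x => x%:R : R) sE; rewrite !natrD !natrM => h; lra.
apply: (@cusp_form_translate R N k (chiD P N) f fmod m 0 2^-1 (c%:R / 2)
  (1 - (2 * (n * c))%N%:Z - (4 * n * n * c)%N%:Z) s%:Z (- (N * n)%N%:Z)) => //.
- have sZ : 2 * s%:Z = 1 + c%:Z + 2 * n%:Z * c%:Z by lia.
  rewrite NE ME mE !PoszM.
  rewrite (_ : s%:Z * _ = - (2 * s%:Z) * (4 * n%:Z * n%:Z * c%:Z)); last by ring.
  by rewrite sZ; ring.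
- by rewrite PoszM -mulNr dvdz_mulr // rpredN.
- by rewrite mE; real_of_int; rewrite sR; field.
- by rewrite mE; real_of_int; rewrite sR; field.
- by rewrite NE ME mE; real_of_int; ring.
- by rewrite NE ME mE; real_of_int; field.
Qed.

End Translations.

(** * Comparison of coefficients *)

Section Comparison.
Context {R : realType}.
Local Notation C := R[i].
Implicit Types (F G H : C -> C) (c : int -> C) (tau : C).

Lemma qcoef_translate n0 D F H c c' (L : R) (z : C) : (0 < D)%N ->
  qexp_from n0 D F c -> qexp_from n0 D H c' ->
  (forall tau, upper tau -> F (tau + L%:C%C) = z * H tau) ->
  forall n, c n * ee (L%:C%C / D%:R) ^ n = z * c' n.
Proof.
move=> D0 hF hH FH; apply: (qexp_from_uniq D0 (qexp_from_translate L hF)).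
by apply: eq_qexp_from (qexp_fromZ z hH) => // tau ut; rewrite FH.
Qed.

Lemma qexp_from_diff n0 D F G H cF cG : qexp_from n0 D F cF -> qexp_from n0 D G cG ->
  (forall tau, upper tau -> F tau = H tau + G tau) ->
  qexp_from n0 D H (fun n => cF n - cG n).
Proof.
move=> hF hG FHG; apply: eq_qexp_from (qexp_fromD hF (qexp_fromZ (-1) hG)) => [tau ut|n].
  by rewrite FHG // mulN1r addrK.
by rewrite mulN1r.
Qed.

(** Every denominator D is allowed, since the expansion witnessing [contains_power] comes with an
    arbitrary one. *)
Definition dominated F G : Prop := forall n0 D cF cG, (0 < D)%N ->
  qexp_from n0 D F cF -> qexp_from n0 D G cG -> forall n, cF n != 0 -> cG n != 0.

(** The condition on n says that the exponent n/D is an integral multiple of 1/M. *)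
Definition agree_on (M : nat) F G : Prop := forall n0 D cF cG, (0 < D)%N ->
  qexp_from n0 D F cF -> qexp_from n0 D G cG ->
  forall n, ee ((M%:R : R)%:C%C / D%:R : C) ^ n = 1 -> cF n = cG n.

Variables (M : nat) (F G : C -> C).
Hypothesis M0 : (0 < M)%N.
Hypothesis Fper : forall tau, upper tau -> F (tau + (M%:R : R)%:C%C) = F tau.

Lemma qcoef_period n0 D cF n : (0 < D)%N -> qexp_from n0 D F cF -> cF n != 0 ->
  ee ((M%:R : R)%:C%C / D%:R : C) ^ n = 1.
Proof.
move=> D0 hF cn; have := qcoef_translate (z := 1) D0 hF hF.
move=> /(_ M%:R)/(_ _ n); rewrite mul1r => H; apply: (mulfI cn); rewrite mulr1 H // => tau ut.
by rewrite mul1r Fper.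
Qed.

Lemma agree_dominated : agree_on M F G -> dominated F G.
Proof. by move=> FG n0 D cF cG D0 hF hG n cn; rewrite -(FG _ _ _ _ D0 hF hG n) // (qcoef_period D0 hF cn). Qed.

Lemma eq_agree : (forall tau, upper tau -> F tau = G tau) -> agree_on M F G.
Proof.
move=> FG n0 D cF cG D0 hF hG n _; apply: (qexp_from_uniq D0 hF).
by apply: eq_qexp_from hG => // tau ut; rewrite FG.
Qed.

Variable H : C -> C.
Hypothesis FHG : forall tau, upper tau -> F tau = H tau + G tau.

(** At exponents in (1/M)Z translation by M fixes each coefficient of H, while antiperiodicity
    negates it; so it is 0. *)
Lemma antiperiodic_agree :
  (forall tau, upper tau -> H (tau + (M%:R : R)%:C%C) = - H tau) -> agree_on M F G.
Proof.
move=> Hper n0 D cF cG D0 hF hG n e1; have hH := qexp_from_diff hF hG FHG.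
have := qcoef_translate (z := -1) D0 hH hH.
move=> /(_ M%:R)/(_ _ n); rewrite e1 mulr1 mulN1r => H1.
have {}H1 : cF n - cG n = - (cF n - cG n) by apply: H1 => tau ut; rewrite mulN1r Hper.
by move/eqP: H1; rewrite -addr_eq0 -mulr2n mulrn_eq0 /= subr_eq0 => /eqP.
Qed.

(** The exponents x of F satisfy e(Lx) = -1 and those of H satisfy e(Lx) = 1, so H contributes
    nothing to the support of F. *)
Lemma antiperiodic_dominated (L : R) :
  (forall tau, upper tau -> F (tau + L%:C%C) = - F tau) ->
  (forall tau, upper tau -> H (tau + L%:C%C) = H tau) -> dominated F G.
Proof.
move=> FL HL n0 D cF cG D0 hF hG n cn; have hH := qexp_from_diff hF hG FHG.
have e1 : ee (L%:C%C / D%:R) ^ n = -1.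
  apply: (mulfI cn); rewrite (qcoef_translate (z := -1) D0 hF hF) ?mulN1r ?mulrN1 // => tau ut.
  by rewrite FL // mulN1r.
have := qcoef_translate (z := 1) (L := L) D0 hH hH _ n; rewrite e1 mulrN1 mul1r => H1.
have {}H1 : - (cF n - cG n) = cF n - cG n by apply: H1 => tau ut; rewrite mul1r HL.
suff <- : cF n = cG n by [].
by move/eqP: H1; rewrite eq_sym -addr_eq0 -mulr2n mulrn_eq0 /= subr_eq0 => /eqP.
Qed.

(** An exponent x of F has e(Lx)^2 = -1. Were the coefficient of G zero, F and H would share theirs,
    and the relation between them would give e(Lx) = z, of square 1. *)
Lemma quarter_dominated (L : R) (z : C) : z ^+ 2 = 1 ->
  (forall tau, upper tau -> H (tau + L%:C%C) = z * F tau) ->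
  (forall tau, upper tau -> F (tau + (L + L)%:C%C) = - F tau) -> dominated F G.
Proof.
move=> z2 HL FL n0 D cF cG D0 hF hG n cn; have hH := qexp_from_diff hF hG FHG.
have e2 : (ee (L%:C%C / D%:R) ^ n) ^+ 2 = -1.
  rewrite expr2 -expfzMl -eeD -mulrDl -rmorphD /=.
  apply: (mulfI cn); rewrite (qcoef_translate (z := -1) D0 hF hF) ?mulN1r ?mulrN1 // => tau ut.
  by rewrite FL // mulN1r.
have h := qcoef_translate D0 hH hF HL n.
apply/eqP => cG0; move: h; rewrite cG0 subr0 mulrC => /(mulIf cn) zE.
by move/eqP: z2; rewrite -zE e2 eq_sym -addr_eq0 -mulr2n pnatr_eq0.
Qed.

End Comparison.

Section Conclusion.
Context {R : realType}.
Local Notation C := R[i].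
Variables (M : nat) (F G : C -> C) (a kap : int -> C) (n0 : int).
Hypothesis M0 : (0 < M)%N.
Hypothesis Fper : forall tau, upper tau -> F (tau + (M%:R : R)%:C%C) = F tau.
Hypothesis Gexp : qexp_from n0 (M * M) G (fun n => kap n * a n).

Lemma qexp_common (n1 : int) (Q : nat) c : (0 < Q)%N -> qexp_from n1 Q F c ->
  exists nn : int,
    qexp_from nn (Q * (M * M)) F
      (fun n => if ((M * M)%N %| n)%Z then c (n %/ (M * M)%N)%Z else 0) /\
    qexp_from nn (Q * (M * M)) G
      (fun n => if (Q %| n)%Z then kap (n %/ Q)%Z * a (n %/ Q)%Z else 0).
Proof.
move=> Q0 hF; have MM : (0 < M * M)%N by rewrite muln_gt0 M0.
have h1 := qexp_from_stretch MM hF; have := qexp_from_stretch Q0 Gexp.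
rewrite [(M * M * Q)%N]mulnC => h2.
exists (Num.min (n1 * (M * M)%N%:Z) (n0 * Q%:Z)); split.
  by apply: qexp_from_lower h1; rewrite ge_min lexx.
by apply: qexp_from_lower h2; rewrite ge_min lexx orbT.
Qed.

Lemma contains_power_support (x : rat) : dominated F G -> contains_power F x ->
  exists j : int, x = j%:~R / M%:R /\ a (j * M%:Z) != 0.
Proof.
move=> dFG [Q [c [n [Q0 /qexpansionP[n1 hF] cn ->]]]].
have [nn [h1 h2]] := qexp_common Q0 hF.
have QM0 : (0 < Q * (M * M))%N by rewrite !muln_gt0 Q0 M0.
have := qcoef_period Fper (n := n) Q0 hF cn.
rewrite -eeX; have -> : n%:~R * ((M%:R : R)%:C%C / Q%:R) = (n%:~R * M%:R / Q%:R : R)%:C%C :> C.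
  by rewrite !(rmorphM, fmorphV, rmorph_int, rmorph_nat) mulrA.
case/ee_real_eq1/intrP => j jE.
have nM : n * M%:Z = j * Q%:Z.
  apply: (@intr_inj R); rewrite !intrM -!pmulrn -jE divfK //.
  by rewrite pnatr_eq0 -lt0n.
have MMz : (M * M)%N%:Z != 0 by rewrite -lt0n muln_gt0 M0.
(* Over the common denominator Q M^2 the exponent n/Q has index n M^2 = (jM) Q, which picks out the
   coefficient at jM on the side of G. *)
have := dFG _ _ _ _ QM0 h1 h2 (n * (M * M)%N%:Z).
rewrite dvdz_mull // mulzK // => /(_ cn).
have -> : n * (M * M)%N%:Z = j * M%:Z * Q%:Z by rewrite PoszM mulrA nM mulrAC.
rewrite dvdz_mull // mulzK -?lt0n // mulf_eq0 negb_or => /andP[_ aj].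
exists j; split=> //.
have Mr : M%:R != 0 :> rat by rewrite pnatr_eq0 -lt0n.
have Qr : Q%:R != 0 :> rat by rewrite pnatr_eq0 -lt0n.
apply: (mulIf Mr); rewrite divfK // mulrAC; apply: (mulIf Qr); rewrite divfK //.
by have := congr1 (fun x : int => x%:~R : rat) nM; rewrite !intrM -!pmulrn.
Qed.

(** Meromorphy supplies some expansion of F; comparison with G then shows that its coefficient at
    j/M is nonzero. *)
Lemma contains_power_converse (j : int) : meromorphic_at_oo F -> agree_on M F G ->
  kap (j * M%:Z) != 0 -> a (j * M%:Z) != 0 -> contains_power F (j%:~R / M%:R).
Proof.
move=> [Q [c [Q0 /qexpansionP[n1 hF]]]] FG kj aj.
have [nn [h1 h2]] := qexp_common Q0 hF.
have QM0 : (0 < Q * (M * M))%N by rewrite !muln_gt0 Q0 M0.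
have Qc : Q%:R != 0 :> C by rewrite pnatr_eq0 -lt0n.
have Mc : M%:R != 0 :> C by rewrite pnatr_eq0 -lt0n.
exists (Q * (M * M))%N,
  (fun n => if ((M * M)%N %| n)%Z then c (n %/ (M * M)%N)%Z else 0), (j * M%:Z * Q%:Z).
split; first exact: QM0.
- by apply/qexpansionP; exists nn; exact: h1.
- rewrite (FG _ _ _ _ QM0 h1 h2 (j * M%:Z * Q%:Z)).
    by rewrite dvdz_mull // mulzK -?lt0n // mulf_neq0.
  rewrite -eeX -[RHS](ee_int j); congr ee.
  by rewrite !intrM -!pmulrn rmorph_nat !natrM; field; rewrite Qc Mc.
- rewrite !intrM -!pmulrn !natrM; field.
  by rewrite !pnatr_eq0 -!lt0n Q0 M0.
Qed.

End Conclusion.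

(** * Expansions at the cusp 1/m *)

Lemma coprime_prime_dvd (p x y : nat) : prime p -> coprime x y -> (p %| x)%N -> (p %| y)%N -> False.
Proof.
move=> pp cxy px py; have : (p %| gcdn x y)%N by rewrite dvdn_gcd px.
by rewrite (eqP cxy) dvdn1 => /eqP p1; move: pp; rewrite p1.
Qed.

Section CuspExpansion.
Context {R : realType}.
Local Notation C := R[i].
Variables (P : dyadic) (N : nat) (ep : nat -> int) (k : int) (f : C -> C) (a : int -> C).
Hypothesis N0 : (0 < N)%N.
Hypothesis hP : dyadic_ok P N.
Hypothesis hsq : forall p, prime p -> odd p -> (p %| N)%N -> logn p N = 1%N.
Hypothesis hep : forall p, p \in primes N -> ep p = 1 \/ ep p = -1.
Hypothesis fmod : forall A tau, Gamma0 N A -> upper tau ->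
  slash k f A tau = (chiD P N (A 1 1))%:~R * f tau.
Hypothesis van : forall n p, p \in primes N -> chi P p n = - ep p -> a n = 0.
Hypothesis fexp : qexpansion 1 f a.
Variables (e m' M : nat).
Hypothesis NE : N = (e * m' * M)%N.
Hypothesis cop : coprime (e * M) m'.
Hypothesis eM : forall p, prime p -> (p %| e)%N -> (p %| M)%N.

Local Notation F := (cusp_form k f (e * m') 0).

Let M0 : (0 < M)%N. Proof. by move: N0; rewrite NE; case: M; rewrite ?muln0. Qed.

Let uM' : unitary N (e * M).
Proof.
have N1 : (0 < e * m' * M)%N by rewrite -NE.
move: N1; rewrite !muln_gt0 => /andP[/andP[e0 m0] _].
split=> [|p]; first by rewrite muln_gt0 e0.
rewrite !mem_primes => /and3P[pp h pd]; rewrite pp N0.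
have -> : N = (m' * (e * M))%N by rewrite NE; lia.
by split; [rewrite dvdn_mull|rewrite [RHS]logn_Gauss ?(coprime_dvdl pd cop)].
Qed.

Let Fper tau : upper tau -> F (tau + (M%:R : R)%:C%C) = F tau.
Proof. exact: (cusp_form_period N0 hP hsq fmod NE). Qed.

Let twisted : exists (n0 : int) (G : C -> C) (kap : int -> C),
  [/\ (2 \notin primes (e * M) -> forall tau, upper tau -> F tau = G tau),
      (2 \in primes (e * M) -> forall tau, upper tau ->
         F tau = cusp_form k f (e * m') 2^-1 tau + G tau),
      qexp_from n0 (M * M) G (fun n => kap n * a n) &
      (e = 1%N -> forall j : int, kap (j * M%:Z) != 0)].
Proof.
have [n0 fe] := (qexpansionP 1 f a).1 fexp; exists n0.
apply: (cusp_form_twisted_expansion N0 hP hsq hep fmod van fe NE) => //.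
- by move: cop; rewrite coprimeMl => /andP[].
- move=> p pp; rewrite NE !Euclid_dvdM // => /orP[/orP[/(eM pp) ->|->]|->] //; by rewrite orbT.
Qed.

Lemma even_level : (2 %| N)%N -> (4 %| N)%N.
Proof.
move=> N2; have : (2 <= logn 2 N)%N by case: (chi2_cases N0 hP N2) => [[->]|[->]].
by rewrite -pfactor_dvdn.
Qed.

Lemma cusp_expansion_e1 : e = 1%N ->
  (forall A, SL2Z A -> meromorphic_at_oo (slash k f A)) ->
  forall x : rat, contains_power F x <-> exists j : int, x = j%:~R / M%:R /\ a (j * M%:Z) != 0.
Proof.
move=> e1 mer x; have [n0 [G [kap [h1 h2 Ge kap0]]]] := twisted.
have ag : agree_on M F G.
  have [i2|i2] := boolP (2 \in primes (e * M)); last by apply: eq_agree; exact: h1.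
  apply: (antiperiodic_agree (h2 i2)).
  have M2 : (2 %| M)%N by move: (i2); rewrite mem_primes e1 mul1n => /and3P[].
  (* The antiperiod needs m odd and 4 dividing M: M is even and prime to m, and an even level is
     divisible by 4. *)
  have om : odd m'.
    rewrite -[odd m']negbK -dvdn2; apply/negP => m2.
    by move: cop; rewrite e1 mul1n => cop'; exact: (@coprime_prime_dvd 2 M m').
  have M4 : (4 %| M)%N.
    have : (4 %| m' * M)%N by rewrite -[(m' * M)%N](_ : N = _) ?even_level ?NE ?dvdn_mull // e1 mul1n.
    by rewrite Gauss_dvdr // (@coprimeXl 2 2) // coprime2n.
  have ME : M = (4 * (M %/ 4))%N by rewrite mulnC divnK.
  move=> tau ut; apply: (cusp_form_half_antiperiod N0 hP hsq fmod NE ME) => //.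
  by rewrite e1 mul1n.
split=> [|[j [-> aj]]].
  have dom := agree_dominated Fper ag.
  exact: (contains_power_support M0 Fper Ge dom).
suff mF : meromorphic_at_oo F by exact: (contains_power_converse M0 Ge mF ag (kap0 e1 j) aj).
have S : SL2Z (mx2 1 0 (e * m')%N%:Z 1) by rewrite /SL2Z det2 !mxE /=; ring.
have [Q [c [Q0 [n1 [c0 H]]]]] := mer _ S; exists Q, c.
split; [exact: Q0|exists n1; split; first exact: c0].
move=> tau ut.
have -> : F tau = slash k f (mx2 1 0 (e * m')%N%:Z 1) tau.
  by rewrite /slash !mxE /= /cusp_form rmorph0 addr0 mulr1z mul1r mulr0z addr0 -pmulrn.
exact: H.
Qed.

Lemma cusp_expansion_half (c : nat) : M = (2 * c)%N -> odd m' ->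
  e = 2%N \/ (e = 4%N /\ odd c) ->
  forall x : rat, contains_power F x -> exists j : int, x = j%:~R / M%:R /\ a (j * M%:Z) != 0.
Proof.
move=> ME om ecase x; have [n0 [G [kap [h1 h2 Ge kap0]]]] := twisted.
have i2 : 2%N \in primes (e * M).
  by rewrite mem_primes /= ME mulnCA dvdn_mulr // muln_gt0; case: ecase => [->|[-> _]]; lia.
suff dom : dominated F G by exact: (contains_power_support M0 Fper Ge dom).
case: ecase => [e2|[e4 oc]].
  apply: (antiperiodic_dominated (h2 i2)) (c%:R) _ _ => tau ut.
    by apply: (cusp_form_antiperiod N0 hP hsq fmod NE ME _ ut (n := m')); rewrite e2.
  by apply: (cusp_form_half_period N0 hP hsq fmod NE ME _ om ut); rewrite e2.
apply: (quarter_dominated (h2 i2)) (c%:R / 2) (chiD P N (1 + (2 * (m' * c))%N%:Z))%:~R _ _ _ => [|tau ut|tau ut].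
- rewrite -rmorphXn (chiD_sqr N0 hP (m := N)) //.
  apply/coprimezP; set t := (2 * (m' * c))%N%:Z.
  (* The identity (1 - t)(1 + t^2)(1 + t) = 1 - t^4, where t^4 = 16 (m'c)^4 = 2 (m'c)^3 N because N
     = 8m'c. *)
  exists ((1 - t) * (1 + t ^+ 2), 2 * (m' * c)%N%:Z ^+ 3) => /=.
  by rewrite /t NE e4 ME !PoszM; ring.
- by apply: (cusp_form_half_quarter N0 fmod NE ME oc _ om ut); rewrite e4.
- have -> : c%:R / 2 + c%:R / 2 = c%:R :> R by lra.
  by apply: (cusp_form_antiperiod N0 hP hsq fmod NE ME _ ut (n := 2 * m')); rewrite e4; lia.
Qed.

End CuspExpansion.

(** * Reduction to the cusp 1/m *)

Lemma mulmx2E (K : pzSemiRingType) (A B : 'M[K]_2) i j :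
  (A *m B) i j = A i 0 * B 0 j + A i 1 * B 1 j.
Proof.
rewrite !mxE !big_ord_recl big_ord0 addr0.
by congr (_ + A _ _ * B _ _); apply: val_inj.
Qed.

Lemma SL2Z_mul A B : SL2Z A -> SL2Z B -> SL2Z (A *m B).
Proof. by rewrite /SL2Z det_mulmx => -> ->; rewrite mulr1. Qed.

Lemma cusp_act_mul A B : SL2Z B -> cusp_act (A *m B) None = cusp_act A (cusp_act B None).
Proof.
rewrite /SL2Z det2 /cusp_act !mulmx2E => dB.
have [c0|c0] := eqVneq ((B 1 0)%:~R : rat) 0.
  have Bc : B 1 0 = 0 by apply/eqP; rewrite -(intr_eq0 rat) c0.
  have a0 : (B 0 0)%:~R != 0 :> rat.
    rewrite intr_eq0; apply/eqP => a0; move: dB; rewrite Bc a0 mul0r mulr0 subrr => /eqP.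
    by rewrite eq_sym oner_eq0.
  rewrite Bc !mulr0 !addr0 !intrM mulf_eq0 (negPf a0) orbF.
  by case: eqP => // /eqP c; rewrite -mulf_div divff // mulr1.
have d (u v : int) : u%:~R * ((B 0 0)%:~R / (B 1 0)%:~R) + v%:~R =
    (u * B 0 0 + v * B 1 0)%:~R / (B 1 0)%:~R :> rat.
  by rewrite intrD !intrM mulrDl mulfK // mulrA.
rewrite !d mulf_eq0 invr_eq0 (negPf c0) orbF; case: eqP => // _.
by rewrite invf_div mulrA divfK.
Qed.

Section Reduction.
Variables (N m : nat).
Hypothesis m0 : (0 < m)%N.

(** Some g in Gamma_0(N) makes gA send infinity to 1/m. Such a matrix is [1 0; m 1] [1 j; 0 1] up to
    sign, and multiplying by the inverse of g recovers A. *)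
Lemma cusp_reduction (A : 'M[int]_2) (t : cusp) : SL2Z A ->
  cusp_equiv N (cusp_act A None) t -> cusp_equiv N t (Some m%:R^-1) ->
  exists (a b c d : int) (s : bool) (j : int),
  [/\ a * d - b * c = 1, (N %| c)%Z,
      A 0 0 = (-1) ^+ s * (a + b * m%:Z) /\ A 1 0 = (-1) ^+ s * (c + d * m%:Z),
      A 0 1 = (-1) ^+ s * (a * j + b * (m%:Z * j + 1)) &
      A 1 1 = (-1) ^+ s * (c * j + d * (m%:Z * j + 1))].
Proof.
move=> SA [g1 [S1 N1] e1] [g2 [S2 N2] e2].
pose g := g2 *m g1; have Sg : SL2Z g := SL2Z_mul S2 S1.
have Ng : (N %| g 1%R 0%R)%Z.
  by rewrite mulmx2E; apply: rpredD; [exact: dvdz_mulr|exact: dvdz_mull].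
pose dl := g *m A; have Sd : SL2Z dl := SL2Z_mul Sg SA.
have dinf : cusp_act dl None = Some m%:R^-1.
  by rewrite /dl /g -mulmxA !cusp_act_mul ?e1 ?e2 //; exact: SL2Z_mul.
have mr : m%:R != 0 :> rat by rewrite pnatr_eq0 -lt0n.
have d10 : dl 1 0 = m%:Z * dl 0 0.
  move: dinf; rewrite /cusp_act; case: eqP => // /eqP c0 [H].
  apply: (@intr_inj rat); rewrite intrM -pmulrn.
  have h : (dl 0 0)%:~R = m%:R^-1 * (dl 1 0)%:~R :> rat by rewrite -H divfK.
  by rewrite h mulVKf.
move: Sd Sg SA; rewrite /SL2Z !det2 => Sd Sg SA.
have [s d00] : exists s : bool, dl 0 0 = (-1) ^+ s.
  have H : dl 0 0 * (dl 1 1 - m%:Z * dl 0 1) = 1 by rewrite -Sd d10; ring.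
  have : `|dl 0%R 0%R|%N == 1%N by rewrite -(dvdz1); apply/dvdzP; exists (dl 1 1 - m%:Z * dl 0 1); rewrite mulrC H.
  move=> h; have [->|->] : dl 0 0 = 1 \/ dl 0 0 = -1 by lia.
    by exists false.
  by exists true.
have ss : (-1) ^+ s * (-1) ^+ s = 1 :> int by rewrite -expr2 sqrr_sign.
have d11 : dl 1 1 = (-1) ^+ s + m%:Z * dl 0 1.
  have : (-1) ^+ s * (dl 1 1 - m%:Z * dl 0 1) = 1 by rewrite -d00 -Sd d10; ring.
  by move/(congr1 ( *%R ((-1) ^+ s))); rewrite mulrA ss mul1r mulr1 => <-; rewrite subrK.
have dlE i j : dl i j = g i 0 * A 0 j + g i 1 * A 1 j by exact: mulmx2E.
clearbody dl; clearbody g.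
have A0 i : A 0 i = g 1 1 * dl 0 i - g 0 1 * dl 1 i.
  by rewrite !dlE -[LHS]mul1r -[X in X * _ = _]Sg; ring.
have A1 i : A 1 i = - g 1 0 * dl 0 i + g 0 0 * dl 1 i.
  by rewrite !dlE -[LHS]mul1r -[X in X * _ = _]Sg; ring.
have [j d01] : exists j, dl 0 1 = (-1) ^+ s * j.
  by exists ((-1) ^+ s * dl 0 1); rewrite mulrA ss mul1r.
exists (g 1 1), (- g 0 1), (- g 1 0), (g 0 0), s, j.
split; rewrite ?rpredN //.
- by rewrite -Sg; ring.
- by rewrite A0 A1 d10 d00; split; ring.
- by rewrite A0 d11 d01; ring.
- by rewrite A1 d11 d01; ring.
Qed.

(** The conjugate has lower left entry -c^2 h, with c the lower left entry of A. *)
Lemma parabolic_Gamma0 (A : 'M[int]_2) (h : nat) : SL2Z A ->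
  Gamma0 N (A *m translation h *m invmx A) <-> (N %| A 1%R 0%R ^+ 2 * h%:Z)%Z.
Proof.
move=> SA; have uA : A \in unitmx by rewrite unitmxE SA unitr1.
set Y := _ *m invmx A.
have YA : Y *m A = A *m translation h by rewrite mulmxKV.
have SY : SL2Z Y.
  have : \det (Y *m A) = 1 by rewrite YA det_mulmx SA det2 !mxE /=; ring.
  by rewrite det_mulmx SA mulr1.
clearbody Y; have E0 := congr1 (fun X : 'M[int]_2 => X 1 0) YA;
  have E1 := congr1 (fun X : 'M[int]_2 => X 1 1) YA.
rewrite /= !mulmx2E ![translation _ _ _]mxE /= in E0 E1.
have Y10 : Y 1 0 = - (A 1 0 ^+ 2 * h%:Z).
  move: (SA); rewrite /SL2Z det2 => dA.
  have -> : Y 1 0 = A 1 1 * (Y 1 0 * A 0 0 + Y 1 1 * A 1 0) - A 1 0 * (Y 1 0 * A 0 1 + Y 1 1 * A 1 1).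
    by rewrite -[LHS]mulr1 -dA; ring.
  by rewrite E0 E1; ring.
by split=> [[_]|d]; [|split=> //]; rewrite Y10 rpredN.
Qed.

(** By the reduction, the lower left entry of any matrix sending infinity to t is a unit times m
    modulo N, so the criterion depends on m alone. *)
Lemma cusp_period_iff (t : cusp) (h : nat) : cusp_equiv N t (Some m%:R^-1) -> cusp_period N t h ->
  forall h', cusp_period N t h' <-> (0 < h')%N /\ (N %| m ^ 2 * h')%N.
Proof.
move=> tm [_ [A [SA At] _]].
have refl_t : cusp_equiv N t t.
  exists 1%:M; first by split; [rewrite /SL2Z det1|rewrite !mxE dvdz0].
  case: t {tm At} => [x|]; rewrite /cusp_act !mxE /= ?mul0r ?add0r ?oner_eq0 //.
  by rewrite mul1r addr0 divr1.
have key B h' : SL2Z B -> cusp_act B None = t ->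
    (N %| B 1%R 0%R ^+ 2 * h'%:Z)%Z = (N %| m ^ 2 * h')%N.
  move=> SB Bt; have rB : cusp_equiv N (cusp_act B None) t by rewrite Bt.
  have [a [b [c [d [s [j [D1 Nc [_ B10] _ _]]]]]]] := cusp_reduction SB rB tm.
  have cd : coprimez N d.
    apply/coprimezP; have [q cE] := dvdzP Nc; exists (- b * q, a) => /=.
    by rewrite -D1 cE; ring.
  rewrite B10 exprMn sqrr_sign mul1r.
  have -> : (c + d * m%:Z) ^+ 2 * h'%:Z =
      c * ((c + 2 * d * m%:Z) * h'%:Z) + d * (d * (m ^ 2 * h')%N%:Z).
    by rewrite PoszM -mulnn PoszM; ring.
  rewrite rpredDl; last exact: dvdz_mulr.
  by rewrite !Gauss_dvdzr.
move=> h'; split=> [[h0 [B [SB Bt]]]|[h0 d]].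
  by move/(parabolic_Gamma0 _ SB); rewrite (key _ _ SB Bt).
by split=> //; exists A => //; apply/(parabolic_Gamma0 _ SA); rewrite (key _ _ SA At).
Qed.

End Reduction.

Section Transfer.
Context {R : realType}.
Local Notation C := R[i].

Lemma contains_power_translate (g F : C -> C) (z : C) (b : R) x : z != 0 ->
  (forall tau, upper tau -> g tau = z * F (tau + b%:C%C)) ->
  contains_power F x -> contains_power g x.
Proof.
move=> z0 gF [Q [c [n [Q0 /qexpansionP[n1 hF] cn ->]]]].
exists Q, (fun n => z * (c n * ee (b%:C%C / Q%:R) ^ n)), n.
split; [exact: Q0| | |by []].
  apply/qexpansionP; exists n1.
  apply: eq_qexp_from (qexp_fromZ z (qexp_from_translate b hF)) => [tau ut|n' //].
  by rewrite gF.
by rewrite !mulf_neq0 // expfz_neq0 // ee_neq0.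
Qed.

(** The two functions differ by a nonzero constant and an integral translation, which multiplies
    each coefficient by a nonzero number. *)
Lemma contains_power_slash (N m : nat) k (psi : int -> int) (f : C -> C) (A : 'M[int]_2) t x :
  (0 < m)%N -> SL2Z A ->
  (forall A tau, Gamma0 N A -> upper tau -> slash k f A tau = (psi (A 1 1))%:~R * f tau) ->
  (forall d, coprimez d N -> psi d != 0) ->
  cusp_equiv N (cusp_act A None) t -> cusp_equiv N t (Some m%:R^-1) ->
  contains_power (slash k f A) x <-> contains_power (cusp_form k f m 0) x.
Proof.
move=> m0 SA fmod psi0 At tm.
have [a [b [c [d [s [j [D1 Nc [A00 A10] A01 A11]]]]]]] := cusp_reduction m0 SA At tm.
have E tau (ut : upper tau) := slash_cusp_form fmod D1 Nc ut A00 A10 A01 A11.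
set z := ((-1) ^+ s) ^ (- k) * (psi d)%:~R in E.
have z0 : z != 0.
  rewrite mulf_neq0 ?expfz_neq0 ?signr_eq0 // intr_eq0 psi0 //.
  apply/coprimezP; have [q cE] := dvdzP Nc; exists (a, - b * q) => /=.
  by rewrite -D1 cE; ring.
split; last exact: (contains_power_translate z0 E).
apply: (@contains_power_translate _ _ z^-1 (- j%:~R)); first by rewrite invr_eq0.
move=> tau ut; rewrite E; last exact: upper_translate.
by rewrite mulKf // -addrA -rmorphD /= addNr rmorph0 addr0.
Qed.

End Transfer.

(** * The main theorem *)

Section LevelData.
Variables (D : finZmodType) (q : D -> rat) (P : dyadic) (delta : nat -> int) (N : nat).
Hypothesis hD : discriminant_form q.
Hypothesis hodd : odd_shape q delta.
Hypothesis h2 : dyadic_shape q P.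
Hypothesis hN : is_level q N.

Lemma level_gt0 : (0 < N)%N. Proof. by case: hN. Qed.

Lemma kroneckerN1_unit (n : int) : n \in [:: 1; -1; 3; -3] ->
  kronecker (-1) n = 1 \/ kronecker (-1) n = -1.
Proof.
have p3 : primes 3 = [:: 3%N] by [].
have l3 : legendre (-1) 3 = 1 \/ legendre (-1) 3 = -1.
  have : legendre (-1) 3 != 0 by rewrite legendre_eq0.
  by case: (legendre_cases 3 (-1)) => ->; [|left|right].
have [l|l] := l3; rewrite !inE => /or4P[] /eqP ->;
  rewrite /kronecker /= ?big_nil ?p3 ?big_seq1 /= ?l; by [left|right].
Qed.

Lemma level_dyadic_ok : dyadic_ok P N.
Proof.
have := dyadic_level hD hN h2; move: h2; rewrite /dyadic_ok; case: P => // t1 t2 [H1 H2 _] ->.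
split=> //; apply: kroneckerN1_unit; move: H1 H2.
by rewrite !inE => /orP[]/eqP -> /or4P[]/eqP ->.
Qed.

Lemma level_squarefree p : prime p -> odd p -> (p %| N)%N -> logn p N = 1%N.
Proof. by move=> pp po pN; case: (odd_level hD pp po hN hodd pN). Qed.

(** The argument of each local character is prime to p: 2N/p because an odd p divides N once, and
    Nt/8 or t2 N/8 because the 2-part of N is 4 with t/2 odd, or 8 with t2 odd. *)
Lemma eps_unit p : p \in primes N -> eps P delta N p = 1 \/ eps P delta N p = -1.
Proof.
move=> pn; have N0 := level_gt0; have ok := level_dyadic_ok.
have sq (u : int) : ~~ (p %| u)%Z -> chi P p u = 1 \/ chi P p u = -1.
  move=> pu; have := chi_sqr N0 ok u pn; rewrite pu => /eqP.
  by rewrite sqrf_eq1 => /orP[]/eqP ->; [left|right].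
move: (pn); rewrite mem_primes => /and3P[pp _ pN].
case: (even_prime pp) => [p2|po].
  have sq2 (u : int) : odd `|u|%N -> chi2 P u = 1 \/ chi2 P u = -1.
    by move=> ou; have := sq u; rewrite p2 /chi /=; apply; rewrite dvdzE dvdn2 negbK.
  have [c oc NE] := @pfactor_coprime 2 N isT N0.
  rewrite coprime2n in oc; rewrite p2 in pN.
  have lE := dyadic_level hD hN h2; have L2 := even_level N0 ok pN.
  rewrite /eps p2 /=; case: P h2 lE sq2 {ok sq} => [_ lE _|t [Ht _] lE sq2|t1 t2 [_ Ht _] lE sq2].
  - by left.
  - rewrite lE in NE; move: Ht; rewrite !inE => Ht; apply: sq2.
    by case/orP: Ht => /eqP ->; rewrite NE; lia.
  - rewrite lE in NE; move: Ht; rewrite !inE => Ht; apply: sq2.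
    by case/or4P: Ht => /eqP ->; rewrite NE; lia.
have [l1 dp] := odd_level hD pp po hN hodd pN.
rewrite /eps; case: eqP po => [->//|_ po].
have pu : ~~ (p %| ((2 * N) %/ p)%N%:Z)%Z.
  rewrite dvdzE /=; apply/negP => H.
  have : (p ^ 2 %| 2 * N)%N.
    by rewrite -(divnK (dvdn_mull 2 pN)) mulnC expnS expn1 dvdn_pmul2l ?prime_gt0.
  rewrite Gauss_dvdr; last by rewrite coprimeXl // coprimen2.
  by rewrite pfactor_dvdn // l1.
by case: (sq _ pu) => ->; case: dp => ->; [left|right|right|left].
Qed.

End LevelData.

(** The odd part of N is squarefree, so m1 and its odd cofactor w share no prime. *)
Lemma odd_part_coprime (N m1 : nat) : (0 < N)%N ->
  (forall p, prime p -> odd p -> (p %| N)%N -> logn p N = 1%N) ->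
  odd m1 -> (m1 %| N)%N ->
  exists2 w, N = (N`_2 * m1 * w)%N & odd w /\ coprime m1 w.
Proof.
move=> N0 sqf om1 mN.
have o2 : coprime (N`_2)%N m1 by rewrite p_part coprimeXl // coprime2n.
have d : (N`_2 * m1 %| N)%N by rewrite Gauss_dvd // dvdn_part mN.
exists (N %/ (N`_2 * m1))%N; first by rewrite mulnC divnK.
have [w wE] := dvdnP d; have wq : (N %/ (N`_2 * m1) = w)%N.
  by rewrite {1}wE mulnK // muln_gt0 part_gt0; case: m1 om1 {mN o2 d wE}.
rewrite wq; have ow : odd w.
  rewrite -[odd w]negbK -dvdn2; apply/negP => w2.
  have : (2 ^ (logn 2 N).+1 %| N)%N by rewrite [X in (_ %| X)%N]wE expnS p_part -?mulnA dvdn_mul // dvdn_mulr.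
  by rewrite pfactor_dvdn // ltnn.
split=> //; rewrite /coprime; apply/negPn/negP => h.
have g0 : (0 < gcdn m1 w)%N by rewrite gcdn_gt0; case: m1 om1 {mN o2 d wE wq h}.
have pp : prime (pdiv (gcdn m1 w)) by apply: pdiv_prime; lia.
have pg := pdiv_dvd (gcdn m1 w); set p := pdiv _ in pp pg.
have pm := dvdn_trans pg (dvdn_gcdl _ _); have pw := dvdn_trans pg (dvdn_gcdr _ _).
have po : odd p.
  case: (even_prime pp) => // p2; move: pm; rewrite p2 dvdn2 om1 //.
have : (p ^ 2 %| N)%N.
  by rewrite wE expnS expn1 dvdn_mul // dvdn_mull.
by rewrite pfactor_dvdn // sqf // (dvdn_trans pm).
Qed.

Lemma cusp_width_eq (N m : nat) (s : cusp) (h g : nat) : (0 < m)%N -> (0 < g)%N ->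
  cusp_width N s h -> cusp_equiv N s (Some m%:R^-1) ->
  (forall h', (N %| m ^ 2 * h')%N = (g %| h')%N) -> h = g.
Proof.
move=> m0 g0 [per min] sm H.
have iff := cusp_period_iff m0 sm per.
have [h0 dh] := (iff h).1 per; rewrite H in dh.
apply/eqP; rewrite eqn_leq (dvdn_leq h0 dh) andbT; apply: min.
by apply/iff; rewrite H dvdnn.
Qed.

Theorem proposition3p4 (R : realType)
  (D : finZmodType) (q : D -> rat) (P : dyadic) (delta : nat -> int)
  (N : nat) (r k : int)
  (f : R[i] -> R[i]) (a : int -> R[i])
  (s : cusp) (h : nat) (alpha : 'M[int]_2) (m1 : nat)
  (hD : discriminant_form q)
  (hodd : odd_shape q delta) (h2 : dyadic_shape q P)
  (hN : is_level q N)
  (hr : has_signature q r) (hreven : (2 %| r)%Z)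
  (hk : (k = (r %/ 2)%Z %[mod 2])%Z)
  (hf : Aeps N k P delta f a)
  (hh : cusp_width N s h)
  (halpha : SL2Z alpha) (hs : cusp_equiv N (cusp_act alpha None) s)
  (hm1pos : (0 < m1)%N) (hm1odd : odd m1) (hm1 : (m1 %| N)%N) :
  [/\ forall m : nat, m = m1 \/ m = (N`_2 * m1)%N ->
        cusp_equiv N s (Some (m%:R^-1)) ->
        forall x : rat, contains_power (slash k f alpha) x <->
          exists n : int, x = n%:~R / h%:R /\ a (n * (N %/ m)%N%:Z) != 0,
      (4 %| N)%N -> cusp_equiv N s (Some ((2 * m1)%N%:R^-1)) ->
        forall x : rat, contains_power (slash k f alpha) x ->
          exists n : int, x = n%:~R / 2 / h%:R /\
            a (n * (N %/ (2 * m1))%N%:Z) != 0 &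
      (8 %| N)%N -> cusp_equiv N s (Some ((4 * m1)%N%:R^-1)) ->
        forall x : rat, contains_power (slash k f alpha) x ->
          exists n : int, x = n%:~R / 2 / h%:R /\
            a (n * (N %/ (4 * m1))%N%:Z) != 0].
Proof.
case: hf => [[_ fmod fmer] fexp van].
have N0 := level_gt0 hN; have hP := level_dyadic_ok hD h2 hN.
have sqf := level_squarefree hD hodd hN.
have hep := eps_unit hD hodd h2 hN.
have [w NE [ow cmw]] := odd_part_coprime N0 sqf hm1odd hm1.
have w0 : (0 < w)%N by case: w ow {NE cmw}.
have psi0 d : coprimez d N -> chiD P N d != 0.
  move=> cd; apply/eqP => h0; have := chiD_sqr N0 hP (m := N) (conj N0 (fun p pn => conj pn erefl)) cd.
  by rewrite h0.
have exp1 (m M : nat) : (0 < m)%N -> N = (m * M)%N -> coprime M m ->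
    cusp_equiv N s (Some (m%:R^-1)) -> forall x : rat, contains_power (slash k f alpha) x <->
    exists n : int, x = n%:~R / h%:R /\ a (n * (N %/ m)%N%:Z) != 0.
  move=> m0 NmM cMm sm x.
  have M0 : (0 < M)%N by move: N0; rewrite NmM muln_gt0 => /andP[].
  have -> : h = M.
    apply: (cusp_width_eq m0 M0 hh sm) => h'.
    by rewrite NmM expnS expn1 -mulnA dvdn_pmul2l // Gauss_dvdr.
  have -> : (N %/ m = M)%N by rewrite NmM mulKn.
  rewrite (contains_power_slash x m0 halpha fmod psi0 hs sm) -[m in cusp_form _ _ m _]mul1n.
  apply: (cusp_expansion_e1 N0 hP sqf hep fmod van fexp (M := M)) => //; rewrite ?mul1n //.
  by move=> p pp; rewrite dvdn1 => /eqP p1; rewrite p1 in pp.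
have exp2 (e c : nat) : (0 < e)%N -> N = (e * m1 * (2 * c))%N -> coprime c m1 ->
    e = 2%N \/ (e = 4%N /\ odd c) ->
    cusp_equiv N s (Some ((e * m1)%N%:R^-1)) -> forall x : rat, contains_power (slash k f alpha) x ->
    exists n : int, x = n%:~R / 2 / h%:R /\ a (n * (N %/ (e * m1))%N%:Z) != 0.
  move=> e0 Ne ccm ecase sm x.
  have em0 : (0 < e * m1)%N by rewrite muln_gt0 e0.
  have c0 : (0 < c)%N by move: N0; rewrite Ne !muln_gt0 => /and3P[].
  have co2 : coprime (2 * c) m1 by rewrite coprimeMl ccm coprime2n hm1odd.
  (* The width is half of N/m = 2c, so the exponents j/(2c) from the expansion read (j/2)/h. *)
  have -> : h = c.
    apply: (cusp_width_eq em0 c0 hh sm) => h'.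
    rewrite Ne expnS expn1 -[(e * m1 * (e * m1) * h')%N]mulnA dvdn_pmul2l //.
    rewrite [(e * m1)%N]mulnC -mulnA Gauss_dvdr //.
    case: ecase => [->|[-> oc]]; first by rewrite dvdn_pmul2l.
    by rewrite -[4%N]/(2 * 2)%N -mulnA dvdn_pmul2l // Gauss_dvdr // coprimen2.
  have -> : (N %/ (e * m1) = 2 * c)%N by rewrite Ne mulKn.
  rewrite (contains_power_slash x em0 halpha fmod psi0 hs sm) => Hx.
  have [||j [-> aj]] := cusp_expansion_half N0 hP sqf hep fmod van fexp Ne _ _ erefl hm1odd ecase Hx.
  - rewrite mulnCA coprimeMl coprime2n hm1odd coprimeMl ccm andbT.
    case: ecase => [->|[-> _]]; first by rewrite coprime2n.
    by rewrite (@coprimeXl 2 2) // coprime2n.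
  - move=> p pp pe; have : (p %| 2 ^ 2)%N by case: ecase pe => [->|[-> _]] // pe; rewrite (dvdn_trans pe).
    by rewrite Euclid_dvdX // => /andP[p2 _]; rewrite dvdn_mulr.
  exists j; split=> //.
  by rewrite natrM invfM mulrA.
have N2 : (N`_2)%N = (2 ^ logn 2 N)%N by rewrite p_part.
split.
- move=> m [->|->] sm.
    apply: (exp1 m1 (N`_2 * w)%N) => //; first by rewrite {1}NE; lia.
    by rewrite coprimeMl p_part coprimeXl ?coprime2n // coprime_sym.
  apply: (exp1 (N`_2 * m1)%N w) => //; first by rewrite muln_gt0 part_gt0.
  by rewrite coprimeMr coprime_sym p_part coprimeXl ?coprime2n // coprime_sym.
- move=> N4 sm; have l2 : (2 <= logn 2 N)%N by rewrite -pfactor_dvdn.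
  apply: (exp2 2%N (2 ^ (logn 2 N - 2) * w)%N) => //; last by left.
    have e4 : (2 ^ logn 2 N = 4 * 2 ^ (logn 2 N - 2))%N by rewrite -[4%N]/(2 ^ 2)%N -expnD subnKC.
    by rewrite {1}NE N2 e4; lia.
  by rewrite coprimeMl coprimeXl ?coprime2n // coprime_sym.
- move=> N8 sm; have l3 : (3 <= logn 2 N)%N by rewrite -pfactor_dvdn.
  (* The 2-part is exactly 8, so N = 4 m1 (2w) with w odd, as the case e = 4 requires. *)
  have l3' : logn 2 N = 3%N by have := dyadic_level hD hN h2; case: (P) => [|t|t1 t2] lE; lia.
  apply: (exp2 4%N w) => //; last by right.
    by rewrite {1}NE N2 l3'; lia.
  by rewrite coprime_sym.
Qed.
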